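(* Fix $t\in[0,1]$. Assume that for every $s\in[0,t]$ the function $x\mapsto\partial_s\log\tilde\rho_\ast(x,s)$ is integrable with respect to $\rho_\ast(\cdot,s)$, and that: (1) for every $s\in[0,t]$, $\rho_\theta(\cdot,s)$ dominates $\rho_\ast(\cdot,s)$ (i.e. $\rho_\theta(x,s)>0$ whenever $\rho_\ast(x,s)>0$); (2) there exist constants $M_1,M_2<\infty$ with $\lvert\tilde w(s;x_0)\rvert<M_1$ for all $s,x_0$ and $\lvert\partial_s\log\tilde\rho_\ast(x,s)\rvert<M_2$ for all $x,s$. Let $x_0^{(1)},x_0^{(2)},\dots$ be i.i.d. samples from $\mu$ and, for $s\in[0,t]$, $$W_N(s):=\sum_{i=1}^N w_i(s)\,\partial_s\log\tilde\rho_\ast\big(x^{(i)}(s),s\big).$$ Then $$\int_0^t W_N(s)\,ds\;\xrightarrow{\text{a.s.}}\;\log\mathcal{Z}(t)\qquad\text{as }N\to\infty.$$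
   Context: Let $D\ge1$. Let $\tilde\rho_\ast:\mathbb{R}^D\times[0,1]\to(0,\infty)$ be a smooth unnormalized time-dependent density with $\mathcal{Z}(t):=\int\tilde\rho_\ast(x,t)\,dx<\infty$, $\rho_\ast(x,t):=\tilde\rho_\ast(x,t)/\mathcal{Z}(t)$, and with $\tilde\rho_\ast(\cdot,0)=\mu$ a normalized probability density (so $\mathcal{Z}(0)=1$). Score: $S_\ast(x,t):=\nabla_x\log\tilde\rho_\ast(x,t)$. Define $g(x,t):=\partial_t\log\tilde\rho_\ast(x,t)-\mathbb{E}_{x'\sim\rho_\ast(\cdot,t)}[\partial_t\log\tilde\rho_\ast(x',t)]$. Let $v_\theta:\mathbb{R}^D\times[0,1]\to\mathbb{R}^D$ be a smooth velocity field, globally Lipschitz in $x$. For $x_0\in\mathbb{R}^D$, let $x(t;x_0)$ denote the solution of $\dot x(t)=v_\theta(x(t),t)$, $x(0)=x_0$. Let $\rho_\theta(\cdot,t)$ be the density of $x(t;x_0)$ when $x_0\sim\mu$, equivalently the solution of $\partial_t\rho_\theta=-\nabla_x\cdot(v_\theta\rho_\theta)$, $\rho_\theta(\cdot,0)=\mu$. Define the error $$\varepsilon(x,t):=\nabla_x\cdot v_\theta(x,t)+S_\ast(x,t)\cdot v_\theta(x,t)+g(x,t),$$ the unnormalized weight $\tilde w(t;x_0):=\exp\!\big(\int_0^t\varepsilon(x(s;x_0),s)\,ds\big)$, and, for samples $x_0^{(1)},\dots,x_0^{(N)}$, $x^{(i)}(t):=x(t;x_0^{(i)})$ and normalized weights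 $w_i(t):=\tilde w(t;x_0^{(i)})/\sum_{j=1}^N\tilde w(t;x_0^{(j)})$. *)

(* Defs.v *)
From HB Require Import structures.
From mathcomp Require Import all_boot all_order all_algebra.
From mathcomp Require Import all_classical all_reals all_analysis.
Set Implicit Arguments. Unset Strict Implicit. Unset Printing Implicit Defensive.
Import Order.TTheory GRing.Theory Num.Theory.
Import numFieldNormedType.Exports.
Local Open Scope classical_set_scope.
Local Open Scope ring_scope.

Section Defs.
Variable R : realType.

Fixpoint Ck {V W : normedModType R} (k : nat) (f : V -> W) : Prop :=
  match k with
  | 0 => continuous f
  | k'.+1 => (forall x v, derivable f x v) /\ (forall v, Ck k' ('D_v f))
  end.
Definition smooth {V W : normedModType R} (f : V -> W) : Prop :=
  forall k, Ck k f.

Definition basis_vec (D : nat) (j : 'I_D) : 'rV[R]_D := delta_mx 0 j.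

Definition partial (D : nat) (j : 'I_D) (f : 'rV[R]_D -> R) (x : 'rV[R]_D) : R :=
  'D_(basis_vec j) f x.

Definition grad (D : nat) (f : 'rV[R]_D -> R) (x : 'rV[R]_D) : 'rV[R]_D :=
  \row_(j < D) partial j f x.
Definition div (D : nat) (v : 'rV[R]_D -> 'rV[R]_D) (x : 'rV[R]_D) : R :=
  \sum_(j < D) partial j (fun y => v y 0 j) x.
Definition dotv (D : nat) (a b : 'rV[R]_D) : R := \sum_(j < D) a 0 j * b 0 j.

(** bridge to tuples, which carry the product (= Borel) sigma-algebra *)
Definition tup (D : nat) (x : 'rV[R]_D) : D.-tuple R := [tuple x 0 j | j < D].
Definition untup (D : nat) (t : D.-tuple R) : 'rV[R]_D := \row_(j < D) tnth t j.

Definition cons_row (n : nat) (a : R) (y : 'rV[R]_n) : 'rV[R]_n.+1 :=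
  \row_(i < n.+1) match unlift ord0 i with Some j => y 0 j | None => a end.

(** Lebesgue integral over R^n, as the iterated integral
    int dx_1 ... int dx_n f(x_1,...,x_n) (Tonelli/Fubini). *)
Fixpoint lebRn (n : nat) : ('rV[R]_n -> \bar R) -> \bar R :=
  match n return ('rV[R]_n -> \bar R) -> \bar R with
  | 0 => fun f => f 0
  | n'.+1 => fun f =>
      (\int[@lebesgue_measure R]_(a in setT)
         lebRn (fun y => f (cons_row a y)))%E
  end.

Definition borel_fun (D : nat) (f : 'rV[R]_D -> R) : Prop :=
  measurable_fun [set: D.-tuple R] (fun t => f (untup t)).

Definition ind_tup (D : nat) (A : set (D.-tuple R)) (x : 'rV[R]_D) : R :=
  if `[< A (tup x) >] then 1 else 0.

Definition mutually_independent {d d'} {Omega : measurableType d}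
  {T : measurableType d'} (P : probability Omega R) (X : nat -> Omega -> T) :=
  forall (I : seq nat) (A : nat -> set T), uniq I ->
    (forall i, i \in I -> measurable (A i)) ->
    P (\big[setI/setT]_(i <- I) (X i @^-1` A i)) =
    (\big[*%E/1%E]_(i <- I) P (X i @^-1` A i))%E.

Variables (D : nat) (rho : 'rV[R]_D -> R -> R) (v : 'rV[R]_D -> R -> 'rV[R]_D).

Definition Zc (t : R) : \bar R := lebRn (fun x => (rho x t)%:E).
Definition rho_star (x : 'rV[R]_D) (t : R) : R := rho x t / fine (Zc t).
Definition dtlog (x : 'rV[R]_D) (t : R) : R := derive1 (fun s => ln (rho x s)) t.
Definition score (x : 'rV[R]_D) (t : R) : 'rV[R]_D := grad (fun y => ln (rho y t)) x.
Definition Estar (t : R) (h : 'rV[R]_D -> R) : R :=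
  fine (lebRn (fun x => (rho_star x t * h x)%:E)).
Definition gfun (x : 'rV[R]_D) (t : R) : R :=
  dtlog x t - Estar t (fun y => dtlog y t).
Definition err (x : 'rV[R]_D) (t : R) : R :=
  div (fun y => v y t) x + dotv (score x t) (v x t) + gfun x t.

Variable flow : 'rV[R]_D -> R -> 'rV[R]_D.
Definition wtilde (t : R) (x0 : 'rV[R]_D) : R :=
  expR (Rintegral (@lebesgue_measure R) `[0, t] (fun s => err (flow x0 s) s)).
Definition wnorm (N : nat) (x0 : nat -> 'rV[R]_D) (i : nat) (t : R) : R :=
  wtilde t (x0 i) / \sum_(j < N) wtilde t (x0 j).
Definition WN (N : nat) (x0 : nat -> 'rV[R]_D) (s : R) : R :=
  \sum_(i < N) wnorm N x0 i s * dtlog (flow (x0 i) s) s.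
End Defs.

(* Main.v *)
(** The weights are the ratio of the target density to the density of the flow, up to a factor
    depending on time only. By Liouville's formula for the flow,
      E_mu [w(s; x0) phi(x(s; x0))]
    is proportional to the integral of rho(., s) phi. That formula is obtained without the
    differentiability of the flow in x0: the flow is the limit of Euler steps performed one
    coordinate at a time, each of which is a shear, so that the one-dimensional change of
    variables and Tonelli's theorem give the exact formula for every step. The strong law of
    large numbers for the numerator and the denominator of W_N(s) yields W_N(s) -> Z'(s) / Z(s)
    almost surely for each s, hence, by Fubini, almost surely for almost every s. Since W_N is
    bounded by M2, dominated convergence gives the limit of its integral, that is, ln Z(t). *)
Require Import Defs.
From HB Require Import structures.
From mathcomp Require Import all_boot all_order all_algebra.
From mathcomp Require Import all_classical all_reals all_analysis.
From mathcomp Require Import measurable_realfun.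
From mathcomp Require Import ring lra zify.
Set Implicit Arguments. Unset Strict Implicit. Unset Printing Implicit Defensive.
Import Order.TTheory GRing.Theory Num.Theory.
Import numFieldNormedType.Exports.
Local Open Scope classical_set_scope.
Local Open Scope ring_scope.

(** * Iterated Lebesgue integrals *)

(** Two restrictions shape the argument. Smoothness is given by iterated directional derivatives, so
    additivity in the direction and the chain rule along a curve are derived from the continuity of
    these derivatives. Positivity of the density, the Lipschitz bound and the flow equation hold for
    times in [0, 1] only, so time is clamped wherever a function continuous on the whole line is
    wanted. The bound [M2] on the time derivative of [ln rho] is used in four ways. Adding it makes
    the integrands nonnegative, which suits Tonelli, and shifts a self-normalized average by exactly
    that constant. It keeps [rho(., s)] between multiples of [rho(., 0)], an integrable function
    that dominates everything when Z is differentiated. It bounds the factor of the weights that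
    depends on time only, so that the bound [M1] passes to the weights without this factor. It
    dominates W_N in the last limit. Bounded samples make second moments enough for the strong law:
    only pairwise orthogonality of the centred variables enters. *)

Section TupleMeasure.
Variable R : realType.
Local Notation mu := (@lebesgue_measure R).

Lemma tupK n : cancel (@tup R n) (@untup R n).
Proof. by move=> x; apply/rowP => j; rewrite mxE tnth_mktuple. Qed.

Lemma untupK n : cancel (@untup R n) (@tup R n).
Proof. by move=> t; apply/eq_from_tnth => j; rewrite tnth_mktuple mxE. Qed.

Lemma cons_row0 n (a : R) (y : 'rV[R]_n) : cons_row a y 0 ord0 = a.
Proof. by rewrite mxE unlift_none. Qed.

Lemma cons_rowS n (a : R) (y : 'rV[R]_n) i : cons_row a y 0 (lift ord0 i) = y 0 i.
Proof. by rewrite mxE liftK. Qed.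

Lemma tup_cons n (a : R) (y : 'rV[R]_n) : tup (cons_row a y) = [tuple of a :: tup y].
Proof.
apply/eq_from_tnth => i; rewrite tnth_mktuple.
have [j ->|->] := unliftP ord0 i; last by rewrite cons_row0.
by rewrite cons_rowS tnthS tnth_mktuple.
Qed.

(** The integral is the difference of the integrals of the positive and negative parts, and Tonelli
    gives the measurability of each of these in the parameter. *)
Lemma measurable_fun_integral_param d d' (T : measurableType d) (T' : measurableType d')
    (m : {sigma_finite_measure set T' -> \bar R}) (g : T * T' -> \bar R) :
  measurable_fun setT g -> measurable_fun setT (fun p => \int[m]_a g (p, a))%E.
Proof.
move=> mg.
rewrite (_ : (fun p => _) = (fun p => \int[m]_a (g^\+ (p, a)) - \int[m]_a (g^\- (p, a)))%E).
  apply: emeasurable_funB.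
    apply: (measurable_fun_fubini_tonelli_F (m2 := m) g^\+%E) => //.
    exact: measurable_funepos.
  apply: (measurable_fun_fubini_tonelli_F (m2 := m) g^\-%E) => //.
  exact: measurable_funeneg.
apply/funext => p; rewrite [LHS]integralE.
under eq_integral do rewrite funepos_comp/=.
by under [X in (_ - X)%E = _]eq_integral do rewrite funeneg_comp/=.
Qed.

Lemma measurable_cons_pair n :
  measurable_fun setT (fun z : R * n.-tuple R => [tuple of z.1 :: z.2]).
Proof. exact: (measurable_cons measurable_fst measurable_snd). Qed.

(** The parameter space varies in the induction: the outermost integration variable joins the
    parameters, [T] becoming [T * R]. *)
Lemma lebRn_measurable_param n d (T : measurableType d) (f : T * n.-tuple R -> \bar R) :
  measurable_fun setT f ->
  measurable_fun setT (fun p => lebRn (fun x => f (p, tup x))).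
Proof.
elim: n d T f => [|n IHn] d T f mf /=.
  apply: (@measurableT_comp _ _ _ _ _ _ f _ (fun p => (p, tup (0 : 'rV[R]_0)))) => //.
pose g (z : T * R * n.-tuple R) := f (z.1.1, [tuple of z.1.2 :: z.2]).
have mg : measurable_fun setT g.
  apply: (measurableT_comp mf); apply: measurable_fun_pair => /=.
    by apply: measurableT_comp => //; exact: measurable_fst.
  apply: measurable_cons; last exact: measurable_snd.
  by apply: measurableT_comp => //; exact: measurable_snd.
rewrite (_ : (fun p => _) = (fun p => \int[mu]_a lebRn (fun y => g ((p, a), tup y))))%E.
  exact: (@measurable_fun_integral_param _ _ _ _ mu
    (fun z => lebRn (fun y => g (z, tup y)))) (IHn _ _ g mg).
apply/funext => p; apply: eq_integral => a _; congr lebRn.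
by apply/funext => y; rewrite /g tup_cons.
Qed.

Lemma lebRn_measurable n d (T : measurableType d) (f : T -> 'rV[R]_n -> \bar R) :
  measurable_fun setT (fun z : T * n.-tuple R => f z.1 (untup z.2)) ->
  measurable_fun setT (fun p => lebRn (f p)).
Proof.
move=> mf; rewrite (_ : (fun p => _) = fun p => lebRn (fun x => f p (untup (tup x)))).
  exact: (@lebRn_measurable_param _ _ T (fun z => f z.1 (untup z.2)) mf).
by apply/funext => p; congr lebRn; apply/funext => y; rewrite tupK.
Qed.

Lemma eq_lebRn n (f g : 'rV[R]_n -> \bar R) : f =1 g -> lebRn f = lebRn g.
Proof. by move=> /funext ->. Qed.

Lemma lebRn_ge0 n (f : 'rV[R]_n -> \bar R) : (forall x, 0 <= f x)%E -> (0 <= lebRn f)%E.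
Proof.
elim: n f => [|n IHn] f f0 //=.
by apply: integral_ge0 => a _; exact: IHn.
Qed.

Lemma measurable_slices n (f : 'rV[R]_n.+1 -> \bar R) :
  measurable_fun setT (fun u => f (untup u)) ->
  measurable_fun setT (fun z : R * n.-tuple R => f (cons_row z.1 (untup z.2))).
Proof.
move=> mf; have := measurableT_comp mf (@measurable_cons_pair n).
by apply: eq_measurable_fun => z _ /=; rewrite -[in RHS](tupK (cons_row _ _)) tup_cons untupK.
Qed.

Lemma measurable_lebRn_cons n (f : 'rV[R]_n.+1 -> \bar R) :
  measurable_fun setT (fun u => f (untup u)) ->
  measurable_fun setT (fun a => lebRn (fun y => f (cons_row a y))).
Proof. by move=> /measurable_slices; exact: (@lebRn_measurable n _ R). Qed.

Lemma measurable_cons_slice n (f : 'rV[R]_n.+1 -> \bar R) a :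
  measurable_fun setT (fun u => f (untup u)) ->
  measurable_fun setT (fun u => f (cons_row a (untup u))).
Proof.
move=> /measurable_slices mf.
exact: (measurableT_comp mf (pair1_measurable a)).
Qed.

Lemma ge0_le_lebRn n (f g : 'rV[R]_n -> \bar R) :
  measurable_fun setT (fun u => f (untup u)) ->
  measurable_fun setT (fun u => g (untup u)) ->
  (forall x, 0 <= f x)%E -> (forall x, f x <= g x)%E -> (lebRn f <= lebRn g)%E.
Proof.
elim: n f g => [|n IHn] f g mf mg f0 fg //=.
have g0 x : (0 <= g x)%E by exact: le_trans (f0 x) (fg x).
apply: ge0_le_integral => //.
- by move=> a _; exact: lebRn_ge0.
- exact: measurable_lebRn_cons.
- exact: measurable_lebRn_cons.
- by move=> a _; apply: IHn => //; exact: measurable_cons_slice.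
Qed.

Lemma le_abse_lebRn n (f : 'rV[R]_n -> \bar R) :
  measurable_fun setT (fun u => f (untup u)) ->
  (`|lebRn f| <= lebRn (fun x => `|f x|))%E.
Proof.
elim: n f => [|n IHn] f mf //=.
have maf : measurable_fun setT (fun u => `|f (untup u)|)%E by exact: measurableT_comp.
apply: le_trans (le_abse_integral _ _ _) _ => //; first exact: measurable_lebRn_cons.
apply: ge0_le_integral => //.
- by apply: measurableT_comp => //; exact: measurable_lebRn_cons.
- exact: (measurable_lebRn_cons (f := fun x => `|f x|%E)).
- by move=> a _; apply: IHn; exact: measurable_cons_slice.
Qed.

(** For [g] the indicator of an interval this is the volume of a cube, which makes the dominating
    function in [liouville] integrable. *)
Lemma lebRn_prod n (g : R -> R) (c : R) :
  measurable_fun setT g -> (forall a, 0 <= g a) -> (\int[mu]_a (g a)%:E = c%:E)%E ->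
  lebRn (fun x : 'rV[R]_n => (\prod_i g (x 0 i))%:E) = (c ^+ n)%:E.
Proof.
move=> mg g0 gc; have c0 : 0 <= c.
  by rewrite -lee_fin -gc; apply: integral_ge0 => a _; rewrite lee_fin.
elim: n => [|n IHn] /=; first by rewrite big_ord0 expr0.
transitivity (\int[mu]_a ((g a)%:E * (c ^+ n)%:E))%E; last first.
  rewrite ge0_integralZr//; last by rewrite lee_fin exprn_ge0.
  - by rewrite gc -EFinM exprS.
  - exact/measurable_EFinP.
  - by move=> a _; rewrite lee_fin.
apply: eq_integral => a _; rewrite -IHn.
(* Homogeneity of the iterated integral, by an induction of its own. *)
have : forall n (f : 'rV[R]_n -> \bar R) k, measurable_fun setT (fun u => f (untup u)) ->
   (forall x, 0 <= f x)%E -> 0 <= k -> (lebRn (fun x => k%:E * f x) = k%:E * lebRn f)%E.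
  move=> {IHn n c c0 a gc}; elim => [|n IHn] f k mf f0 k0 //=.
  rewrite -ge0_integralZl//; last 2 first.
  - exact: measurable_lebRn_cons.
  - by move=> a _; exact: lebRn_ge0.
  apply: eq_integral => a _; apply: IHn => //; exact: measurable_cons_slice.
move=> <- //.
- apply: eq_lebRn => y; rewrite -EFinM big_ord_recl cons_row0.
  by congr (_ * _)%:E; apply: eq_bigr => i _; rewrite cons_rowS.
- apply/measurable_EFinP/measurable_prod => i _.
  apply: (eq_measurable_fun (fun u => g (tnth u i))); first by move=> u _; rewrite mxE.
  exact: measurableT_comp mg (measurable_tnth i).
- by move=> x; rewrite lee_fin; exact: prodr_ge0.
Qed.

Lemma pack_sigma_finite d (T : measurableType d) (m : {measure set T -> \bar R}) :
  sigma_finite setT m ->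
  exists M : {sigma_finite_measure set T -> \bar R}, forall A, M A = m A.
Proof.
move=> sf.
pose M1 := isSFinite.Build _ _ _ _ (sfinite_measure_sigma_finite sf).
pose M2 := isSigmaFinite.Build _ _ _ _ sf.
by exists (HB.pack_for (SigmaFiniteMeasure.type T R) (Measure.sort m) M1 M2).
Qed.

(** The iterated integral of nonnegative functions is integration against one sigma-finite measure,
    which opens the way to Tonelli and to the monotone and dominated convergence theorems. The
    measure is built by induction, as the image of a product measure under the map that prepends a
    coordinate. *)
Lemma lebRn_measure n : exists m : {sigma_finite_measure set (n.-tuple R) -> \bar R},
  forall f : n.-tuple R -> \bar R, measurable_fun setT f -> (forall u, 0 <= f u)%E ->
  (\int[m]_u f u = lebRn (fun x => f (tup x)))%E.
Proof.
elim: n => [|n [m IHm]].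
  exists (dirac (tup (0 : 'rV[R]_0))) => f mf f0.
  by rewrite integral_dirac//= diracT mul1e.
pose cn (z : R * n.-tuple R) := [tuple of z.1 :: z.2] : n.+1.-tuple R.
have mcn : measurable_fun setT cn by exact: measurable_cons_pair.
pose m' := pushforward (mu \x m)%E cn.
have sf : sigma_finite setT m'.
  have /sigma_finiteP[F [FT ndF Foo]] := sigma_finiteT mu.
  have /sigma_finiteP[G [GT ndG Goo]] := sigma_finiteT m.
  pose uc (u : n.+1.-tuple R) : R * n.-tuple R := (thead u, [tuple of behead u]).
  have muc : measurable_fun setT uc.
    by apply: measurable_fun_pair; [exact: (measurable_tnth ord0)|exact: measurable_behead].
  have ucK z : uc (cn z) = z.
    by case: z => a u; rewrite /uc /cn theadE; congr pair; exact/val_inj.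
  (* Exhausting boxes are pulled back through [uc], a left inverse of [cn]. Both exhaustions being
     monotone, the index [maxn k l] serves the two factors at once. *)
  exists (fun k => uc @^-1` (F k `*` G k)) => [|k].
    apply/seteqP; split=> // u _.
    have : (setT : set R) (uc u).1 by [].
    have : (setT : set (n.-tuple R)) (uc u).2 by [].
    rewrite FT GT => -[k _ Gk] [l _ Fl]; exists (maxn k l) => //; split => /=.
      by move: Fl; apply/subsetPset/ndF/leq_maxr.
    by move: Gk; apply/subsetPset/ndG/leq_maxl.
  have [mF Fkoo] := Foo k; have [mG Gkoo] := Goo k.
  split; first by rewrite -[_ @^-1` _]setTI; apply: muc => //; exact: measurableX.
  rewrite /m' /pushforward -comp_preimage.
  rewrite (_ : uc \o cn = id); last by apply/funext => z; exact: ucK.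
  rewrite preimage_id.
  by rewrite product_measure1E// lte_mul_pinfty// ge0_fin_numE.
have [M ME] := pack_sigma_finite (m := pushforward (mu \x m)%E cn) sf.
exists M => f mf f0 /=.
rewrite (eq_measure_integral (pushforward (mu \x m)%E cn)); last first.
  by move=> A _ _; exact: ME.
rewrite ge0_integral_pushforward// preimage_setT.
have mfcn := measurableT_comp mf mcn.
apply: (etrans (fubini_tonelli1 (m1 := mu) (m2 := m) (f \o cn) mfcn (fun z => f0 (cn z)))).
apply: eq_integral => a _; rewrite /fubini_F/= IHm//.
- by apply: eq_lebRn => y; rewrite tup_cons.
- exact: (measurableT_comp mfcn (pair1_measurable a)).
Qed.

Lemma lebRn_integral n (m : {sigma_finite_measure set (n.-tuple R) -> \bar R}) :
  (forall f : n.-tuple R -> \bar R, measurable_fun setT f -> (forall u, 0 <= f u)%E ->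
    (\int[m]_u f u = lebRn (fun x => f (tup x)))%E) ->
  forall k : 'rV[R]_n -> R, measurable_fun setT (fun u => k (untup u)) -> (forall x, 0 <= k x) ->
  lebRn (fun x => (k x)%:E) = (\int[m]_u (k (untup u))%:E)%E.
Proof.
move=> mE k mk k0; rewrite mE.
- by apply: eq_lebRn => x; rewrite tupK.
- exact/measurable_EFinP.
- by move=> u; rewrite lee_fin.
Qed.

End TupleMeasure.

(** * Continuity and measurability on row vectors *)

Section RowVectors.
Variable R : realType.

Lemma rV_norm_le n (x : 'rV[R]_n) c : 0 <= c -> (forall j, `|x 0 j| <= c) -> `|x| <= c.
Proof.
move=> c0 xc; rewrite [leLHS]mx_normrE; apply: bigmax_le => // -[i j] _ /=.
by rewrite ord1.
Qed.

Lemma coord_norm_le n (x : 'rV[R]_n) j : `|x 0 j| <= `|x|.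
Proof. by rewrite [leRHS]mx_normrE (le_bigmax _ (fun ij => `|x ij.1 ij.2|) (0, j)). Qed.

Lemma cvg_rV T (F : set_system T) {FF : Filter F} n (f : T -> 'rV[R]_n) (l : 'rV[R]_n) :
  (forall j, f x 0 j @[x --> F] --> l 0 j) -> f x @[x --> F] --> l.
Proof.
move=> fl; apply/cvgrPdist_le => /= e e0.
have : \forall x \near F, forall j, `|l 0 j - f x 0 j| <= e.
  by apply: filter_forall => j; move/cvgrPdist_le : (fl j) => /(_ _ e0).
apply: filterS => x xe; apply: rV_norm_le => [|j]; first exact: ltW.
by rewrite !mxE.
Qed.

Lemma cvg_coord T (F : set_system T) {FF : Filter F} n (f : T -> 'rV[R]_n) (y : 'rV[R]_n) i :
  f x @[x --> F] --> y -> f x 0 i @[x --> F] --> y 0 i.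
Proof.
by move=> fy; apply: (@continuous_cvg _ _ _ F FF f (fun z => z 0 i) y) => //;
    exact: coord_continuous.
Qed.

Lemma cvg_compc T (F : set_system T) {FF : Filter F} (U V : topologicalType)
    (h : U -> V) (f : T -> U) (a : U) : continuous h ->
  f x @[x --> F] --> a -> h (f x) @[x --> F] --> h a.
Proof. by move=> ch fa; exact: (@continuous_cvg _ _ _ F FF f h a (ch a) fa). Qed.

Lemma continuous_compT (W U V : topologicalType) (h : U -> V) (f : W -> U) :
  continuous h -> continuous f -> continuous (fun x => h (f x)).
Proof. by move=> ch cf x; exact: (@continuous_comp _ _ _ f h x (cf x) (ch (f x))). Qed.

Lemma continuous_idT (W : topologicalType) : continuous (fun x : W => x).
Proof. by move=> x; exact: cvg_id. Qed.

Lemma continuous_cstT (W V : topologicalType) (v : V) : continuous (fun _ : W => v).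
Proof. by move=> x; exact: cvg_cst. Qed.

Lemma continuous_addT (W : topologicalType) (V : normedModType R) (f g : W -> V) :
  continuous f -> continuous g -> continuous (fun x => f x + g x).
Proof. by move=> cf cg x; exact: (@continuousD _ _ _ f g x (cf x) (cg x)). Qed.

Lemma continuous_subT (W : topologicalType) (V : normedModType R) (f g : W -> V) :
  continuous f -> continuous g -> continuous (fun x => f x - g x).
Proof. by move=> cf cg x; exact: (@continuousB _ _ _ f g x (cf x) (cg x)). Qed.

Lemma continuous_mulT (W : topologicalType) (f g : W -> R) :
  continuous f -> continuous g -> continuous (fun x => f x * g x).
Proof. by move=> cf cg x; exact: (@continuousM _ _ f g x (cf x) (cg x)). Qed.

Lemma continuous_scalelT (W : topologicalType) (V : normedModType R) (f : W -> R) (v : V) :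
  continuous f -> continuous (fun x => f x *: v).
Proof. by move=> cf x; exact: (@cvgZr_tmp _ _ _ (nbhs x) _ f _ v (cf x)). Qed.

Lemma continuous_maxT (W : topologicalType) (f g : W -> R) :
  continuous f -> continuous g -> continuous (fun x => Num.max (f x) (g x)).
Proof. by move=> cf cg x; exact: (@continuous_max _ _ f g x (cf x) (cg x)). Qed.

Lemma continuous_minT (W : topologicalType) (f g : W -> R) :
  continuous f -> continuous g -> continuous (fun x => Num.min (f x) (g x)).
Proof. by move=> cf cg x; exact: (@continuous_min _ _ f g x (cf x) (cg x)). Qed.

Lemma cvg_sumT T (F : set_system T) {FF : Filter F} (I : Type) (r : seq I) (f : I -> T -> R)
    (a : I -> R) : (forall i, f i x @[x --> F] --> a i) ->
  \sum_(i <- r) f i x @[x --> F] --> \sum_(i <- r) a i.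
Proof.
move=> fa; elim: r => [|i r IHr].
  by rewrite big_nil; under eq_fun do rewrite big_nil; exact: cvg_cst.
by rewrite big_cons; under eq_fun do rewrite big_cons; exact: cvgD.
Qed.

Lemma continuous_sumT (W : topologicalType) (I : Type) (r : seq I) (f : I -> W -> R) :
  (forall i, continuous (f i)) -> continuous (fun x => \sum_(i <- r) f i x).
Proof.
by move=> cf x; apply: (@cvg_sumT _ (nbhs x) _ _ r f (fun i => f i x)) => i; exact: cf.
Qed.

Lemma cvg_pairT T (F : set_system T) {FF : Filter F} (U V : topologicalType)
    (f : T -> U) (g : T -> V) (a : U) (b : V) :
  f x @[x --> F] --> a -> g x @[x --> F] --> b -> (f x, g x) @[x --> F] --> (a, b).
Proof. by move=> fa gb; exact: (cvg_pair fa gb). Qed.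

Lemma continuous_pairT (W U V : topologicalType) (f : W -> U) (g : W -> V) :
  continuous f -> continuous g -> continuous (fun x => (f x, g x)).
Proof. by move=> cf cg x; exact: (@cvg_pairT _ (nbhs x) _ _ _ f g (f x) (g x) (cf x) (cg x)). Qed.

(** A preimage is a union of fibres of [c], countably many since [C] is countable. *)
Lemma measurable_fun_discrete d (T : measurableType d) (C : countType) (c : T -> C)
    (G : C -> R) : (forall a, measurable (c @^-1` [set a])) ->
  measurable_fun setT (G \o c).
Proof.
move=> mc _ B mB; rewrite setTI.
rewrite (_ : _ @^-1` B = \bigcup_(a in [set a | B (G a)]) (c @^-1` [set a])).
  rewrite bigcup_mkcond; apply: countable_bigcupT_measurable => [|a].
    exact: countableP.
  by case: ifP.
apply/seteqP; split=> x /=; first by move=> Bx; exists (c x).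
by move=> [a /= Ba cxa]; rewrite cxa.
Qed.

Lemma grid_cvg (x : R) : (Num.floor (k.+1%:R * x))%:~R / k.+1%:R @[k --> \oo] --> x.
Proof.
apply/cvgrPdist_le => /= e e0.
have [N Ne] : exists N : nat, e^-1 <= N%:R.
  by exists (Num.truncn e^-1).+1; rewrite ltW// truncnS_gt.
near=> k.
have k0 : 0 < k.+1%:R :> R by [].
have /andP[h1 h2] := floor_itv (k.+1%:R * x).
rewrite intrD in h2.
have -> : x - (Num.floor (k.+1%:R * x))%:~R / k.+1%:R
    = (k.+1%:R * x - (Num.floor (k.+1%:R * x))%:~R) / k.+1%:R.
  by rewrite mulrBl mulrAC divff ?mul1r ?gt_eqF.
rewrite ger0_norm ?divr_ge0 ?subr_ge0// ler_pdivrMr//.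
apply: (@le_trans _ _ 1); first by rewrite lerBlDr addrC ltW.
rewrite -ler_pdivrMl// mulr1 (le_trans Ne)// ler_nat.
near: k; exists N => // k /= Nk; exact: leqW.
Unshelve. all: by end_near. Qed.

(* The norm topology of ['rV] and the sigma-algebra of tuples are not related in the
   library: [F] is approximated by its values on the grid of mesh 1 / (k + 1), a function
   of the countably many integer parts. *)
Lemma measurable_continuous_rV d (T : measurableType d) n (F : 'rV[R]_n * R -> R)
    (f : T -> 'rV[R]_n) (s : T -> R) : continuous F ->
  (forall j, measurable_fun setT (fun p => f p 0 j)) -> measurable_fun setT s ->
  measurable_fun setT (fun p => F (f p, s p)).
Proof.
move=> cF mf ms.
pose q k (x : R) := Num.floor (k.+1%:R * x).
pose c k (p : T) : n.-tuple int * int := ([tuple q k (f p 0 j) | j < n], q k (s p)).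
pose G k (a : n.-tuple int * int) :=
  F (\row_j ((tnth a.1 j)%:~R / k.+1%:R), a.2%:~R / k.+1%:R).
apply: (@measurable_fun_cvg _ _ _ _ (fun k => G k \o c k)).
  move=> k; apply: measurable_fun_discrete => -[a b].
  have mq (g : T -> R) (z : int) : measurable_fun setT g ->
      measurable [set p | q k (g p) = z].
    move=> mg; have := mg measurableT `[z%:~R / k.+1%:R, (z + 1)%:~R / k.+1%:R[%classic.
    rewrite setTI => /(_ (measurable_itv _)); congr measurable.
    apply/seteqP; split=> p /=; rewrite in_itv/= ler_pdivrMr// ltr_pdivlMr// mulrC.
      by rewrite -floor_eq => /eqP.
    by move=> /eqP; rewrite floor_eq.
  rewrite (_ : _ @^-1` _ = \bigcap_(j in [set: 'I_n]) [set p | q k (f p 0 j) = tnth a j]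
      `&` [set p | q k (s p) = b]).
    apply: measurableI; last exact: mq.
    by apply: fin_bigcap_measurable => // j _; exact: mq.
  apply/seteqP; split=> p /=.
    by case=> <- <-; split => // j _ /=; rewrite tnth_mktuple.
  case=> h <-; congr pair; apply/eq_from_tnth => j.
  by rewrite tnth_mktuple; exact: h.
move=> p _.
rewrite (_ : (fun k => _) = F \o (fun k => (\row_j ((q k (f p 0 j))%:~R / k.+1%:R) : 'rV[R]_n,
    (q k (s p))%:~R / k.+1%:R))); last first.
  apply/funext => k; rewrite /G /c /=; congr (F (_, _)).
  by apply/rowP => j; rewrite !mxE tnth_mktuple.
apply: continuous_cvg; first exact: cF.
apply: cvg_pairT; last exact: grid_cvg.
by apply: cvg_rV => j; under eq_fun do rewrite mxE; exact: grid_cvg.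
Qed.

Lemma measurable_continuous_rV1 d (T : measurableType d) n (F : 'rV[R]_n -> R)
    (f : T -> 'rV[R]_n) : continuous F ->
  (forall j, measurable_fun setT (fun p => f p 0 j)) ->
  measurable_fun setT (fun p => F (f p)).
Proof.
move=> cF mf.
apply: (@measurable_continuous_rV _ _ _ (fun z => F z.1) f (cst 0)) => //.
by move=> z; apply: continuous_comp; [exact: cvg_fst|exact: cF].
Qed.

Lemma measurable_untup n j : measurable_fun setT (fun u : n.-tuple R => untup u 0 j).
Proof.
apply: (eq_measurable_fun (fun u : n.-tuple R => tnth u j)); first by move=> u _; rewrite mxE.
exact: measurable_tnth.
Qed.

Lemma measurable_continuous_untup n (F : 'rV[R]_n -> R) : continuous F ->
  measurable_fun setT (fun u => F (untup u)).
Proof. by move=> /measurable_continuous_rV1; apply; exact: measurable_untup. Qed.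

End RowVectors.

(** * Change of variables for shears *)

Section Substitution.
Variable R : realType.
Local Notation mu := (@lebesgue_measure R).

(** A directional derivative sees only the values along a line: when the two functions agree along
    corresponding lines, their difference quotients are equal. This stands in for the chain rule
    under affine changes of variables. *)
Lemma is_derive_reparam (V V' W : normedModType R) (f : V -> W) (g : V' -> W)
    (a v : V) (b w : V') (d : W) :
  (forall h : R, g (h *: w + b) = f (h *: v + a)) -> is_derive a v f d -> is_derive b w g d.
Proof.
move=> gf [df <-].
have e : (fun h : R => h^-1 *: ((g \o shift b) (h *: w) - g b)) =
         (fun h : R => h^-1 *: ((f \o shift a) (h *: v) - f a)).
  apply/funext => h /=; rewrite gf.
  by have := gf 0; rewrite !scale0r !add0r => ->.
by split; [move: df; rewrite /derivable e|rewrite /derive e].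
Qed.

Lemma is_derive_continuous (f : R -> R) (x d : R) : is_derive x 1 f d -> {for x, continuous f}.
Proof. by move=> fd; apply/differentiable_continuous/derivable1_diffP/ex_derive. Qed.

Lemma continuous_withinT (V W : topologicalType) (A : set V) (f : V -> W) :
  continuous f -> {within A, continuous f}.
Proof. by move=> cf; apply: continuous_subspaceT. Qed.

(** Substitution is performed on the segments [[-n, n]] and monotone convergence does the rest. The
    lower bound [e] on the derivative makes [g] increasing and lets the images of these segments
    exhaust the line. *)
Lemma integral_subst_line (g g' f : R -> R) (e : R) :
  0 < e -> (forall a : R, is_derive a 1 g (g' a)) -> continuous g' ->
  (forall a, e <= g' a) -> continuous f -> (forall a, 0 <= f a) ->
  (\int[mu]_a (f (g a) * g' a)%:E = \int[mu]_a (f a)%:E)%E.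
Proof.
move=> e0 dg cg' eg' cf f0.
have cg : continuous g by move=> a; exact: is_derive_continuous (dg a).
have g'E : derive1 g = g'.
  by apply/funext => a; rewrite derive1E; exact: derive_val.
have grow a b : a <= b -> e * (b - a) <= g b - g a.
  move=> ab; have [c _ ->] := MVT_segment ab (fun x _ => dg x) (continuous_withinT cg).
  by rewrite ler_wpM2r// subr_ge0.
have incr a b : a < b -> g a < g b.
  by move=> ab; rewrite -subr_gt0 (lt_le_trans _ (grow _ _ (ltW ab)))// mulr_gt0// subr_gt0.
have ndecr a b : a <= b -> g a <= g b.
  by rewrite le_eqVlt => /predU1P[->//|/incr/ltW].
pose A (n : nat) : set R := `[- n%:R, n%:R]%classic.
pose B (n : nat) : set R := `[g (- n%:R), g n%:R]%classic.
have AB n : (\int[mu]_(a in B n) (f a)%:E = \int[mu]_(a in A n) (f (g a) * g' a)%:E)%E.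
  have n0 : - n%:R <= n%:R :> R by rewrite -subr_ge0 opprK addr_ge0.
  rewrite /B integration_by_substitution_increasing//.
  - by rewrite g'E.
  - by move=> a b _ _; exact: incr.
  - by move=> a _; rewrite g'E; exact: cg'.
  - rewrite g'E; apply/cvg_ex; exists (g' (- n%:R)).
    by apply: cvg_at_right_filter; exact: cg'.
  - rewrite g'E; apply/cvg_ex; exists (g' (n%:R)).
    by apply: cvg_at_left_filter; exact: cg'.
  - split; first by move=> a _; exact: ex_derive.
    + by apply: cvg_at_right_filter; exact: cg.
    + by apply: cvg_at_left_filter; exact: cg.
  - exact: continuous_withinT.
have natP (x : R) : exists n : nat, `|x| <= n%:R.
  by exists (Num.truncn `|x|).+1; rewrite ltW// truncnS_gt.
have UA : \bigcup_n A n = setT.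
  apply/seteqP; split => // x _; have [n xn] := natP x.
  by exists n => //=; rewrite /A/= in_itv/= -ler_norml.
have UB : \bigcup_n B n = setT.
  (* By [grow], [g n >= g 0 + e * n] and [g (- n) <= g 0 - e * n], so that [e * n >= |x| + |g 0|]
     places [x] between them. *)
  apply/seteqP; split => // x _; have [n xn] := natP ((`|x| + `|g 0|) / e).
  move: xn => /(le_trans (ler_norm _)); rewrite ler_pdivrMr// mulrC => xn.
  exists n => //=; rewrite /B/= in_itv/=.
  have := grow 0 n%:R (ler0n _ _); have : - n%:R <= 0 :> R by rewrite oppr_le0.
  move=> /grow; rewrite sub0r opprK subr0.
  have := ler_norm x; have := ler_norm (- x); have := ler_norm (g 0).
  have := ler_norm (- g 0); rewrite !normrN => h1 h2 h3 h4 h5 h6.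
  by apply/andP; split; lra.
have ndA : nondecreasing_seq A.
  move=> n m nm; apply/subsetPset => x /=; rewrite /A/= !in_itv/= -!ler_norml.
  by move=> /le_trans; apply; rewrite ler_nat.
have ndB : nondecreasing_seq B.
  move=> n m nm; apply/subsetPset => x /=; rewrite /B/= !in_itv/=.
  move=> /andP[h1 h2]; apply/andP; split.
    by apply: le_trans h1; apply: ndecr; rewrite lerN2 ler_nat.
  by apply: (le_trans h2); apply: ndecr; rewrite ler_nat.
have cfg : continuous (fun a => f (g a) * g' a).
  move=> a; apply: cvgM; last exact: cg'.
  by apply: continuous_comp; [exact: cg|exact: cf].
have := @ge0_nondecreasing_set_cvg_integral _ (measurableTypeR R) R A (fun a =>
    (f (g a) * g' a)%:E) mu ndA.
rewrite UA => cA.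
have := @ge0_nondecreasing_set_cvg_integral _ (measurableTypeR R) R B (fun a => (f a)%:E) mu ndB.
rewrite UB => cB.
rewrite -(cvg_lim _ (cA _ _ _))//; last 3 first.
- by move=> n; exact: measurable_itv.
- move=> n; apply: measurable_funTS; apply/measurable_EFinP.
  exact: continuous_measurable_fun.
- move=> n a _; rewrite lee_fin mulr_ge0//.
  exact: le_trans (ltW e0) (eg' a).
rewrite -(cvg_lim _ (cB _ _ _))//; last 3 first.
- by move=> n; exact: measurable_itv.
- move=> n; apply: measurable_funTS; apply/measurable_EFinP.
  exact: continuous_measurable_fun.
- by move=> n a _; rewrite lee_fin.
by under [in RHS]eq_fun do rewrite AB.
Qed.

Lemma cvg_cons_row n T (F : set_system T) {FF : Filter F} (f : T -> R) (g : T -> 'rV[R]_n) a y :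
  f x @[x --> F] --> a -> g x @[x --> F] --> y ->
  cons_row (f x) (g x) @[x --> F] --> cons_row a y.
Proof.
move=> fa gy; apply: cvg_rV => j; have [i ->|->] := unliftP ord0 j; last first.
  by rewrite cons_row0; under eq_fun do rewrite cons_row0.
rewrite cons_rowS; under eq_fun do rewrite cons_rowS.
exact: cvg_coord.
Qed.

Lemma cons_row_continuousr n (a : R) : continuous (fun y : 'rV[R]_n => cons_row a y).
Proof. by move=> y; apply: (@cvg_cons_row _ _ (nbhs y) _ (cst a) id);
    [exact: cvg_cst|exact: cvg_id]. Qed.

Lemma cons_row_continuousl n (y : 'rV[R]_n) : continuous (fun a : R => cons_row a y).
Proof. by move=> a; apply: (@cvg_cons_row _ _ (nbhs a) _ id (cst y));
    [exact: cvg_id|exact: cvg_cst]. Qed.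

Lemma cons_row_shift0 n (a h : R) (y : 'rV[R]_n) :
  h *: basis_vec R ord0 + cons_row a y = cons_row (a + h) y.
Proof.
apply/rowP => j; rewrite !mxE; have [i ->|->] := unliftP ord0 j.
  by rewrite ?liftK eq_sym (negbTE (neq_lift _ _)) mulr0 add0r.
by rewrite ?unlift_none eqxx mulr1 addrC.
Qed.

Lemma cons_row_shiftS n (a h : R) (y : 'rV[R]_n) j :
  h *: basis_vec R (lift ord0 j) + cons_row a y = cons_row a (h *: basis_vec R j + y).
Proof.
apply/rowP => k; rewrite !mxE; have [i ->|->] := unliftP ord0 k.
  by rewrite ?liftK !mxE (inj_eq lift_inj).
by rewrite ?unlift_none (negbTE (neq_lift _ _)) mulr0 add0r.
Qed.

(** By Tonelli the first coordinate becomes the innermost variable, so that a one-dimensional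
    substitution can act on it with all the others fixed. *)
Lemma lebRn_swap n (f : 'rV[R]_n.+1 -> \bar R) :
  measurable_fun setT (fun u => f (untup u)) -> (forall x, 0 <= f x)%E ->
  lebRn f = lebRn (fun y => \int[mu]_a f (cons_row a y))%E.
Proof.
move=> mf f0; have [m mE] := lebRn_measure R n.
have mf' : measurable_fun setT (fun z : R * n.-tuple R => f (cons_row z.1 (untup z.2))).
  exact: measurable_slices.
transitivity (\int[mu]_a \int[m]_u f (cons_row a (untup u)))%E.
  apply: eq_integral => a _; rewrite mE//.
    by apply: eq_lebRn => y; rewrite tupK.
  exact: (measurableT_comp mf' (pair1_measurable a)).
rewrite (@fubini_tonelli _ _ _ _ R mu m _ mf')//.
rewrite mE.
- by apply: eq_lebRn => y; apply: eq_integral => a _; rewrite /= tupK.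
- exact: (@measurable_fun_fubini_tonelli_G _ _ _ _ R mu _ mf').
- by move=> u; exact: integral_ge0.
Qed.

(** A shear along the first axis is a substitution in one variable once that variable is innermost.
    A shear along another axis leaves the first coordinate alone, and the induction hypothesis
    applies to each slice. *)
Lemma lebRn_shear n (j : 'I_n) (c c' f : 'rV[R]_n -> R) (e : R) :
  0 < e -> continuous c' -> (forall x, is_derive x (basis_vec R j) c (c' x)) ->
  (forall x, e <= 1 + c' x) -> continuous c -> continuous f -> (forall x, 0 <= f x) ->
  lebRn (fun x => (f (x + c x *: basis_vec R j) * (1 + c' x))%:E) =
  lebRn (fun x => (f x)%:E).
Proof.
elim: n j c c' f => [[]//|n IHn] j c c' f e0 cc' dc ec' cc cf f0.
have cS : continuous (fun x : 'rV[R]_n.+1 => f (x + c x *: basis_vec R j)).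
  apply: (continuous_compT cf); apply: continuous_addT; first exact: continuous_idT.
  exact: continuous_scalelT.
have cF : continuous (fun x : 'rV[R]_n.+1 => f (x + c x *: basis_vec R j) * (1 + c' x)).
  apply: continuous_mulT => //; apply: continuous_addT => //; exact: continuous_cstT.
have [i ij|j0] := unliftP ord0 j; last first.
  rewrite lebRn_swap; last 2 first.
  - by apply/measurable_EFinP; exact: measurable_continuous_untup cF.
  - by move=> x; rewrite lee_fin mulr_ge0// (le_trans (ltW e0)).
  rewrite [RHS]lebRn_swap; last 2 first.
  - by apply/measurable_EFinP; exact: measurable_continuous_untup cf.
  - by move=> x; rewrite lee_fin.
  apply: eq_lebRn => y.
  have dg (a : R) : is_derive a 1 (fun a => a + c (cons_row a y)) (1 + c' (cons_row a y)).
    apply: is_deriveD.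
    apply: (@is_derive_reparam _ _ _ c _ (cons_row a y) (basis_vec R j)) => // h.
    by rewrite j0 cons_row_shift0 [h *: 1]mulr1 addrC.
  rewrite -(@integral_subst_line (fun a => a + c (cons_row a y))
     (fun a => 1 + c' (cons_row a y)) (fun a => f (cons_row a y)) e e0 dg)//.
  - by apply: eq_integral => a _; rewrite j0 addrC cons_row_shift0.
  - apply: continuous_addT; first exact: continuous_cstT.
    by apply: (continuous_compT cc'); exact: cons_row_continuousl.
  - by apply: (continuous_compT cf); exact: cons_row_continuousl.
rewrite ij in dc *; apply: eq_integral => a _.
have dca y : is_derive y (basis_vec R i) (fun y => c (cons_row a y)) (c' (cons_row a y)).
  apply: (@is_derive_reparam _ _ _ c _ (cons_row a y) (basis_vec R (lift ord0 i))) => // h.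
  by rewrite cons_row_shiftS.
apply: (etrans _ (IHn i (fun y => c (cons_row a y)) (fun y => c' (cons_row a y))
   (fun y => f (cons_row a y)) e0 _ dca _ _ _ _)) => //.
- by apply: eq_lebRn => y; rewrite addrC cons_row_shiftS addrC.
- by apply: (continuous_compT cc'); exact: cons_row_continuousr.
- by apply: (continuous_compT cc); exact: cons_row_continuousr.
- by apply: (continuous_compT cf); exact: cons_row_continuousr.
Qed.

End Substitution.

(** * The splitting scheme *)

Section SplittingScheme.
Variables (R : realType) (n : nat).
Local Notation D := n.+1.
Variables (v : 'rV[R]_D -> R -> 'rV[R]_D) (b : 'I_D -> 'rV[R]_D -> R -> R) (L : R).
Hypothesis v_cont : forall j, continuous (fun z : 'rV[R]_D * R => v z.1 z.2 0 j).
Hypothesis b_cont : forall j, continuous (fun z : 'rV[R]_D * R => b j z.1 z.2).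
Hypothesis v_der : forall j s x, is_derive x (basis_vec R j) (fun y => v y s 0 j) (b j x s).
Hypothesis v_lip : forall x y s, 0 <= s <= 1 -> `|v x s - v y s| <= L * `|x - y|.

(* Step [i] performs the [i %/ D]-th Euler step of size [h] in the coordinate [i %% D] only,
   so that it is a shear along one axis, with Jacobian determinant [1 + h * b]. *)
Definition scheme_dir (i : nat) : 'I_D := inord (i %% D).
Definition scheme_time (h : R) (i : nat) : R := h * (i %/ D)%:R.

(** Within one Euler step the time is frozen, but the velocity is read at the coordinates already
    updated, in the manner of Gauss-Seidel. *)
Fixpoint scheme (h : R) (x : 'rV[R]_D) (i : nat) : 'rV[R]_D :=
  if i is k.+1 then
    scheme h x k + (h * v (scheme h x k) (scheme_time h k) 0 (scheme_dir k))
      *: basis_vec R (scheme_dir k)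
  else x.

(** By the chain rule, the Jacobian determinant of the first [i] steps is the product of the
    determinants of the shears. *)
Fixpoint scheme_jac (h : R) (x : 'rV[R]_D) (i : nat) : R :=
  if i is k.+1 then
    scheme_jac h x k * (1 + h * b (scheme_dir k) (scheme h x k) (scheme_time h k))
  else 1.

Lemma basis_vec_norm (j : 'I_D) : `|basis_vec R j| = 1.
Proof.
apply/eqP; rewrite eq_le; apply/andP; split.
  by apply: rV_norm_le => // k; rewrite mxE eqxx /=; case: (k == j); rewrite ?normr0 ?normr1.
by have := coord_norm_le (basis_vec R j) j; rewrite mxE !eqxx/= normr1.
Qed.

(** In the sup norm a basis vector has norm 1 and a coordinate is at most the norm, so every
    difference quotient is bounded by the Lipschitz constant, and so is its limit. *)
Lemma jac_bound j x s : 0 <= s <= 1 -> `|b j x s| <= L.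
Proof.
move=> s01; have [df dfE] := v_der j s x.
apply/ler_addgt0Pr => e e0.
have /cvgrPdist_le/(_ e e0) : (fun h : R => h^-1 *: (v (h *: basis_vec R j + x) s 0 j - v x s 0 j))
    @ 0^' --> b j x s by rewrite -dfE; exact: df.
move=> H; have H2 : \forall h \near 0^', h != 0 :> R by exact: nbhs_dnbhs_neq.
have [h [H1 h0]] := @filter_ex _ (0 : R)^' _ _ (filterI H H2).
rewrite -(subrK (h^-1 *: (v (h *: basis_vec R j + x) s 0 j - v x s 0 j)) (b j x s)).
rewrite (le_trans (ler_normD _ _))// addrC lerD//.
rewrite normrZ normfV ler_pdivrMl ?normr_gt0//.
have := coord_norm_le (v (h *: basis_vec R j + x) s - v x s) j.
rewrite !mxE => /le_trans; apply; rewrite (le_trans (v_lip _ _ s01))//.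
by rewrite addrK normrZ basis_vec_norm mulr1 mulrC.
Qed.

Lemma v_cont1 j s : continuous (fun x => v x s 0 j).
Proof.
apply: (@continuous_compT _ _ _ (fun z : 'rV[R]_D * R => v z.1 z.2 0 j) (fun x => (x, s))).
  exact: v_cont.
by apply: continuous_pairT; [exact: continuous_idT|exact: continuous_cstT].
Qed.

Lemma b_cont1 j s : continuous (fun x => b j x s).
Proof.
apply: (@continuous_compT _ _ _ (fun z : 'rV[R]_D * R => b j z.1 z.2) (fun x => (x, s))).
  exact: b_cont.
by apply: continuous_pairT; [exact: continuous_idT|exact: continuous_cstT].
Qed.

(** The last step is peeled off: [f] composed with it and multiplied by its Jacobian is a new
    continuous nonnegative test function [f'], to which the induction hypothesis applies. The
    condition [h * L < 1] keeps the Jacobian away from 0. *)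
Lemma scheme_preserve h i (f : 'rV[R]_D -> R) : 0 <= h -> h * L < 1 ->
  (forall k, (k < i)%N -> scheme_time h k <= 1) -> continuous f -> (forall x, 0 <= f x) ->
  lebRn (fun x => (f (scheme h x i) * scheme_jac h x i)%:E) = lebRn (fun x => (f x)%:E).
Proof.
move=> h0 hL; elim: i f => [|i IHi] f t1 cf f0.
  by apply: eq_lebRn => x /=; rewrite mulr1.
pose j := scheme_dir i; pose s := scheme_time h i.
have s01 : 0 <= s <= 1 by rewrite t1// andbT mulr_ge0.
pose f' x := f (x + (h * v x s 0 j) *: basis_vec R j) * (1 + h * b j x s).
have b0 x : 1 - h * L <= 1 + h * b j x s.
  rewrite lerD2l -mulrN ler_wpM2l// lerNl.
  by have := jac_bound j x s01; rewrite ler_norml => /andP[+ _]; rewrite lerNl.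
have e0 : 0 < 1 - h * L by rewrite subr_gt0.
have cS : continuous (fun x => h * v x s 0 j).
  by apply: continuous_mulT; [exact: continuous_cstT|exact: v_cont1].
have cb : continuous (fun x => h * b j x s).
  by apply: continuous_mulT; [exact: continuous_cstT|exact: b_cont1].
have cf' : continuous f'.
  apply: continuous_mulT.
    apply: (continuous_compT cf); apply: continuous_addT; first exact: continuous_idT.
    exact: continuous_scalelT.
  by apply: continuous_addT => //; exact: continuous_cstT.
have df' x : is_derive x (basis_vec R j) (fun x => h * v x s 0 j) (h * b j x s).
  exact: (is_deriveZ h (v_der j s x)).
rewrite -(@lebRn_shear _ _ j _ _ f _ e0 cb df')//.
rewrite -/(f' _) -(IHi f')//.
- by apply: eq_lebRn => x; rewrite /f' /= mulrA [X in _ = (X)%:E]mulrAC.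
- by move=> k ki; apply: t1; rewrite ltnW.
- by move=> x; rewrite mulr_ge0// (le_trans (ltW e0)).
Qed.

End SplittingScheme.

(** * Uniformity along a compact curve, and elementary inequalities *)

Section Uniformity.
Variable R : realType.

(** Compactness of [0, 1], in its near-covering form, gives a radius common to all the points of the
    curve; half of the local radius is spent on moving along the curve and half on leaving it. *)
Lemma uniform_along (V : normedModType R) (Y : R -> V) (G : V -> R) :
  continuous Y -> continuous G -> forall e, 0 < e -> \forall d \near 0^'+,
    forall r, 0 <= r <= 1 -> forall z, `|z - Y r| < d -> `|G z - G (Y r)| <= e.
Proof.
move=> cY cG e e0.
have := @segment_compact R 0 1; rewrite compact_near_coveringP.
move=> /(_ R (0^'+) (fun d r => forall z, `|z - Y r| < d -> `|G z - G (Y r)| <= e)).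
move=> H; have {}H : \forall d \near 0^'+, `[0, 1]%classic `<=`
    (fun r => forall z, `|z - Y r| < d -> `|G z - G (Y r)| <= e).
  apply: H => r _.
  have /cvgrPdist_le/(_ (e / 2)) := cG (Y r); rewrite divr_gt0// => /(_ isT).
  move=> /nbhs_normP[d /= d0 dG].
  have /cvgrPdist_lt/(_ (d / 2)) := cY r; rewrite divr_gt0// => /(_ isT) Yr.
  exists ([set r' | `|Y r - Y r'| < d / 2], [set d' | 0 < d' < d / 2]) =>
      [|[r' d'] /= [h1 h2] z zd].
    split => //=; near=> d'; apply/andP; split => //.
    by near: d'; apply: nbhs_right_lt; rewrite divr_gt0.
  have Yr' : `|G (Y r) - G (Y r')| <= e / 2.
    by apply: dG => /=; rewrite (lt_le_trans h1)// ler_pdivrMr// ler_pMr// ler1n.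
  have Gz : `|G (Y r) - G z| <= e / 2.
    apply: dG => /=; rewrite -(subrK (Y r') (Y r)) -addrA.
    rewrite (le_lt_trans (ler_normD _ _))// (splitr d) ltrD// distrC (lt_trans zd)//.
    by case/andP: h2.
  rewrite -(subrK (G (Y r)) (G z)) -addrA (le_trans (ler_normD _ _))//.
  by rewrite (splitr e) lerD// distrC.
move: H; apply: filterS => d H r r01; apply: H.
by rewrite /= in_itv.
Unshelve. all: by end_near. Qed.

(* Time is projected onto [0, t], where the hypotheses hold, to obtain functions that are
   continuous on the whole line. *)
Definition clamp (t r : R) : R := Num.max 0 (Num.min t r).

Lemma clampP t r : 0 <= t -> 0 <= clamp t r <= t.
Proof. by move=> t0; rewrite /clamp le_max lexx /= ge_max t0 /= ge_min lexx. Qed.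

Lemma clampK t r : 0 <= r <= t -> clamp t r = r.
Proof. by move=> /andP[r0 rt]; rewrite /clamp min_r// max_r. Qed.

Lemma clamp_continuous t : continuous (clamp t).
Proof.
apply: continuous_maxT; first exact: continuous_cstT.
by apply: continuous_minT; [exact: continuous_cstT|exact: continuous_idT].
Qed.

Lemma telescope_bound (a : nat -> R) (c : R) N : a 0%N = 0 ->
  (forall i, (i < N)%N -> `|a i.+1 - a i| <= c) -> forall i, (i <= N)%N -> `|a i| <= i%:R * c.
Proof.
move=> a0 ac; elim=> [_|i IHi iN]; first by rewrite a0 normr0 mul0r.
rewrite -(subrK (a i) (a i.+1)) (le_trans (ler_normD _ _))// -natr1 mulrDl mul1r addrC.
by rewrite lerD ?ac// IHi// ltnW.
Qed.

(** The amplification [1 + u] of each step is at most [expR u], and the new error [c] is enlarged by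
    an exponential factor at least 1 so that the form of the bound persists. *)
Lemma gronwall_discrete (a : nat -> R) (u c : R) N : 0 <= u -> 0 <= c -> a 0%N <= 0 ->
  (forall i, (i < N)%N -> a i.+1 <= (1 + u) * a i + c) ->
  forall i, (i <= N)%N -> a i <= i%:R * c * expR (u * i%:R).
Proof.
move=> u0 c0 a0 ac; elim=> [_|i IHi iN]; first by rewrite !mul0r.
rewrite (le_trans (ac _ _))//.
have e1 : 1 <= expR (u * i.+1%:R) by rewrite -expR0 ler_expR mulr_ge0.
have : (1 + u) * a i <= expR u * (i%:R * c * expR (u * i%:R)).
  apply: (@le_trans _ _ ((1 + u) * (i%:R * c * expR (u * i%:R)))).
    by rewrite ler_wpM2l ?addr_ge0// IHi// ltnW.
  by rewrite ler_wpM2r ?expR_ge1Dx// !mulr_ge0// expR_ge0.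
rewrite -natr1 mulrDr mulr1 expRD in e1 *.
move: e1; set E := expR (u * i%:R); set U := expR u => e1 h.
have -> : (i%:R + 1) * c * (E * U) = U * (i%:R * c * E) + c * (E * U) by ring.
by rewrite lerD// ler_peMr.
Qed.

(** The upper bound is [ln (1 + u) <= u]; the lower one is the same inequality for the inverse of
    [1 + u]. *)
Lemma ln1D_approx (u : R) : `|u| <= 1 / 2 -> `|ln (1 + u) - u| <= 2 * u ^+ 2.
Proof.
rewrite ler_norml => /andP[h1 h2].
have u1 : 0 < 1 + u by lra.
have le1 := @le_ln1Dx R u.
have : ln (1 + u)^-1 <= (1 + u)^-1 - 1.
  have := @le_ln1Dx R ((1 + u)^-1 - 1); rewrite [1 + (_ - 1)]addrC subrK; apply.
  by rewrite ltrBrDl subrr invr_gt0.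
rewrite lnV ?posrE// => le2; rewrite ler_norml; apply/andP; split; last first.
  by rewrite (@le_trans _ _ 0)// ?subr_le0 ?le1//; [lra|rewrite mulr_ge0// sqr_ge0].
have : (1 + u)^-1 - 1 <= - u + 2 * u ^+ 2.
  rewrite lerBlDr -[leLHS]mul1r ler_pdivrMr//.
  have : 0 <= u ^+ 2 * (1 + 2 * u) by rewrite mulr_ge0// ?sqr_ge0//; lra.
  by rewrite expr2 => ?; nra.
by move: le2; lra.
Qed.

End Uniformity.

(** * Convergence of the splitting scheme *)

Section SchemeConvergence.
Variables (R : realType) (n : nat).
Local Notation D := n.+1.

Lemma is_derive_coord (V : normedModType R) (Y : V -> 'rV[R]_D) (s w : V) (dY : 'rV[R]_D) j :
  is_derive s w Y dY -> is_derive s w (fun r => Y r 0 j) (dY 0 j).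
Proof.
move=> [dYs <-].
have Yc : (fun h : R => h^-1 *: (((fun r => Y r 0 j) \o shift s) (h *: w) - Y s 0 j)) @ 0^'
    --> 'D_w Y s 0 j.
  rewrite (_ : (fun h : R => _) = (fun h : R => (h^-1 *: ((Y \o shift s) (h *: w) - Y s)) 0 j)).
    exact: cvg_coord dYs.
  by apply/funext => h; rewrite !mxE.
by split; [apply/cvg_ex; eexists; exact: Yc|apply/cvg_lim].
Qed.

(* Number of moves of the coordinate [l] among the first [i] steps of the scheme. *)
Definition dir_count (l : 'I_D) (i : nat) : nat := (i %/ D + (l < i %% D))%N.

Lemma dir_count0 l : dir_count l 0 = 0%N.
Proof. by rewrite /dir_count div0n mod0n. Qed.

Lemma dir_countM l N : dir_count l (N * D) = N.
Proof. by rewrite /dir_count mulnK// modnMl addn0. Qed.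

Lemma dir_countS l i : dir_count l i.+1 = (dir_count l i + (l == scheme_dir n i))%N.
Proof.
rewrite /dir_count -[l == _]/(nat_of_ord l == nat_of_ord _) /scheme_dir inordK ?ltn_mod//.
have := ltn_mod i D; rewrite ltn0Sn => rD.
rewrite [in LHS](divn_eq i D) -addnS.
set q := (i %/ D)%N; set r := (i %% D)%N in rD *.
rewrite divnMDl// modnMDl; have [rD1|rD1] := ltnP r.+1 D.
  rewrite divn_small// modn_small// addn0; lia.
have -> : r.+1 = D by lia.
by rewrite divnn modnn; have := ltn_ord l; lia.
Qed.

Lemma dir_count_dir i : dir_count (scheme_dir n i) i = (i %/ D)%N.
Proof. by rewrite /dir_count /scheme_dir inordK ?ltn_mod// ltnn addn0. Qed.

Variables (v : 'rV[R]_D -> R -> 'rV[R]_D) (b : 'I_D -> 'rV[R]_D -> R -> R) (L : R).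
Hypothesis v_cont : forall j, continuous (fun z : 'rV[R]_D * R => v z.1 z.2 0 j).
Hypothesis b_cont : forall j, continuous (fun z : 'rV[R]_D * R => b j z.1 z.2).
Hypothesis v_der : forall j s x, is_derive x (basis_vec R j) (fun y => v y s 0 j) (b j x s).
Hypothesis L_ge1 : 1 <= L.
Hypothesis v_lip : forall x y s, 0 <= s <= 1 -> `|v x s - v y s| <= L * `|x - y|.
Variable Y : R -> 'rV[R]_D.
Hypothesis Y_cont : continuous Y.
Hypothesis Y_der : forall s : R, 0 < s < 1 -> is_derive s 1 Y (v (Y s) s).
Variable t : R.
Hypothesis t01 : 0 <= t <= 1.

Let L_gt0 : 0 < L. Proof. exact: lt_le_trans ltr01 L_ge1. Qed.

(* The scheme is compared with the solution read with each coordinate at its own clock; both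
   then change in the same single coordinate at each step. *)
Definition curve_ref (h : R) (i : nat) : 'rV[R]_D := \row_l Y (h * (dir_count l i)%:R) 0 l.

Lemma curve_refS h i : curve_ref h i.+1 = curve_ref h i +
  (Y (h * (i %/ D).+1%:R) 0 (scheme_dir n i) - Y (h * (i %/ D)%:R) 0 (scheme_dir n i))
    *: basis_vec R (scheme_dir n i).
Proof.
apply/rowP => l; rewrite !mxE dir_countS eqxx /=.
have [->|lj] := eqVneq l (scheme_dir n i).
  by rewrite dir_count_dir addn1 mulr1 addrC subrK.
by rewrite addn0 mulr0 addr0.
Qed.

Lemma near_step (d : R) : 0 < d -> \forall N \near \oo, (0 < N)%N /\ t / N%:R < d.
Proof.
move=> d0; have [M Md] : exists M : nat, d^-1 < M%:R.
  by exists (Num.truncn d^-1).+1; rewrite truncnS_gt.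
exists M.+1 => // N /= MN; have N0 : (0 < N)%N by exact: leq_trans MN.
split => //; rewrite ltr_pdivrMr ?ltr0n//.
rewrite (@le_lt_trans _ _ 1)//; first by case/andP: t01.
by rewrite -ltr_pdivrMl// mulr1 (lt_trans Md)// ltr_nat.
Qed.

Lemma step_time_le1 N i : (0 < N)%N -> (i < N * D)%N ->
  0 <= t / N%:R * (i %/ D)%:R /\ t / N%:R * (i %/ D).+1%:R <= 1.
Proof.
move=> N0 iN; case/andP: t01 => t0 t1; split; first by rewrite !mulr_ge0// invr_ge0.
rewrite mulrAC ler_pdivrMr ?ltr0n// mul1r.
have kN : (i %/ D < N)%N by rewrite ltn_divLR.
by rewrite -[leRHS]mul1r ler_pM// ler_nat.
Qed.

Lemma curve_modulus (G : 'I_D -> 'rV[R]_D * R -> R) :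
  (forall j, continuous (G j)) -> forall e, 0 < e ->
  exists2 d, 0 < d & forall j z s r, 0 <= r <= 1 -> `|z - Y r| < d -> `|s - r| < d ->
    `|G j (z, s) - G j (Y r, r)| <= e.
Proof.
move=> cG e e0.
have cYr : continuous (fun r => (Y r, r)) by apply: continuous_pairT => //; exact: continuous_idT.
have H : \forall d \near 0^'+, forall j r, 0 <= r <= 1 -> forall z, `|z - (Y r, r)| < d ->
    `|G j z - G j (Y r, r)| <= e.
  by apply: filter_forall => j; exact: (uniform_along cYr (@cG j) e0).
have [d [dP d0]] := @filter_ex _ (0 : R)^'+ _ _ (filterI H (nbhs_right_gt 0)).
exists d => // j z s r r01 zd sd; apply: dP => //.
by rewrite prod_normE/= gt_max zd sd.
Qed.

Lemma curve_ref_close e : 0 < e -> \forall N \near \oo,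
  forall i r, (i < N * D)%N ->
    t / N%:R * (i %/ D)%:R <= r <= t / N%:R * (i %/ D).+1%:R ->
    `|curve_ref (t / N%:R) i - Y r| <= e.
Proof.
move=> e0.
have H : \forall d \near 0^'+, forall l : 'I_D, forall r, 0 <= r <= 1 -> forall z : R,
    `|z - r| < d -> `|Y z 0 l - Y r 0 l| <= e.
  apply: filter_forall => l.
  apply: (@uniform_along R R (fun r => r) (fun r => Y r 0 l)) => //; first exact: continuous_idT.
  by move=> r; apply: cvg_coord; exact: Y_cont.
have [d [dP d0]] := @filter_ex _ (0 : R)^'+ _ _ (filterI H (nbhs_right_gt 0)).
have := near_step d0; apply: filterS => N [N0 hd] i r iN ri.
have [k0 k1] := step_time_le1 N0 iN.
have h0 : 0 <= t / N%:R by case/andP: t01 => ? ?; rewrite divr_ge0.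
apply: rV_norm_le => [|l]; first exact: ltW.
rewrite !mxE; apply: dP.
  by case/andP: ri => r1 r2; rewrite (le_trans k0)// (le_trans r2).
rewrite (le_lt_trans _ hd)//.
move: ri; rewrite -natr1 mulrDr mulr1 /dir_count.
set h := t / N%:R in h0 *; set k := (i %/ D)%N => /andP[r1 r2].
case: (l < i %% D)%N; rewrite ?addn1 ?addn0 -?natr1 ?mulrDr ?mulr1.
  by rewrite ler_norml; apply/andP; split; lra.
by rewrite ler_norml; apply/andP; split; lra.
Qed.

Lemma curve_increment N i (f df : R -> R) : (0 < N)%N -> (i < N * D)%N ->
  {within `[0, 1], continuous f} -> (forall s : R, 0 < s < 1 -> is_derive s 1 f (df s)) ->
  exists2 r, t / N%:R * (i %/ D)%:R <= r <= t / N%:R * (i %/ D).+1%:R &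
   f (t / N%:R * (i %/ D).+1%:R) - f (t / N%:R * (i %/ D)%:R) = t / N%:R * df r.
Proof.
move=> N0 iN cf dfE; have [k0 k1] := step_time_le1 N0 iN.
have h0 : 0 <= t / N%:R by case/andP: t01 => ? ?; rewrite divr_ge0.
have kk : t / N%:R * (i %/ D)%:R <= t / N%:R * (i %/ D).+1%:R by rewrite ler_wpM2l// ler_nat.
have := @MVT_segment R f df _ _ kk; case.
- move=> s; rewrite in_itv/= => /andP[s0 s1]; apply: dfE.
  by rewrite (le_lt_trans k0)// (lt_le_trans s1).
- apply: continuous_subspaceW cf => s /=; rewrite !in_itv/= => /andP[s0 s1].
  by rewrite (le_trans k0)// (le_trans s1).
- move=> r; rewrite in_itv/= => ri ->; exists r => //.
  by rewrite -mulrBr -natrB// subSnn mulr1 mulrC.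
Qed.

(** At each step the scheme and [curve_ref] move along the same axis, one by [h] times the velocity
    at its own point, the other by [h] times the velocity at some mean-value time. The Lipschitz
    bound and the modulus of continuity yield the recursion of [gronwall_discrete]. *)
Lemma scheme_close e : 0 < e -> \forall N \near \oo, forall i, (i <= N * D)%N ->
  `|scheme v (t / N%:R) (Y 0) i - curve_ref (t / N%:R) i| <= e.
Proof.
(* There are at most [N * D] steps with [h * N <= 1], so [h * i <= D]: Gronwall with a local error
   [h * e / C] returns at most [e]. *)
move=> e0; pose C := D%:R * expR (L * D%:R).
have C0 : 0 < C by rewrite mulr_gt0// expR_gt0.
have eC : 0 < e / C by rewrite divr_gt0.
have [d d0 dP] := curve_modulus v_cont eC.
have d20 : 0 < d / 2 by rewrite divr_gt0.
apply: filterS2 (near_step d0) (curve_ref_close d20) => N [N0 hd] ref i iN.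
set h := t / N%:R in hd ref *.
have h0 : 0 <= h by case/andP: t01 => ? ?; rewrite divr_ge0.
have hN : h * N%:R <= 1.
  by rewrite /h -mulrA mulVf ?mulr1 ?pnatr_eq0 -?lt0n//; case/andP: t01.
pose a i := `|scheme v h (Y 0) i - curve_ref h i|.
have a0 : a 0%N <= 0.
  rewrite /a /= (_ : Y 0 - _ = 0) ?normr0//; apply/rowP => l.
  by rewrite !mxE dir_count0 mulr0 subrr.
have aS k : (k < N * D)%N -> a k.+1 <= (1 + h * L) * a k + h * (e / C).
  move=> kN; have [q0 q1] := step_time_le1 N0 kN.
  pose j := scheme_dir n k; pose s := scheme_time n h k.
  have cY : {within `[0, 1], continuous (fun r => Y r 0 j)}.
    by apply: continuous_withinT => r; apply: cvg_coord; exact: Y_cont.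
  have [r rk dY] := curve_increment N0 kN cY (fun s s01 => is_derive_coord j (Y_der s01)).
  have r01 : 0 <= r <= 1.
    by case/andP: rk => r0 r1; rewrite (le_trans q0)// (le_trans r1).
  have hk0 : 0 <= s <= 1.
    by rewrite /s /scheme_time q0/= (le_trans _ q1)// ler_wpM2l// ler_nat.
  have sr : `|s - r| < d.
    rewrite (le_lt_trans _ hd)// ler_norml.
    move: rk; rewrite -natr1 mulrDr mulr1 -/h -/(scheme_time n h k) -/s => /andP[r0 r1].
    by apply/andP; split; lra.
  have zr : `|curve_ref h k - Y r| < d.
    by rewrite (le_lt_trans (ref _ _ kN rk))// ltr_pdivrMr// ltr_pMr// ltr1n.
  have e1 := dP j _ _ _ r01 zr sr.
  have e2 : `|v (scheme v h (Y 0) k) s 0 j - v (curve_ref h k) s 0 j| <= L * a k.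
    have := coord_norm_le (v (scheme v h (Y 0) k) s - v (curve_ref h k) s) j.
    by rewrite !mxE => /le_trans; apply; exact: v_lip.
  rewrite /a curve_refS dY /= -/j -/s opprD addrACA -scalerBl -mulrBr.
  rewrite (le_trans (ler_normD _ _))// mulrDl mul1r -addrA lerD2l.
  rewrite normrZ basis_vec_norm mulr1 normrM (ger0_norm h0) -mulrA -mulrDr ler_wpM2l//.
  rewrite -(subrK (v (curve_ref h k) s 0 j) (v (scheme v h (Y 0) k) s 0 j)) -addrA.
  by rewrite (le_trans (ler_normD _ _))// lerD.
have hL0 : 0 <= h * L by rewrite mulr_ge0// ltW.
have he0 : 0 <= h * (e / C) by rewrite mulr_ge0// ltW.
rewrite (le_trans (gronwall_discrete hL0 he0 a0 aS iN))//.
have iD : h * i%:R <= D%:R.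
  rewrite (@le_trans _ _ (h * (N * D)%:R))//; first by rewrite ler_wpM2l// ler_nat.
  by rewrite natrM mulrA -[leRHS]mul1r ler_wpM2r.
rewrite (@le_trans _ _ (D%:R * (e / C) * expR (L * D%:R)))//; last first.
  by rewrite mulrAC -/C mulrC divfK// gt_eqF.
rewrite mulrA [i%:R * h]mulrC ler_pM ?expR_ge0//.
- by apply: mulr_ge0; [exact: mulr_ge0|exact: ltW].
- by rewrite ler_wpM2r// ltW.
- by rewrite ler_expR mulrAC mulrC ler_wpM2l// ltW.
Qed.

Lemma scheme_cvg : scheme v (t / N%:R) (Y 0) (N * D) @[N --> \oo] --> Y t.
Proof.
apply/cvgrPdist_le => /= e e0.
apply: filterS2 (near_step ltr01) (scheme_close e0) => N [N0 _] H.
(* After [N * D] steps all the coordinate clocks agree and show [t]. *)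
rewrite distrC; have := H _ (leqnn _); rewrite (_ : curve_ref _ _ = Y t)//.
apply/rowP => l; rewrite mxE dir_countM divfK// pnatr_eq0 -lt0n//.
Qed.

Variable F : 'I_D -> R -> R.
Hypothesis F0 : forall j, F j 0 = 0.
Hypothesis F_cont : forall j, {within `[0, 1], continuous (F j)}.
Hypothesis F_der : forall j (s : R), 0 < s < 1 -> is_derive s 1 (F j) (b j (Y s) s).

(** The logarithm turns the product into a sum of [ln (1 + h * b)]. Each term is close to [h * b],
    with a quadratic error, and then to the increment of one [F j] over the same step. Read at the
    coordinate clocks, these increments telescope. *)
Lemma scheme_jac_cvg :
  scheme_jac v b (t / N%:R) (Y 0) (N * D) @[N --> \oo] --> expR (\sum_j F j t).
Proof.
(* A step smaller than the inverse of [L] makes every factor positive, so that logarithms may be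
   taken. *)
have posJ : \forall N \near \oo, forall i, (i <= N * D)%N ->
    0 < scheme_jac v b (t / N%:R) (Y 0) i.
  have iL : 0 < L^-1 by rewrite invr_gt0.
  have := near_step iL; apply: filterS => N [N0 hL].
  have h0 : 0 <= t / N%:R by case/andP: t01 => ? ?; rewrite divr_ge0.
  elim=> [_|i IHi iN] //=; rewrite mulr_gt0 ?IHi 1?ltnW//.
  have [q0 q1] := step_time_le1 N0 iN.
  have s01 : 0 <= scheme_time n (t / N%:R) i <= 1.
    by rewrite q0/= (le_trans _ q1)// ler_wpM2l// ler_nat.
  have := jac_bound v_der v_lip (scheme_dir n i) (scheme v (t / N%:R) (Y 0) i) s01.
  rewrite ler_norml => /andP[bL _].
  have : - 1 < t / N%:R * b (scheme_dir n i) (scheme v (t / N%:R) (Y 0) i)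
      (scheme_time n (t / N%:R) i).
    apply: (@lt_le_trans _ _ (t / N%:R * - L)); last by rewrite ler_wpM2l.
    by rewrite mulrN ltrN2 -ltr_pdivlMr// mul1r.
  by rewrite -subr_gt0 opprK addrC.
suff lnJ : ln (scheme_jac v b (t / N%:R) (Y 0) (N * D)) @[N --> \oo] --> \sum_j F j t.
  apply: (@cvg_trans _ ((expR \o (fun N => ln (scheme_jac v b (t / N%:R) (Y 0) (N * D)))) @ \oo)).
    apply: near_eq_cvg; move: posJ; apply: filterS => N H /=.
    by rewrite lnK// posrE H.
  by apply: continuous_cvg => //; exact: continuous_expR.
apply/cvgrPdist_le => /= e e0.
(* Each of the [N * D] steps costs at most [h * (e1 + e1)], and [h * N <= 1]. *)
pose e1 := e / (D%:R * 2).
have e10 : 0 < e1 by rewrite divr_gt0.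
have [d d0 dP] := curve_modulus b_cont e10.
have d30 : 0 < d / 3 by rewrite divr_gt0.
(* The three bounds on the step serve the modulus of continuity of [b], the condition [|u| <= 1 / 2]
   of [ln1D_approx], and its remainder [2 * (h * L) ^+ 2 <= h * e1]. *)
pose d4 := Num.min d (Num.min (1 / 2 / L) (e1 / (2 * L ^+ 2))).
have d40 : 0 < d4 by rewrite !lt_min d0 !divr_gt0// ?mulr_gt0// exprn_gt0.
apply: filterS2 (filterI posJ (near_step d40)) (filterI (curve_ref_close d30) (scheme_close d30)).
move=> N [{}posJ [N0 hd]] [ref sch].
set h := t / N%:R in posJ hd ref sch *.
have h0 : 0 <= h by case/andP: t01 => ? ?; rewrite divr_ge0.
have hN : h * N%:R <= 1.
  by rewrite /h -mulrA mulVf ?mulr1 ?pnatr_eq0 -?lt0n//; case/andP: t01.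
move: hd; rewrite !lt_min => /and3P[hd hL hL2].
pose a i := ln (scheme_jac v b h (Y 0) i) - \sum_j F j (h * (dir_count j i)%:R).
have a0 : a 0%N = 0.
  by rewrite /a /= ln1 big1 ?subrr// => j _; rewrite dir_count0 mulr0.
have aS k : (k < N * D)%N -> `|a k.+1 - a k| <= h * (e1 + e1).
  move=> kN; have [q0 q1] := step_time_le1 N0 kN.
  pose j := scheme_dir n k; pose s := scheme_time n h k.
  have [r rk dF] := curve_increment N0 kN (F_cont (j := j)) (F_der j).
  have r01 : 0 <= r <= 1.
    by case/andP: rk => r0 r1; rewrite (le_trans q0)// (le_trans r1).
  have s01 : 0 <= s <= 1.
    by rewrite /s /scheme_time q0/= (le_trans _ q1)// ler_wpM2l// ler_nat.
  have sr : `|s - r| < d.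
    rewrite (le_lt_trans _ hd)// ler_norml.
    move: rk; rewrite -natr1 mulrDr mulr1 -/h -/(scheme_time n h k) -/s => /andP[r0 r1].
    by apply/andP; split; lra.
  have zr : `|scheme v h (Y 0) k - Y r| < d.
    rewrite -(subrK (curve_ref h k) (scheme v h (Y 0) k)) -addrA.
    rewrite (le_lt_trans (ler_normD _ _))//.
    rewrite (@le_lt_trans _ _ (d / 3 + d / 3))// ?lerD ?ref// ?sch 1?ltnW//.
    lra.
  have eb := dP j _ _ _ r01 zr sr.
  set u := h * b j (scheme v h (Y 0) k) s.
  have uL : `|u| <= h * L.
    by rewrite normrM (ger0_norm h0) ler_wpM2l//; exact: jac_bound s01.
  have u1 : 0 < 1 + u.
    have := posJ k.+1 kN; have := posJ k (ltnW kN) => /= J0.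
    by rewrite pmulr_rgt0.
  have -> : a k.+1 - a k = ln (1 + u) - h * b j (Y r) r.
    rewrite /a /= -/j -/s -/u lnM ?posrE ?(posJ k (ltnW kN))//.
    have -> : \sum_j F j (h * (dir_count j k.+1)%:R) = \sum_j F j (h * (dir_count j k)%:R)
        + h * b j (Y r) r.
      rewrite -dF (bigD1 j)//= [in RHS](bigD1 j)//= dir_countS eqxx dir_count_dir addn1.
      rewrite [X in _ + X = _](eq_bigr (fun l => F l (h * (dir_count l k)%:R))); first ring.
      by move=> l lj; rewrite dir_countS (negbTE lj) addn0.
    ring.
  rewrite -(subrK u (ln (1 + u))) -addrA (le_trans (ler_normD _ _))// mulrDr lerD//.
    rewrite (le_trans (ln1D_approx _))//.
      by rewrite (le_trans uL)// -ler_pdivlMr// ltW.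
    rewrite -real_normK ?num_real// (@le_trans _ _ (2 * (h * L) ^+ 2))//.
      by rewrite ler_wpM2l// ler_sqr ?nnegrE// mulr_ge0// ltW.
    have -> : 2 * (h * L) ^+ 2 = h * (h * (2 * L ^+ 2)) by ring.
    by rewrite ler_wpM2l// -ler_pdivlMr ?mulr_gt0 ?exprn_gt0// ltW.
  by rewrite /u -mulrBr normrM (ger0_norm h0) ler_wpM2l.
have E : \sum_j F j (h * (dir_count j (N * D))%:R) = \sum_j F j t.
  by apply: eq_bigr => j _; rewrite dir_countM /h divfK// pnatr_eq0 -lt0n.
have := telescope_bound a0 aS (leqnn _); rewrite /a E distrC => /le_trans; apply.
have -> : (N * D)%:R * (h * (e1 + e1)) = h * N%:R * e.
  rewrite natrM /e1; field.
  by rewrite gt_eqF// ltr_pwDl.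
by rewrite ler_piMl// ltW.
Qed.

End SchemeConvergence.

(** * Liouville's formula *)

Section Liouville.
Variables (R : realType) (n : nat).
Local Notation D := n.+1.
Local Notation mu := (@lebesgue_measure R).
Variables (v : 'rV[R]_D -> R -> 'rV[R]_D) (b : 'I_D -> 'rV[R]_D -> R -> R) (L : R).
Hypothesis v_cont : forall j, continuous (fun z : 'rV[R]_D * R => v z.1 z.2 0 j).
Hypothesis b_cont : forall j, continuous (fun z : 'rV[R]_D * R => b j z.1 z.2).
Hypothesis v_der : forall j s x, is_derive x (basis_vec R j) (fun y => v y s 0 j) (b j x s).
Hypothesis L_ge1 : 1 <= L.
Hypothesis v_lip : forall x y s, 0 <= s <= 1 -> `|v x s - v y s| <= L * `|x - y|.
Variable V0 : R.
Hypothesis v0 : forall s, 0 <= s <= 1 -> `|v 0 s| <= V0.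
Variable t : R.
Hypothesis t01 : 0 <= t <= 1.

Let L_gt0 : 0 < L. Proof. exact: lt_le_trans ltr01 L_ge1. Qed.

Let V0_ge0 : 0 <= V0.
Proof. by apply: le_trans (v0 (s := 0) _) => //; rewrite lexx ler01. Qed.

Lemma scheme_continuous h i : continuous (fun x => scheme v h x i).
Proof.
elim: i => [|i IHi] /=; first exact: continuous_idT.
apply: continuous_addT => //; apply: continuous_scalelT.
apply: continuous_mulT; first exact: continuous_cstT.
exact: (continuous_compT (@v_cont1 _ _ v v_cont (scheme_dir n i) (scheme_time n h i)) IHi).
Qed.

Lemma scheme_jac_continuous h i : continuous (fun x => scheme_jac v b h x i).
Proof.
elim: i => [|i IHi] /=; first exact: continuous_cstT.
apply: continuous_mulT => //; apply: continuous_addT; first exact: continuous_cstT.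
apply: continuous_mulT; first exact: continuous_cstT.
exact: (continuous_compT (@b_cont1 _ _ b b_cont (scheme_dir n i) (scheme_time n h i))
    (@scheme_continuous h i)).
Qed.

(* Where the scheme ends in a ball it also started in a ball independent of the step size,
   which gives the dominating function in the limit. *)
Lemma scheme_lower h x i : 0 <= h -> h * L <= 1 / 2 ->
  (forall k, (k < i)%N -> 0 <= scheme_time n h k <= 1) ->
  `|x| + V0 <= expR (2 * (h * L) * i%:R) * (`|scheme v h x i| + V0).
Proof.
move=> h0 hL; elim: i => [|i IHi] t1; first by rewrite mulr0 expR0 mul1r.
rewrite (le_trans (IHi _))//; first by move=> k ki; apply: t1; rewrite ltnW.
rewrite -[i.+1%:R]natr1 [_ * (i%:R + 1)]mulrDr mulr1 expRD -[leRHS]mulrA ler_wpM2l ?expR_ge0//=.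
set y := scheme v h x i; set s := scheme_time n h i; set j := scheme_dir n i.
have s01 : 0 <= s <= 1 by exact: t1.
have vy : `|v y s 0 j| <= L * (`|y| + V0).
  rewrite (le_trans (coord_norm_le _ _))//.
  rewrite -(subrK (v 0 s) (v y s)) (le_trans (ler_normD _ _))// mulrDr lerD//.
    by have := v_lip y 0 s01; rewrite subr0.
  by rewrite (le_trans (v0 s01))// ler_peMl.
set y' := y + _.
have yy' : `|y| <= `|y'| + h * (L * (`|y| + V0)).
  rewrite -[X in `|X| <= _](addrK ((h * v y s 0 j) *: basis_vec R j)) -/y'.
  rewrite (le_trans (ler_normB _ _))// lerD2l normrZ basis_vec_norm mulr1 normrM.
  by rewrite (ger0_norm h0) ler_wpM2l.
have e2 := @expR_ge1Dx R (2 * (h * L)).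
set u := h * L in hL e2 *; have u0 : 0 <= u by rewrite mulr_ge0// ltW.
have ny := normr_ge0 y; have ny' := normr_ge0 y'.
have yy2 : (1 - u) * (`|y| + V0) <= `|y'| + V0.
  by move: yy'; rewrite mulrA -/u; lra.
(* The factor 2 in the exponent comes from [(1 + 2 * u) * (1 - u) = 1 + u * (1 - 2 * u) >= 1] for
   [u <= 1 / 2]. *)
rewrite (@le_trans _ _ ((1 + 2 * u) * (`|y'| + V0)))//; last first.
  by rewrite ler_wpM2r// addr_ge0.
rewrite (@le_trans _ _ ((1 + 2 * u) * ((1 - u) * (`|y| + V0))))//; last first.
  by rewrite ler_wpM2l// addr_ge0// mulr_ge0.
rewrite mulrA ler_peMl ?addr_ge0//.
have : 0 <= u * (1 - 2 * u) by rewrite mulr_ge0//; lra.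
by nra.
Qed.

Lemma scheme_jac_bound h x i : 0 <= h -> h * L <= 1 / 2 ->
  (forall k, (k < i)%N -> 0 <= scheme_time n h k <= 1) ->
  0 <= scheme_jac v b h x i <= expR (h * L * i%:R).
Proof.
move=> h0 hL; elim: i => [|i IHi] t1; first by rewrite /= mulr0 expR0 ler01 lexx.
have /andP[J0 J1] : 0 <= scheme_jac v b h x i <= expR (h * L * i%:R).
  by apply: IHi => k ki; apply: t1; rewrite ltnW.
have s01 := t1 _ (ltnSn i).
have bL := jac_bound v_der v_lip (scheme_dir n i) (scheme v h x i) s01.
have hb : `|h * b (scheme_dir n i) (scheme v h x i) (scheme_time n h i)| <= h * L.
  by rewrite normrM (ger0_norm h0) ler_wpM2l.
move: hb; rewrite ler_norml /= => /andP[h1 h2].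
rewrite mulr_ge0//=; last by lra.
rewrite -[i.+1%:R]natr1 [_ * (i%:R + 1)]mulrDr mulr1 expRD ler_pM//; first lra.
by rewrite (le_trans _ (expR_ge1Dx _))// lerD2l.
Qed.

Variable phi : 'rV[R]_D -> R -> 'rV[R]_D.
Hypothesis phi0 : forall x, phi x 0 = x.
Hypothesis phi_cont : forall x, continuous (phi x).
Hypothesis phi_der : forall x (s : R), 0 < s < 1 -> is_derive s 1 (phi x) (v (phi x s) s).
Variable F : 'rV[R]_D -> 'I_D -> R -> R.
Hypothesis F0 : forall x j, F x j 0 = 0.
Hypothesis F_cont : forall x j, {within `[0, 1], continuous (F x j)}.
Hypothesis F_der : forall x j (s : R), 0 < s < 1 -> is_derive s 1 (F x j) (b j (phi x s) s).

Lemma phi_scheme_cvg x : scheme v (t / N%:R) x (N * D) @[N --> \oo] --> phi x t.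
Proof. by have := scheme_cvg v_cont L_ge1 v_lip (@phi_cont x) (@phi_der x) t01; rewrite phi0. Qed.

Lemma phi_jac_cvg x :
  scheme_jac v b (t / N%:R) x (N * D) @[N --> \oo] --> expR (\sum_j F x j t).
Proof.
have := scheme_jac_cvg v_cont b_cont v_der L_ge1 v_lip (@phi_cont x) (@phi_der x) t01 (F0 x)
  (@F_cont x) (@F_der x).
by rewrite phi0.
Qed.

(** The identity is exact for the scheme at every small step size, and the limit is taken by
    dominated convergence. Since [f] has bounded support, it is bounded and all the integrands
    vanish outside one common cube. *)
Lemma liouville (f : 'rV[R]_D -> R) (r : R) : continuous f -> (forall x, 0 <= f x) ->
  (forall x, r < `|x| -> f x = 0) ->
  lebRn (fun x => (f (phi x t) * expR (\sum_j F x j t))%:E) = lebRn (fun x => (f x)%:E).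
Proof.
move=> cf f0 fr.
have [t0 t1] := andP t01.
have [m mE] := lebRn_measure R D.
have [K fK] : exists K, forall x, f x <= K.
  have cK : compact [set x : 'rV[R]_D | `|x| <= r].
    apply: bounded_closed_compact.
      by exists r; split; [exact: num_real|move=> M rM x /= xr; rewrite (le_trans xr)// ltW].
    apply: (@closed_comp _ _ (fun x : 'rV[R]_D => `|x|) [set y | y <= r]); last exact: closed_le.
    by move=> x _; exact: norm_continuous.
  have [[x0 x0r]|ne] := pselect ([set x : 'rV[R]_D | `|x| <= r] !=set0).
    have [c cr cM] := EVT_max_rV (ex_intro _ x0 x0r) cK (continuous_withinT cf).
    exists (Num.max (f c) 0) => x; have [xr|rx] := leP `|x| r.
      by rewrite le_max cM// inE.
    by rewrite fr// le_max lexx orbT.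
  exists 0 => x; have [xr|rx] := leP `|x| r; last by rewrite fr.
  by exfalso; apply: ne; exists x.
have K0 : 0 <= K by exact: le_trans (f0 0) (fK 0).
(* By [scheme_lower] and [h * i <= D], every start from which the scheme ends within [r] has norm at
   most [rr]; the absolute value covers a negative [r]. The constant [C] below combines the bound on
   [f] with [scheme_jac_bound]. *)
pose rr := expR (2 * L * D%:R) * (`|r| + V0).
pose C := K * expR (L * D%:R).
have C0 : 0 <= C by rewrite mulr_ge0// expR_ge0.
pose g1 (a : R) : R := \1_(`[- rr, rr]%classic : set R) a.
have rr0 : 0 <= rr by rewrite mulr_ge0 ?expR_ge0// addr_ge0.
have g1E : (\int[mu]_a (g1 a)%:E = (rr + rr)%:E)%E.
  rewrite integral_indic//= setIT lebesgue_measure_itv/= lte_fin.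
  case: ltP => [_|]; first by rewrite -EFinB opprK.
  by move=> h; congr EFin; lra.
pose g (u : D.-tuple R) := C * \prod_i g1 (tnth u i).
have mg1 : measurable_fun setT g1 by exact: measurable_indic.
have g10 a : 0 <= g1 a by rewrite /g1.
have mg : measurable_fun setT g.
  apply: measurable_funM => //; apply: measurable_prod => i _.
  exact: measurableT_comp mg1 (measurable_tnth i).
have g0 u : 0 <= g u by rewrite mulr_ge0// prodr_ge0.
have ig : m.-integrable setT (EFin \o g).
  apply/integrableP; split; first exact/measurable_EFinP.
  rewrite (_ : (\int[m]_u `|(EFin \o g) u| =
      \int[m]_u (C%:E * (\prod_i g1 (tnth u i))%:E))%E); last first.
    by apply: eq_integral => u _ /=; rewrite ger0_norm// -EFinM.
  rewrite ge0_integralZl//.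
  - rewrite mE; last 2 first.
    + by apply/measurable_EFinP/measurable_prod => i _; exact: measurableT_comp mg1
        (measurable_tnth i).
    + by move=> u; rewrite lee_fin prodr_ge0.
    rewrite (eq_lebRn (g := fun x => (\prod_i g1 (x 0 i))%:E)); last first.
      by move=> x; congr EFin; apply: eq_bigr => i _; rewrite tnth_mktuple.
    by rewrite (lebRn_prod _ mg1 g10 g1E) -EFinM ltry.
  - by apply/measurable_EFinP/measurable_prod => i _; exact: measurableT_comp mg1
      (measurable_tnth i).
  - by move=> u _; rewrite lee_fin prodr_ge0.
have [N0 _ N0P] : \forall N \near \oo, (0 < N)%N /\ t / N%:R < 1 / 2 / L.
  by apply: (near_step t01); rewrite !divr_gt0.
(* The shift by [N0] makes the step small at every index, so that the exact identity and the
   domination hold along the whole sequence. *)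
pose h N := t / (N + N0)%:R.
have hP N : [/\ 0 <= h N, h N * L <= 1 / 2, (0 < N + N0)%N &
    forall k, (k < (N + N0) * D)%N -> 0 <= scheme_time n (h N) k <= 1].
  have [NN0 hN] := N0P (N + N0)%N (leq_addl _ _).
  split => //.
  - by rewrite divr_ge0.
  - by rewrite -ler_pdivlMr// ltW.
  - move=> k kN; have [q0 q1] := step_time_le1 t01 NN0 kN.
    by rewrite q0/= (le_trans _ q1)// ler_wpM2l ?divr_ge0// ler_nat.
pose f_ N x := f (scheme v (h N) x ((N + N0) * D)) * scheme_jac v b (h N) x ((N + N0) * D).
have cf_ N : continuous (f_ N).
  apply: continuous_mulT; last exact: scheme_jac_continuous.
  by apply: (continuous_compT cf); exact: scheme_continuous.
have f_0 N x : 0 <= f_ N x.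
  have [h0 hL _ ht] := hP N.
  by rewrite mulr_ge0//; have /andP[] := scheme_jac_bound x h0 hL ht.
have f_E N : lebRn (fun x => (f_ N x)%:E) = lebRn (fun x => (f x)%:E).
  have [h0 hL _ ht] := hP N.
  apply: (scheme_preserve v_cont b_cont v_der v_lip h0) => //.
    by apply: (le_lt_trans hL); lra.
  by move=> k kN; have /andP[] := ht k kN.
have hNN N : h N * ((N + N0) * D)%:R <= D%:R.
  have [_ _ NN0 _] := hP N.
  by rewrite natrM mulrA /h divfK ?pnatr_eq0 -?lt0n// -[leRHS]mul1r ler_wpM2r.
have f_g N u : f_ N (untup u) <= g u.
  have [h0 hL _ ht] := hP N.
  have [xr|rx] := leP `|scheme v (h N) (untup u) ((N + N0) * D)| r; last first.
    by rewrite /f_ fr// mul0r.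
  have /andP[J0 J1] := scheme_jac_bound (untup u) h0 hL ht.
  have ur : `|untup u| <= rr.
    rewrite -[leLHS]addr0 (@le_trans _ _ (`|untup u| + V0)) ?lerD2l//.
    rewrite (le_trans (scheme_lower _ h0 hL ht))// ler_pM ?expR_ge0 ?addr_ge0//.
      have := hNN N; rewrite ler_expR; move: (_ * D)%:R => X hX.
      have -> : 2 * (h N * L) * X = 2 * L * (h N * X) by ring.
      by rewrite ler_wpM2l// mulr_ge0// ltW.
    by rewrite lerD2r (le_trans xr)// ler_norm.
  rewrite /f_ /g (eq_bigr (fun=> 1)); last first.
    move=> i _; rewrite /g1 indicE mem_set//= in_itv/= -ler_norml.
    by have := coord_norm_le (untup u) i; rewrite mxE => /le_trans; apply.
  rewrite big1// mulr1 ler_pM// (le_trans J1)// ler_expR.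
  have := hNN N; move: (_ * D)%:R => X hX.
  have -> : h N * L * X = L * (h N * X) by ring.
  by rewrite ler_wpM2l// ltW.
pose fl x := f (phi x t) * expR (\sum_j F x j t).
have f_cvg x : f_ N x @[N --> \oo] --> fl x.
  have c1 : scheme v (h N) x ((N + N0) * D) @[N --> \oo] --> phi x t.
    have := @phi_scheme_cvg x.
    by rewrite -(cvg_shiftn N0).
  have c2 : scheme_jac v b (h N) x ((N + N0) * D) @[N --> \oo] --> expR (\sum_j F x j t).
    have := @phi_jac_cvg x.
    by rewrite -(cvg_shiftn N0).
  by apply: cvgM => //; apply: cvg_compc.
have mf_ N : measurable_fun setT (fun u => f_ N (untup u)).
  exact: measurable_continuous_untup.
have mfl : measurable_fun setT (fun u => fl (untup u)).
  by apply: (measurable_fun_cvg mf_) => u _; exact: f_cvg.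
have fl0 x : 0 <= fl x by rewrite mulr_ge0// expR_ge0.
have toint := lebRn_integral mE.
rewrite (toint fl)//.
have := @dominated_cvg _ _ R m setT measurableT (fun N u => (f_ N (untup u))%:E)
  (fun u => (fl (untup u))%:E) (EFin \o g).
move=> /(_ _ _ _ ig) dc.
have {}dc : (\int[m]_u (f_ N (untup u))%:E)%E @[N --> \oo] --> (\int[m]_u (fl (untup u))%:E)%E.
  apply: dc.
  - by move=> N; exact/measurable_EFinP.
  - by move=> u _; apply: cvg_EFin; [exact: nearW|exact: f_cvg].
  - by move=> u _.
  - by move=> N u _; rewrite /= ger0_norm// lee_fin.
rewrite -(cvg_lim _ dc)//.
rewrite (_ : (fun N => _) = cst (lebRn (fun x => (f x)%:E))); first by rewrite lim_cst.
by apply/funext => N; rewrite -toint.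
Qed.

End Liouville.

(** * Chain rule along a curve *)

Section DirectionalC1.
Variables (R : realType) (V : normedModType R) (f : V -> R).
Hypothesis f_der : forall x v, derivable f x v.
Hypothesis f_C1 : forall v, continuous ('D_v f).

Lemma is_derive_line x v (a : R) :
  is_derive a 1 (fun h : R => f (x + h *: v)) ('D_v f (x + a *: v)).
Proof.
apply: (@is_derive_reparam _ _ _ _ f _ (x + a *: v) v).
  by move=> h; rewrite [h *: 1]mulr1 scalerDl addrCA.
exact/derivableP.
Qed.

Lemma derive_dirZ x v (c : R) : 'D_(c *: v) f x = c * 'D_v f x.
Proof.
have H1 := is_derive_line x (c *: v) 0.
rewrite scale0r addr0 in H1.
have H2 : is_derive (0 : R) 1 (fun h : R => f (x + h *: (c *: v))) (c * 'D_v f x).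
  have := is_derive_line x v (c * 0).
  rewrite mulr0 scale0r addr0 => H2.
  have H3 : is_derive (0 : R) 1 (fun h : R => c * h) c.
    have := @is_deriveZ _ _ _ (fun h : R => h) c 0 1 1 (is_derive_id _ _).
    by rewrite [c *: 1]mulr1.
  have H4 : is_derive (c * 0 : R) 1 (fun h : R => f (x + h *: v)) ('D_v f x) by rewrite mulr0.
  have := is_derive1_comp H4 H3.
  rewrite mulrC.
  by rewrite (_ : _ \o _ = (fun h : R => f (x + h *: (c *: v)))) //; apply/funext => h /=;
    rewrite scalerA mulrC.
by rewrite -(@derive_val _ _ _ _ _ _ _ H1) (@derive_val _ _ _ _ _ _ _ H2).
Qed.

Lemma line_mvt x v : exists2 c : R, 0 <= c <= 1 & f (x + v) - f x = 'D_v f (x + c *: v).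
Proof.
have cl : continuous (fun h : R => f (x + h *: v)).
  by move=> a; apply: is_derive_continuous; exact: is_derive_line.
have [c] := MVT_segment (@ler01 R) (fun a _ => is_derive_line x v a) (continuous_withinT cl).
rewrite in_itv/= => c01; rewrite scale1r scale0r addr0 subr0 mulr1 => E.
by exists c.
Qed.

(** The increment along [u + w] is split at [x + h *: u]. By the mean value theorem the second leg
    equals [h] times the derivative along [w] at an intermediate point, and continuity of that
    derivative in the point gives the limit. *)
Lemma derive_dirD x u w : 'D_(u + w) f x = 'D_u f x + 'D_w f x.
Proof.
have /choice[c cP] : forall h : R, exists c : R, 0 <= c <= 1 /\
    f (x + h *: u + h *: w) - f (x + h *: u) = 'D_(h *: w) f (x + h *: u + c *: (h *: w)).
  by move=> h; have [c c01 cE] := line_mvt (x + h *: u) (h *: w); exists c.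
have H1 : (fun h : R => h^-1 *: (f (h *: (u + w) + x) - f x)) @ 0^' --> 'D_(u + w) f x.
  exact: f_der.
have H2 : (fun h : R => h^-1 *: (f (h *: u + x) - f x)) @ 0^' --> 'D_u f x.
  exact: f_der.
have H3 : 'D_w f (x + h *: u + c h *: (h *: w)) @[h --> 0^'] --> 'D_w f x.
  apply: (cvg_compc (@f_C1 w)).
  have h0 : (h : R) @[h --> 0^'] --> (0 : R) by apply: cvg_within_filter; exact: cvg_id.
  rewrite -[X in _ --> X]addr0; apply: cvgD.
    rewrite -[X in _ --> X]addr0; apply: cvgD; first exact: cvg_cst.
    by rewrite -[X in _ --> X](scale0r u); exact: cvgZr_tmp.
  apply/cvgr0Pnorm_le => e e0.
  have hw : h *: w @[h --> 0^'] --> (0 : V) by rewrite -(scale0r w); exact: cvgZr_tmp.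
  move/cvgr0Pnorm_le : hw => /(_ e e0); apply: filterS => h hwe.
  rewrite normrZ; have [/andP[c0 c1] _] := cP h.
  by rewrite ger0_norm// (le_trans _ hwe)// ler_piMl.
have H4 := cvgD H2 H3.
suff H5 : (fun h : R => h^-1 *: (f (h *: (u + w) + x) - f x)) @ 0^' --> 'D_u f x + 'D_w f x.
  exact: (cvg_unique (@norm_hausdorff _ _) H1 H5).
apply: (@cvg_trans _ ((fun h : R => h^-1 *: (f (h *: u + x) - f x) +
   'D_w f (x + h *: u + c h *: (h *: w))) @ (0 : R)^')); last exact: H4.
apply: near_eq_cvg.
have : \forall h \near (0 : R)^', h != 0 by exact: nbhs_dnbhs_neq.
apply: filterS => h h0 /=.
have [_ cE] := cP h; move: cE; rewrite derive_dirZ => cE.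
rewrite (_ : f (h *: (u + w) + x) - f x = (f (x + h *: u + h *: w) - f (x + h *: u))
   + (f (h *: u + x) - f x)); last first.
  rewrite [h *: u + x]addrC [_ *: (u + w) + x]addrC scalerDr addrA; ring.
rewrite cE [RHS]scalerDr [RHS]addrC; congr (_ + _).
by rewrite -[RHS]/(h^-1 * (h * _)) mulrA mulVf// mul1r.
Qed.

Lemma derive_dir_sum (I : Type) (r : seq I) (P : pred I) (w : I -> V) x :
  'D_(\sum_(i <- r | P i) w i) f x = \sum_(i <- r | P i) 'D_(w i) f x.
Proof.
elim/big_rec2 : _ => [|i y1 y2 _ <-]; first exact: derive0.
exact: derive_dirD.
Qed.

End DirectionalC1.

Section CurveDerivative.
Variables (R : realType) (n : nat) (f : 'rV[R]_n * R -> R).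
Hypothesis f_der : forall x v, derivable f x v.
Hypothesis f_C1 : forall v, continuous ('D_v f).

Lemma derive_pair_decomp (z : 'rV[R]_n * R) (k : 'rV[R]_n) (h : R) :
  'D_(k, h) f z = \sum_j k 0 j * 'D_(basis_vec R j, 0) f z + h * 'D_(0, 1) f z.
Proof.
rewrite (_ : (k, h) = \sum_j k 0 j *: (basis_vec R j, 0 : R) + h *: ((0 : 'rV[R]_n), 1 : R)).
  rewrite derive_dirD// derive_dir_sum// derive_dirZ//; congr (_ + _).
  by apply: eq_bigr => j _; rewrite derive_dirZ.
have -> : \sum_j k 0 j *: (basis_vec R j, 0 : R) = (k, 0).
  have -> : (k, 0 : R) = (\sum_j k 0 j *: basis_vec R j, 0).
    by congr pair; rewrite [LHS]row_sum_delta.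
  elim/big_rec2 : _ => [//|j y1 y2 _ ->].
  by congr pair; rewrite /= ?scaler0 ?addr0.
by congr pair; rewrite /= ?scaler0 ?addr0 ?add0r// [_ *: 1]mulr1.
Qed.

(** The mean value theorem on the chord between two points of the graph of [Y] gives a derivative at
    a point tending to [(Y s, s)]; its direction is expanded in the basis, and the coefficients are
    the difference quotients of [Y]. *)
Lemma is_derive_curve (Y : R -> 'rV[R]_n) (s : R) (dY : 'rV[R]_n) :
  is_derive s 1 Y dY ->
  is_derive s 1 (fun r => f (Y r, r))
    (\sum_j dY 0 j * 'D_(basis_vec R j, 0) f (Y s, s) + 'D_(0, 1) f (Y s, s)).
Proof.
move=> dYs; have [dYc dYE] := dYs.
have Ycvg : (fun h : R => h^-1 *: (Y (h *: 1 + s) - Y s)) @ 0^' --> dY by rewrite -dYE.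
have Ycont : Y (h *: 1 + s) @[h --> (0 : R)^'] --> Y s.
  have cY : {for s, continuous Y} by apply/differentiable_continuous/derivable1_diffP.
  have hs : (h *: 1 + s : R) @[h --> (0 : R)^'] --> s.
    rewrite -[X in _ --> X]add0r; apply: cvgD; last exact: cvg_cst.
    by under eq_fun do rewrite [_ *: 1]mulr1; apply: cvg_within_filter; exact: cvg_id.
  exact: (continuous_cvg _ cY hs).
have /choice[c cP] : forall h : R, exists c : R, 0 <= c <= 1 /\
    f (Y (h *: 1 + s), h *: 1 + s) - f (Y s, s) =
    'D_(Y (h *: 1 + s) - Y s, h) f ((Y s, s) + c *: (Y (h *: 1 + s) - Y s, h)).
  move=> h; have [c c01 cE] := line_mvt f_der (Y s, s) (Y (h *: 1 + s) - Y s, h).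
  exists c; split => //; rewrite -cE; congr (f _ - _).
  by congr pair => /=; [rewrite [RHS]addrC subrK|rewrite [h *: 1]mulr1 [RHS]addrC].
pose pt h := (Y s, s) + c h *: (Y (h *: 1 + s) - Y s, h).
have ptc : pt h @[h --> (0 : R)^'] --> (Y s, s).
  rewrite -[X in _ --> X]addr0; apply: cvgD; first exact: cvg_cst.
  apply/cvgr0Pnorm_le => e e0.
  have k0 : (Y (h *: 1 + s) - Y s, h) @[h --> (0 : R)^'] --> (0 : 'rV[R]_n * R).
    apply: cvg_pairT; last by apply: cvg_within_filter; exact: cvg_id.
    by rewrite -(subrr (Y s)); apply: cvgB => //; exact: cvg_cst.
  move/cvgr0Pnorm_le : k0 => /(_ e e0); apply: filterS => h hwe.
  rewrite normrZ; have [/andP[c0 c1] _] := cP h.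
  by rewrite ger0_norm// (le_trans _ hwe)// ler_piMl.
have lim : (fun h : R => \sum_j (h^-1 *: (Y (h *: 1 + s) - Y s)) 0 j * 'D_(basis_vec R j,
    0) f (pt h)
     + 'D_(0, 1) f (pt h)) @ 0^' -->
   \sum_j dY 0 j * 'D_(basis_vec R j, 0) f (Y s, s) + 'D_(0, 1) f (Y s, s).
  apply: cvgD; last exact: (cvg_compc (@f_C1 _)).
  apply: cvg_sumT => j; apply: cvgM; last exact: (cvg_compc (@f_C1 _)).
  exact: cvg_coord.
have {}lim : (fun h : R => h^-1 *: (((fun r => f (Y r, r)) \o shift s)
    (h *: 1) - f (Y s, s))) @ 0^' -->
   \sum_j dY 0 j * 'D_(basis_vec R j, 0) f (Y s, s) + 'D_(0, 1) f (Y s, s).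
  apply: (@cvg_trans _ ((fun h : R => \sum_j (h^-1 *: (Y (h *: 1 + s) - Y s)) 0 j *
     'D_(basis_vec R j, 0) f (pt h) + 'D_(0, 1) f (pt h)) @ (0 : R)^')); last exact: lim.
  apply: near_eq_cvg.
  have : \forall h \near (0 : R)^', h != 0 by exact: nbhs_dnbhs_neq.
  apply: filterS => h h0 /=; have [_ ->] := cP h; rewrite -/(pt h) [X in _ =
      _ *: X]derive_pair_decomp.
  rewrite -[RHS]/(h^-1 * _) [RHS]mulrDr [X in _ = _ + X]mulrA mulVf// mul1r mulr_sumr;
      congr (_ + _).
  by apply: eq_bigr => j _; rewrite !mxE mulrA.
by split; [apply/cvg_ex; eexists; exact: lim|apply/cvg_lim].
Qed.

End CurveDerivative.

(** * The weighted flow *)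

Section Primitive.
Variable R : realType.
Local Notation mu := (@lebesgue_measure R).

Lemma integrable_continuous_segment (g : R -> R) (a b : R) : continuous g ->
  mu.-integrable `[a, b] (EFin \o g).
Proof.
move=> cg; apply: continuous_compact_integrable; first exact: segment_compact.
exact: continuous_withinT.
Qed.

Definition primitive (g : R -> R) (s : R) : R := Rintegral mu `[0, s] g.

Lemma primitive0 g : primitive g 0 = 0.
Proof. by rewrite /primitive set_itv1 Rintegral_set1. Qed.

Lemma primitive_cont g : continuous g -> {within `[0, 1], continuous (primitive g)}.
Proof.
move=> cg; apply: (@parameterized_integral_continuous _ 0 1 g) => //.
exact: integrable_continuous_segment.
Qed.

Lemma primitive_der g (s : R) : continuous g -> 0 < s < 1 -> is_derive s 1 (primitive g) (g s).
Proof.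
move=> cg /andP[s0 s1].
have [d dE] := continuous_FTC1_closed s1 (@integrable_continuous_segment g 0 1 cg) s0 (cg s).
by apply: (DeriveDef d); rewrite -derive1E.
Qed.

Lemma zero_derive_const (f : R -> R) : {within `[0, 1], continuous f} ->
  (forall s : R, 0 < s < 1 -> is_derive s 1 f 0) -> forall s, 0 <= s <= 1 -> f s = f 0.
Proof.
move=> cf df s /andP[s0 s1].
have [r rs|c|c _ +] := @MVT_segment R f (cst 0) 0 s s0.
- move: rs; rewrite in_itv/= => /andP[r0 rs]; apply: df.
  by rewrite r0 (lt_le_trans rs).
- by move: c; apply: continuous_subspaceW cf => r /=; rewrite !in_itv/= => /andP[-> rs];
    rewrite (le_trans rs).
- by rewrite mul0r => /eqP; rewrite subr_eq0 => /eqP.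
Qed.

End Primitive.

(** * Reweighting the flow to the target density *)

Section Weighted.
Variables (R : realType) (n : nat).
Local Notation D := n.+1.
Local Notation mu := (@lebesgue_measure R).
Variables (v : 'rV[R]_D -> R -> 'rV[R]_D) (b : 'I_D -> 'rV[R]_D -> R -> R) (L : R).
Hypothesis v_cont : forall j, continuous (fun z : 'rV[R]_D * R => v z.1 z.2 0 j).
Hypothesis b_cont : forall j, continuous (fun z : 'rV[R]_D * R => b j z.1 z.2).
Hypothesis v_der : forall j s x, is_derive x (basis_vec R j) (fun y => v y s 0 j) (b j x s).
Hypothesis L_ge1 : 1 <= L.
Hypothesis v_lip : forall x y s, 0 <= s <= 1 -> `|v x s - v y s| <= L * `|x - y|.
Variable V0 : R.
Hypothesis v0 : forall s, 0 <= s <= 1 -> `|v 0 s| <= V0.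
Variable phi : 'rV[R]_D -> R -> 'rV[R]_D.
Hypothesis phi0 : forall x, phi x 0 = x.
Hypothesis phi_cont : forall x, continuous (phi x).
Hypothesis phi_der : forall x (s : R), 0 < s < 1 -> is_derive s 1 (phi x) (v (phi x s) s).
Hypothesis phi_clamp : forall x s, phi x (clamp 1 s) = phi x s.
Variables rho al : 'rV[R]_D -> R -> R.
Hypothesis rho_cont : continuous (fun z : 'rV[R]_D * R => rho z.1 z.2).
Hypothesis rho_gt0 : forall x s, 0 <= s <= 1 -> 0 < rho x s.
Hypothesis al_cont : continuous (fun z : 'rV[R]_D * R => al z.1 (clamp 1 z.2)).
Hypothesis rho_der : forall x (s : R), 0 < s < 1 ->
  is_derive s 1 (fun r => ln (rho (phi x r) r)) (al (phi x s) s).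

(* [b] is the diagonal of the Jacobian of [v], and [al] the derivative of [ln rho] along the
   flow; [weight] is the unnormalized weight without the term that depends on time only. *)
Definition rate (z : 'rV[R]_D * R) : R := \sum_j b j z.1 (clamp 1 z.2) + al z.1 (clamp 1 z.2).
Definition weight (x : 'rV[R]_D) (s : R) : R := expR (primitive (fun r => rate (phi x r, r)) s).

Lemma b_clamp_cont j : continuous (fun z : 'rV[R]_D * R => b j z.1 (clamp 1 z.2)).
Proof.
apply: (@continuous_compT _ _ _ (fun z : 'rV[R]_D * R => b j z.1 z.2) (fun z =>
    (z.1, clamp 1 z.2))).
  exact: b_cont.
apply: continuous_pairT; first by move=> z; exact: cvg_fst.
apply: (@continuous_compT _ _ _ (clamp 1) snd); first exact: clamp_continuous.
by move=> z; exact: cvg_snd.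
Qed.

Lemma rate_cont : continuous rate.
Proof.
apply: continuous_addT => //; apply: continuous_sumT => j; exact: b_clamp_cont.
Qed.

Lemma phi_pair_cont x : continuous (fun r => (phi x r, r)).
Proof. by apply: continuous_pairT => //; exact: continuous_idT. Qed.

Lemma measurable_scheme d (T : measurableType d) (h : T -> R) (X : T -> 'rV[R]_D) i j :
  measurable_fun setT h -> (forall j, measurable_fun setT (fun p => X p 0 j)) ->
  measurable_fun setT (fun p => scheme v (h p) (X p) i 0 j).
Proof.
move=> mh mX; elim: i j => [|i IHi] j //=.
under eq_fun do rewrite !mxE.
apply: measurable_funD => //; apply: measurable_funM => //; apply: measurable_funM => //.
apply: (@measurable_continuous_rV _ _ _ _ (fun z : 'rV[R]_D * R => v z.1 z.2 0 (scheme_dir n i))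
  (fun p => scheme v (h p) (X p) i) (fun p => scheme_time n (h p) i)) => //.
by apply: measurable_funM.
Qed.

(** The flow is a pointwise limit of schemes, measurable jointly in the step size and the starting
    point; time enters through the step size [clamp 1 (s p) / N]. *)
Lemma measurable_phi d (T : measurableType d) (s : T -> R) (X : T -> 'rV[R]_D) j :
  measurable_fun setT s -> (forall j, measurable_fun setT (fun p => X p 0 j)) ->
  measurable_fun setT (fun p => phi (X p) (s p) 0 j).
Proof.
move=> ms mX.
have mc : measurable_fun setT (fun p => clamp 1 (s p)).
  by apply: (measurableT_comp _ ms); apply: continuous_measurable_fun; exact: clamp_continuous.
apply: (@measurable_fun_cvg _ _ _ _ (fun N p => scheme v (clamp 1 (s p) / N%:R) (X p) (N * D) 0 j)).
  move=> N; apply: measurable_scheme => //; exact: measurable_funM.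
move=> p _; apply: cvg_coord; rewrite -phi_clamp.
exact: (phi_scheme_cvg v_cont L_ge1 v_lip (clampP (s p) ler01) phi0 phi_cont phi_der).
Qed.

Lemma measurable_rate d (T : measurableType d) (s : T -> R) (X : T -> 'rV[R]_D) :
  measurable_fun setT s -> (forall j, measurable_fun setT (fun p => X p 0 j)) ->
  measurable_fun setT (fun p => rate (phi (X p) (s p), s p)).
Proof.
move=> ms mX; apply: measurable_continuous_rV => //; first exact: rate_cont.
by move=> j; exact: measurable_phi.
Qed.

(** The integral up to a variable time becomes an integral over the whole line once the indicator of
    [0 <= r <= s] is put in the integrand, and then it is an integral with a parameter. *)
Lemma measurable_weight d (T : measurableType d) (s : T -> R) (X : T -> 'rV[R]_D) :
  measurable_fun setT s -> (forall j, measurable_fun setT (fun p => X p 0 j)) ->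
  measurable_fun setT (fun p => weight (X p) (s p)).
Proof.
move=> ms mX; apply: (measurableT_comp (@measurable_expR R)).
apply: (measurableT_comp (@fine_measurable R setT measurableT)).
pose A : set (T * R) := [set z | (0 <= z.2) && (z.2 <= s z.1)].
have mA : measurable A.
  have m1 : measurable_fun setT (fun z : T * R => 0 <= z.2) by exact: measurable_fun_ler.
  have m2 : measurable_fun setT (fun z : T * R => z.2 <= s z.1).
    by apply: measurable_fun_ler => //; exact: measurableT_comp.
  have := measurable_and m1 m2 measurableT (Y := [set true]) I.
  by rewrite setTI; congr measurable; apply/seteqP; split.
pose gA (z : T * R) : \bar R := (rate (phi (X z.1) z.2, z.2) * \1_A z)%:E.
rewrite (_ : (fun p => _) = (fun p => \int[mu]_r gA (p, r))%E).
  apply: (@measurable_fun_integral_param R _ _ T (measurableTypeR R) mu gA).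
  apply/measurable_EFinP/measurable_funM; last exact: measurable_indic.
  apply: measurable_rate => // j.
  exact: (measurableT_comp (mX j)).
apply/funext => p; rewrite integral_mkcond; apply: eq_integral => r _.
rewrite /gA /patch indicE; have [|] := boolP (r \in _).
  rewrite inE/= in_itv/= => rs; rewrite (_ : _ \in A) ?mulr1// inE; exact: rs.
by rewrite !notin_setE/= in_itv/= => rs; rewrite (_ : (_ \in A) = false) ?mulr0//;
  apply/negbTE; rewrite notin_setE.
Qed.

(** Along a trajectory [ln rho] and the primitive of [al] have the same derivative, so their
    difference keeps its initial value. *)
Lemma rho_phi x s : 0 <= s <= 1 ->
  rho (phi x s) s = rho x 0 * expR (primitive (fun r => al (phi x r) (clamp 1 r)) s).
Proof.
move=> s01.
have ca : continuous (fun r => al (phi x r) (clamp 1 r)).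
  exact: (@continuous_compT _ _ _ (fun z : 'rV[R]_D * R => al z.1 (clamp 1 z.2)) _ al_cont
      (@phi_pair_cont x)).
pose u s := ln (rho (phi x s) s) - primitive (fun r => al (phi x r) (clamp 1 r)) s.
have cu : {within `[0, 1], continuous u}.
  move=> r; apply: cvgB; last exact: primitive_cont.
  move: r; apply: (@subspace_eq_continuous _ _ _ (fun r => ln (rho (phi x r) (clamp 1 r)))).
    by move=> r; rewrite inE/= in_itv/= => r01; rewrite clampK.
  apply: continuous_withinT => r.
  apply: (@continuous_comp _ _ _ (fun r => rho (phi x r) (clamp 1 r)) (@ln R)).
    apply: (@continuous_compT _ _ _ (fun z : 'rV[R]_D * R => rho z.1 z.2) (fun r =>
        (phi x r, clamp 1 r))) => //.
    by apply: continuous_pairT => //; exact: clamp_continuous.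
  by apply: continuous_ln; apply: rho_gt0; exact: (clampP _ ler01).
have du (r : R) : 0 < r < 1 -> is_derive r 1 u 0.
  move=> r01; have r01' : 0 <= r <= 1 by case/andP: r01 => /ltW -> /ltW ->.
  have h1 := rho_der x r01; have h2 := primitive_der ca r01.
  by have := is_deriveB h1 h2; rewrite clampK// subrr.
have := zero_derive_const cu du s01.
rewrite /u primitive0 subr0 phi0 => /eqP; rewrite subr_eq => /eqP E.
have := congr1 expR E; rewrite expRD !lnK ?posrE ?rho_gt0//.
by rewrite lexx ler01.
Qed.

(** The first factor is the Jacobian of Liouville's formula, the second the growth of [rho] along
    the trajectory. *)
Lemma weightE x s : 0 <= s <= 1 ->
  weight x s = expR (\sum_j primitive (fun r => b j (phi x r) (clamp 1 r)) s) *
    expR (primitive (fun r => al (phi x r) (clamp 1 r)) s).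
Proof.
move=> s01; rewrite /weight -expRD; congr expR; apply/eqP; rewrite -subr_eq0; apply/eqP.
have ca : continuous (fun r => al (phi x r) (clamp 1 r)).
  exact: (@continuous_compT _ _ _ (fun z : 'rV[R]_D * R => al z.1 (clamp 1 z.2)) _ al_cont
      (@phi_pair_cont x)).
have cb j : continuous (fun r => b j (phi x r) (clamp 1 r)).
  exact: (@continuous_compT _ _ _ (fun z : 'rV[R]_D * R => b j z.1 (clamp 1 z.2)) _
      (@b_clamp_cont j) (@phi_pair_cont x)).
have cr : continuous (fun r => rate (phi x r, r)).
  exact: (@continuous_compT _ _ _ rate _ rate_cont (@phi_pair_cont x)).
pose u s := primitive (fun r => rate (phi x r, r)) s -
  (\sum_j primitive (fun r => b j (phi x r) (clamp 1 r)) s +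
   primitive (fun r => al (phi x r) (clamp 1 r)) s).
have cu : {within `[0, 1], continuous u}.
  move=> r; apply: cvgB; first exact: primitive_cont.
  apply: cvgD; last exact: primitive_cont.
  by apply: cvg_sumT => j; exact: primitive_cont.
have du (r : R) : 0 < r < 1 -> is_derive r 1 u 0.
  move=> r01.
  have h1 := primitive_der cr r01; have h2 := primitive_der ca r01.
  have h3 := @is_derive_sum _ _ _ D (fun j => primitive (fun r => b j (phi x r) (clamp 1 r))) r 1 _
     (fun j => primitive_der (cb j) r01).
  have h4 := is_deriveB h1 (is_deriveD h3 h2).
  rewrite /rate /= subrr in h4.
  rewrite (_ : u = primitive (fun r => rate (phi x r, r)) - (\sum_j primitive (fun r =>
      b j (phi x r) (clamp 1 r)) + primitive (fun r => al (phi x r) (clamp 1 r)))).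
    exact: h4.
  by apply/funext => y; rewrite /u !fctE fct_sumE.
have := zero_derive_const cu du s01; rewrite {2}/u !primitive0 addr0 big1 ?subrr//.
by move=> j _; rewrite primitive0.
Qed.

(** By [rho_phi] and [weightE], [rho x 0 * weight x t] is [rho (phi x t) t] times the Jacobian: this
    is Liouville's formula for the test function [rho(., t) * f]. Bounded support is obtained by
    cutoffs, removed by monotone convergence. *)
Lemma weighted_identity (f : 'rV[R]_D -> R) t : 0 <= t <= 1 -> continuous f ->
    (forall x, 0 <= f x) ->
  lebRn (fun x => (rho x 0 * weight x t * f (phi x t))%:E) = lebRn (fun x => (rho x t * f x)%:E).
Proof.
move=> t01 cf f0.
have [m mE] := lebRn_measure R D.
have toint := lebRn_integral mE.
(* A continuous cutoff, equal to 1 where [|y| <= k], to 0 where [|y| >= k + 1], and nondecreasing in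
   [k]. *)
pose chi (k : nat) (y : 'rV[R]_D) : R := Num.max 0 (Num.min 1 (k.+1%:R - `|y|)).
have chi0 k y : 0 <= chi k y by rewrite /chi le_max lexx.
have chi_cont k : continuous (chi k).
  apply: continuous_maxT; first exact: continuous_cstT.
  apply: continuous_minT; first exact: continuous_cstT.
  by apply: continuous_subT; [exact: continuous_cstT|exact: norm_continuous].
have chi_nd y k l : (k <= l)%N -> chi k y <= chi l y.
  move=> kl; rewrite /chi ge_max; apply/andP; split; first by rewrite le_max lexx.
  rewrite le_max; apply/orP; right; rewrite le_min; apply/andP; split; first by rewrite ge_min lexx.
  by rewrite ge_min lerD2r ler_nat ltnS kl orbT.
have chi1 y : \forall k \near \oo, chi k y = 1.
  exists (Num.truncn `|y|).+1 => // k /= hk.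
  rewrite /chi min_l ?max_r// lerBrDr addrC -lerBrDr -natr1 addrK.
  by rewrite (@le_trans _ _ (Num.truncn `|y|).+1%:R)// ?ler_nat// ltW// truncnS_gt.
have rt_cont : continuous (fun x => rho x t).
  apply: (@continuous_compT _ _ _ (fun z : 'rV[R]_D * R => rho z.1 z.2) (fun x => (x, t))) => //.
  by apply: continuous_pairT; [exact: continuous_idT|exact: continuous_cstT].
have r0_cont : continuous (fun x => rho x 0).
  apply: (@continuous_compT _ _ _ (fun z : 'rV[R]_D * R => rho z.1 z.2) (fun x => (x, 0))) => //.
  by apply: continuous_pairT; [exact: continuous_idT|exact: continuous_cstT].
have r00 x : 0 <= rho x 0 by apply/ltW/rho_gt0; rewrite lexx ler01.
have rt0 x : 0 <= rho x t by apply/ltW/rho_gt0.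
pose A k x := rho x 0 * weight x t * f (phi x t) * chi k (phi x t).
pose B k x := rho x t * f x * chi k x.
have AB k : lebRn (fun x => (A k x)%:E) = lebRn (fun x => (B k x)%:E).
  have cB : continuous (B k) by apply: continuous_mulT => //; exact: continuous_mulT.
  have B0 x : 0 <= B k x by rewrite !mulr_ge0.
  have Bk x : k.+1%:R < `|x| -> B k x = 0.
    move=> kx; rewrite /B (_ : chi k x = 0) ?mulr0// /chi max_l// ge_min.
    by rewrite subr_le0 (ltW kx) ?orbT.
  pose F x j := primitive (fun r => b j (phi x r) (clamp 1 r)).
  have cbx x j : continuous (fun r => b j (phi x r) (clamp 1 r)).
    exact: (@continuous_compT _ _ _ (fun z : 'rV[R]_D * R => b j z.1 (clamp 1 z.2)) _
        (@b_clamp_cont j) (@phi_pair_cont x)).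
  have F0 x j : F x j 0 = 0 by exact: primitive0.
  have Fc x j : {within `[0, 1], continuous (F x j)} by exact: primitive_cont.
  have Fd x j (s : R) : 0 < s < 1 -> is_derive s 1 (F x j) (b j (phi x s) s).
    move=> s01; have := primitive_der (cbx x j) s01; rewrite clampK//.
    by case/andP: s01 => /ltW -> /ltW ->.
  rewrite -(liouville v_cont b_cont v_der L_ge1 v_lip v0 t01 phi0 phi_cont phi_der F0 Fc Fd cB
      B0 Bk).
  apply: eq_lebRn => x; congr EFin; rewrite /A /B rho_phi// weightE//.
  by rewrite /F; ring.
have mphi j : measurable_fun setT (fun u : D.-tuple R => phi (untup u) t 0 j).
  by apply: measurable_phi => //; exact: measurable_untup.
have mw : measurable_fun setT (fun u : D.-tuple R => weight (untup u) t).
  by apply: measurable_weight => //; exact: measurable_untup.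
have mAl : measurable_fun setT (fun u => rho (untup u) 0 * weight (untup u) t * f (phi (untup u)
    t)).
  apply: measurable_funM; last exact: measurable_continuous_rV1.
  apply: measurable_funM => //; exact: (measurable_continuous_untup r0_cont).
have mA k : measurable_fun setT (fun u => A k (untup u)).
  by apply: measurable_funM => //; exact: measurable_continuous_rV1.
have mBl : measurable_fun setT (fun u => rho (untup u) t * f (untup u)).
  apply: measurable_funM; [exact: (measurable_continuous_untup rt_cont)|exact:
      measurable_continuous_untup].
have mB k : measurable_fun setT (fun u => B k (untup u)).
  by apply: measurable_funM => //; exact: measurable_continuous_untup.
have w0 x : 0 <= weight x t by exact: expR_ge0.
(* The cutoff is evaluated at [c x]: at [phi x t] on the side of the flow and at [x] on the side of
   the target, as Liouville's formula matches them. *)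
have lim (k : 'rV[R]_D -> R) (c : 'rV[R]_D -> 'rV[R]_D) : (forall x, 0 <= k x) ->
    measurable_fun setT (fun u => k (untup u)) ->
    (forall i, measurable_fun setT (fun u => k (untup u) * chi i (c (untup u)))) ->
    lebRn (fun x => (k x * chi i (c x))%:E) @[i --> \oo] --> lebRn (fun x => (k x)%:E).
  move=> k0 mk mki; rewrite toint//.
  rewrite (_ : (fun i => _) = (fun i => \int[m]_u (k (untup u) * chi i (c (untup u)))%:E)%E);
      last first.
    apply/funext => i; rewrite (toint (fun x => k x * chi i (c x)))// => x.
    by rewrite mulr_ge0.
  rewrite (_ : (\int[m]_u (k (untup u))%:E)%E =
      (\int[m]_u limn (fun i => (k (untup u) * chi i (c (untup u)))%:E))%E); last first.
    apply: eq_integral => u _; apply/esym/cvg_lim => //.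
    apply: cvg_EFin; first exact: nearW.
    apply: (@cvg_trans _ (cst (k (untup u)) @ \oo)); last exact: cvg_cst.
    apply: near_eq_cvg; have := chi1 (c (untup u)); apply: filterS => i /= ->.
    by rewrite mulr1.
  apply: cvg_monotone_convergence => //.
  - by move=> i; exact/measurable_EFinP.
  - by move=> i u _; rewrite lee_fin mulr_ge0.
  - by move=> u _ i j ij; rewrite lee_fin ler_wpM2l// chi_nd.
have limA := lim _ (phi ^~ t) (fun x => mulr_ge0 (mulr_ge0 (r00 x) (w0 x)) (f0 (phi x t))) mAl mA.
have limB := lim _ id (fun x => mulr_ge0 (rt0 x) (f0 x)) mBl mB.
apply: (cvg_unique (@ereal_hausdorff R) limA).
by apply: cvg_trans limB; apply: near_eq_cvg; apply: nearW => i; exact/esym/AB.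
Qed.

End Weighted.

(** * The law of large numbers *)

Section LargeNumbers.
Context {d : measure_display} {Om : measurableType d} {R : realType} (P : probability Om R).
Variables (Z : nat -> Om -> R) (C : R).
Hypothesis mZ : forall i, measurable_fun setT (Z i).
Hypothesis Z_le : forall i w, `|Z i w| <= C.
Hypothesis Z_orth : forall i j, (i < j)%N -> Rintegral P setT (fun w => Z i w * Z j w) = 0.

Let C_ge0 : 0 <= C.
Proof.
have [w _] : [set: Om] !=set0.
  apply/set0P/eqP => E; have := @probability_setT _ _ _ P; rewrite E measure0 => /eqP.
  by rewrite eq_sym onee_eq0.
exact: le_trans (normr_ge0 _) (Z_le 0%N w).
Qed.

Lemma bounded_integrable (f : Om -> R) (K : R) : measurable_fun setT f ->
  (forall w, `|f w| <= K) -> P.-integrable setT (EFin \o f).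
Proof.
move=> mf fK; apply: measurable_bounded_integrable => //.
  by rewrite (le_lt_trans (probability_le1 P measurableT))// ltry.
by exists K; split; [exact: num_real|move=> x Kx w _ /=; rewrite (le_trans (fK w))// ltW].
Qed.

Let S N w := \sum_(i < N) Z i w.

Let mS N : measurable_fun setT (S N).
Proof. by apply: measurable_sum => i. Qed.

Let S_le N w : `|S N w| <= N%:R * C.
Proof.
rewrite (le_trans (ler_norm_sum _ _ _))//.
rewrite (le_trans (ler_sum _ (fun (i : 'I_N) _ => Z_le i w)))//.
by rewrite sumr_const card_ord mulr_natl.
Qed.

Let integrable_SZ N k : P.-integrable setT (EFin \o (fun w => S N w * Z k w)).
Proof.
apply: (@bounded_integrable _ (N%:R * C * C)); first exact: measurable_funM.
by move=> w; rewrite normrM ler_pM.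
Qed.

Let integrable_ZZ i k : P.-integrable setT (EFin \o (fun w => Z i w * Z k w)).
Proof.
apply: (@bounded_integrable _ (C * C)); first exact: measurable_funM.
by move=> w; rewrite normrM ler_pM.
Qed.

Let integrable_SS N : P.-integrable setT (EFin \o (fun w => S N w * S N w)).
Proof.
apply: (@bounded_integrable _ (N%:R * C * (N%:R * C))); first exact: measurable_funM.
by move=> w; rewrite normrM ler_pM.
Qed.

Let S_orth N k : (N <= k)%N -> Rintegral P setT (fun w => S N w * Z k w) = 0.
Proof.
elim: N => [_|N IHN Nk].
  rewrite (_ : (fun w => _) = cst 0); last by apply/funext => w; rewrite /S big_ord0 mul0r.
  by rewrite Rintegral_cst// mul0r.
rewrite (_ : (fun w => _) = (fun w => S N w * Z k w + Z N w * Z k w)); last first.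
  by apply/funext => w; rewrite /S big_ord_recr/= mulrDl.
by rewrite RintegralD// IHN 1?ltnW// Z_orth// addr0.
Qed.

(** Orthogonality removes the cross terms, so the second moment grows linearly in [N]. *)
Let S_var N : Rintegral P setT (fun w => S N w * S N w) <= N%:R * C ^+ 2.
Proof.
elim: N => [|N IHN].
  rewrite (_ : (fun w => _) = cst 0); last by apply/funext => w; rewrite /S big_ord0 mul0r.
  by rewrite Rintegral_cst// !mul0r.
rewrite (_ : (fun w => _) = (fun w => S N w * S N w + (S N w * Z N w + (S N w * Z N w + Z N w *
    Z N w)))).
  have i1 := integrable_SS N; have i2 := integrable_SZ N N; have i3 := integrable_ZZ N N.
  have i4 : P.-integrable setT (EFin \o (fun w => S N w * Z N w + Z N w * Z N w)).
    exact: (integrableD measurableT i2 i3).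
  have i5 : P.-integrable setT (EFin \o (fun w => S N w * Z N w + (S N w * Z N w + Z N w * Z N w))).
    exact: (integrableD measurableT i2 i4).
  rewrite RintegralD// RintegralD// RintegralD// S_orth// !add0r -natr1 mulrDl mul1r lerD//.
  have -> : C ^+ 2 = Rintegral P setT (cst (C ^+ 2)).
    transitivity (C ^+ 2 * fine (P setT)); last by rewrite Rintegral_cst.
    by rewrite (_ : P setT = 1%E) ?mulr1//; exact: probability_setT.
  apply: le_Rintegral => //.
    by apply: (@bounded_integrable _ `|C ^+ 2|).
  by move=> w _ /=; rewrite -expr2 -real_normK ?num_real// ler_sqr ?nnegrE.
by apply/funext => w; rewrite /S big_ord_recr/=; ring.
Qed.

(** The induction carries the sharper bound [2 - 1 / (n + 1)] for [n + 1] terms, a telescoping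
    comparison. *)
Lemma sum_inv_sq n : \sum_(k < n) (k.+1%:R ^+ 2)^-1 <= 2 :> R.
Proof.
case: n => [|n]; first by rewrite big_ord0.
suff : \sum_(k < n.+1) (k.+1%:R ^+ 2)^-1 <= 2 - n.+1%:R^-1 :> R.
  by move=> /le_trans; apply; rewrite lerBlDr lerDl invr_ge0.
elim: n => [|n IHn]; first by rewrite big_ord1 expr1n invr1; lra.
rewrite big_ord_recr/= (le_trans (lerD IHn (lexx _)))//.
rewrite -[n.+2%:R]natr1; set a : R := n.+1%:R.
have a0 : 0 < a by rewrite ltr0n.
rewrite -subr_ge0.
have -> : 2 - (a + 1)^-1 - (2 - a^-1 + ((a + 1) ^+ 2)^-1) = (a * (a + 1) ^+ 2)^-1.
  by field; rewrite !gt_eqF// ltr_pwDl.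
by rewrite invr_ge0 mulr_ge0 ?sqr_ge0// ltW.
Qed.

Let T k w := (S (k.+1 ^ 2) w / (k.+1 ^ 2)%:R) ^+ 2.

Let T_ge0 k w : 0 <= T k w. Proof. exact: sqr_ge0. Qed.

Let mT k : measurable_fun setT (T k).
Proof. by apply: measurable_funX; exact: measurable_funM. Qed.

Let T_int k : (\int[P]_w (T k w)%:E <= (C ^+ 2 * (k.+1%:R ^+ 2)^-1)%:E)%E.
Proof.
set N := (k.+1 ^ 2)%N.
have iT : P.-integrable setT (EFin \o T k).
  apply: (@bounded_integrable _ ((N%:R * C / N%:R) ^+ 2)) => //.
  move=> w; rewrite /T normrX ler_sqr ?nnegrE ?mulr_ge0 ?invr_ge0//.
  by rewrite normrM normfV [`|N%:R|]ger0_norm// ler_wpM2r// invr_ge0.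
rewrite -[leLHS]fineK; last exact: (integrable_fin_num measurableT iT).
rewrite lee_fin -/(Rintegral P setT (T k)).
rewrite (_ : T k = (fun w => (N%:R ^+ 2)^-1 * (S N w * S N w))); last first.
  by apply/funext => w; rewrite /T -/N expr_div_n mulrC expr2.
rewrite RintegralZl// (@le_trans _ _ ((N%:R ^+ 2)^-1 * (N%:R * C ^+ 2)))//.
  by rewrite ler_wpM2l ?invr_ge0 ?sqr_ge0.
have N0 : N%:R != 0 :> R by rewrite pnatr_eq0.
have <- : (N%:R : R) = k.+1%:R ^+ 2 by rewrite natrX.
rewrite le_eqVlt; apply/orP; left; apply/eqP; move: N0; move: (N%:R : R) => a a0.
by field.
Qed.

(** The expectations of the [T k] have a finite sum, so the series of the [T k] is integrable, hence
    almost surely finite, and its terms tend to 0. *)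
Let T_cvg : {ae P, forall w, T k w @[k --> \oo] --> 0}.
Proof.
pose F w := (\sum_(k <oo) (T k w)%:E)%E.
have mTE k : measurable_fun setT (fun w => (T k w)%:E) by exact/measurable_EFinP.
have F0 w : (0 <= F w)%E by apply: nneseries_ge0 => k _ _; rewrite lee_fin.
have iF : P.-integrable setT F.
  apply/integrableP; split.
    by apply: ge0_emeasurable_sum => // k w _ _; rewrite lee_fin.
  under eq_integral do rewrite gee0_abs//.
  rewrite integral_nneseries//; last by move=> k w _; rewrite lee_fin.
  apply: (@le_lt_trans _ _ (C ^+ 2 * 2)%:E); last exact: ltry.
  apply: lime_le; first by apply: is_cvg_nneseries => k _ _; apply: integral_ge0 => w _;
      rewrite lee_fin.
  apply: nearW => n; rewrite big_mkord.
  apply: (@le_trans _ _ (\sum_(k < n) (C ^+ 2 * (k.+1%:R ^+ 2)^-1)%:E)%E).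
    by apply: lee_sum => k _; exact: T_int.
  by rewrite sumEFin lee_fin -mulr_sumr ler_wpM2l ?sqr_ge0// sum_inv_sq.
have := integrable_ae measurableT iF; apply: filterS => w /(_ I) Fw.
apply: cvg_series_cvg_0; apply: nondecreasing_is_cvgn.
  by apply: nondecreasing_series => k _ _.
exists (fine (F w)) => _ [n _ <-]; rewrite -lee_fin fineK//.
rewrite /series/= -sumEFin; apply: nneseries_lim_ge => k _ _.
by rewrite lee_fin.
Qed.

Lemma square_between N : (0 < N)%N -> exists k, (k.+1 ^ 2 <= N < k.+2 ^ 2)%N.
Proof.
elim: N => // N IHN _; have [->|N0] := posnP N; first by exists 0%N.
have [k /andP[k1 k2]] := IHN N0.
have [h|h] := ltnP N.+1 (k.+2 ^ 2); first by exists k; rewrite (leq_trans k1)//= h.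
by exists k.+1; rewrite h/=; lia.
Qed.

(* Along the squares [N = (k + 1)^2] the variances are summable; between two squares the
   partial sums vary by at most [3 (k + 1) C]. *)
Lemma slln_orthogonal : {ae P, forall w, (\sum_(i < N) Z i w) / N%:R @[N --> \oo] --> 0}.
Proof.
have := T_cvg; apply: filterS => w Tw.
have tau : S (k.+1 ^ 2) w / (k.+1 ^ 2)%:R @[k --> \oo] --> 0.
  apply/cvgr0Pnorm_le => e e0.
  move/cvgr0Pnorm_le : Tw => /(_ (e ^+ 2)); rewrite exprn_gt0// => /(_ isT).
  apply: filterS => k; rewrite normrX ler_sqr ?nnegrE//; exact: ltW.
apply/cvgr0Pnorm_le => e e0.
move/cvgr0Pnorm_le : tau => /(_ (e / 2)); rewrite divr_gt0// => /(_ isT) [K1 _ K1P].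
(* For [k >= K2] the variation [3 * (k + 1) * C] between two squares is at most
   [e / 2 * (k + 1) ^ 2], hence at most [e / 2 * N]. *)
have [K2 K2P] : exists K2 : nat, 3 * C / (e / 2) <= K2%:R.
  by exists (Num.truncn (3 * C / (e / 2))).+1; rewrite ltW// truncnS_gt.
exists ((maxn K1 K2).+1 ^ 2)%N => // N /= NK.
have N0 : (0 < N)%N by apply: leq_trans NK; rewrite expn_gt0.
have [k /andP[k1 k2]] := square_between N0.
have kK : (maxn K1 K2 <= k)%N.
  have := leq_ltn_trans NK k2; rewrite ltn_exp2r//.
have kK1 : (K1 <= k)%N by exact: leq_trans (leq_maxl _ _) kK.
have kK2 : (K2 <= k)%N by exact: leq_trans (leq_maxr _ _) kK.
have Sdiff M r : `|S (M + r) w - S M w| <= r%:R * C.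
  rewrite /S big_split_ord/= addrAC subrr add0r.
  rewrite (le_trans (ler_norm_sum _ _ _))//.
  rewrite (le_trans (ler_sum _ (fun (i : 'I_r) _ => Z_le _ w)))//.
  by rewrite sumr_const card_ord mulr_natl.
have Nr0 : 0 < N%:R :> R by rewrite ltr0n.
rewrite -/(S N w) normrM normfV [`|N%:R|]ger0_norm// ler_pdivrMr//.
have := Sdiff (k.+1 ^ 2)%N (N - k.+1 ^ 2)%N; rewrite subnKC// => SN.
rewrite -(subrK (S (k.+1 ^ 2) w) (S N w)) (le_trans (ler_normD _ _))//.
have r3 : (N - k.+1 ^ 2 <= 3 * k.+1)%N by lia.
have := K1P k kK1; rewrite normrM normfV [`|_%:R|]ger0_norm// ler_pdivrMr ?ltr0n ?expn_gt0// => S1.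
have e2 : 0 < e / 2 by rewrite divr_gt0.
have h1 : `|S N w - S (k.+1 ^ 2) w| <= e / 2 * N%:R.
  rewrite (le_trans SN)//.
  rewrite (@le_trans _ _ ((3 * k.+1)%:R * C))//; first by rewrite ler_wpM2r// ler_nat.
  rewrite natrM mulrAC (@le_trans _ _ (e / 2 * K2%:R * k.+1%:R))//.
    by rewrite ler_wpM2r// [leRHS]mulrC -ler_pdivrMr//.
  rewrite -mulrA (ler_wpM2l (ltW e2)) // -natrM ler_nat (leq_trans _ k1)//.
  by rewrite expnS expn1 leq_mul// leqW.
have h2 : `|S (k.+1 ^ 2) w| <= e / 2 * N%:R.
  by rewrite (le_trans S1)// (ler_wpM2l (ltW e2))// ler_nat.
by rewrite (le_trans (lerD h1 h2))// -mulrDl -splitr.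
Qed.

End LargeNumbers.

(** * From laws and independence on events to a strong law for functions of the samples *)

Section Sampling.
Variable R : realType.
Local Notation mu := (@lebesgue_measure R).

Lemma measurable_superlevel d (T : measurableType d) (U : T -> R) a : measurable_fun setT U ->
  measurable [set u | 0 <= a < U u].
Proof.
move=> mU.
have m1 : measurable_fun setT (fun u : T => 0 <= a) by exact: measurable_cst.
have m2 : measurable_fun setT (fun u => a < U u) by exact: measurable_fun_ltr.
have := measurable_and m1 m2 measurableT (Y := [set true]) I.
by rewrite setTI; congr measurable; apply/seteqP; split.
Qed.

(** A nonnegative number is the length of the set of levels below it; Tonelli then exchanges levels
    and points. The law and the independence of the samples are given on events, and this form
    carries them over to expectations. *)
Lemma layer_cake d (T : measurableType d) (m : {sigma_finite_measure set T ->
    \bar R}) (U V : T -> R) :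
  measurable_fun setT U -> measurable_fun setT V -> (forall u, 0 <= U u) -> (forall u, 0 <= V u) ->
  (\int[m]_u (U u * V u)%:E = \int[mu]_a \int[m]_u (\1_[set u | (0 <= a < U u)%R] u * V u)%:E)%E.
Proof.
move=> mU mV U0 V0.
pose A : set (T * R) := [set z | 0 <= z.2 < U z.1].
have mA : measurable A.
  have m1 : measurable_fun setT (fun z : T * R => 0 <= z.2) by exact: measurable_fun_ler.
  have m2 : measurable_fun setT (fun z : T * R => z.2 < U z.1).
    by apply: measurable_fun_ltr => //; exact: measurableT_comp.
  have := measurable_and m1 m2 measurableT (Y := [set true]) I.
  by rewrite setTI; congr measurable; apply/seteqP; split.
pose g (z : T * R) : \bar R := (\1_A z * V z.1)%:E.
have mg : measurable_fun setT g.
  apply/measurable_EFinP/measurable_funM; first exact: measurable_indic.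
  exact: measurableT_comp.
have g0 z : (0 <= g z)%E by rewrite lee_fin mulr_ge0.
have := @fubini_tonelli _ _ T (measurableTypeR R) R m mu g mg g0.
rewrite /fubini_F /fubini_G => E.
transitivity (\int[m]_u \int[mu]_a g (u, a))%E; last first.
  by rewrite E; apply: eq_integral => a _; apply: eq_integral => u _; rewrite /g !indicE.
apply: eq_integral => u _.
rewrite (_ : (fun a => g (u, a)) = (fun a => (V u)%:E * (\1_(`[0, U u[%classic :
    set R) a)%:E)%E); last first.
  by apply/funext => a; rewrite /g /= -EFinM mulrC !indicE.
rewrite ge0_integralZl ?lee_fin//; last first.
  by apply/measurable_EFinP; exact: measurable_indic.
rewrite integral_indic//= setIT lebesgue_measure_itv/= lte_fin.
have := U0 u; rewrite le_eqVlt => /predU1P[<-|U1].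
  by rewrite ltxx mul0r mule0.
by rewrite U1 -EFinB subr0 -EFinM mulrC.
Qed.

Context {d : measure_display} {Om : measurableType d} (P : probability Om R).
Variables (n : nat) (q : 'rV[R]_n -> R).
Hypothesis q_ge0 : forall x, 0 <= q x.
Hypothesis mq : measurable_fun setT (fun u => q (untup u)).

(** The layer-cake formula on both sides reduces the claim to the law of [X] on the superlevel sets
    of [k]. *)
Lemma expectation_density (X : Om -> 'rV[R]_n) (k : n.-tuple R -> R) :
  measurable_fun setT (fun w => tup (X w)) ->
  (forall A, measurable A -> P ((fun w => tup (X w)) @^-1` A) =
     lebRn (fun x => (ind_tup A x * q x)%:E)) ->
  measurable_fun setT k -> (forall u, 0 <= k u) ->
  (\int[P]_w (k (tup (X w)))%:E = lebRn (fun x => (k (tup x) * q x)%:E))%E.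
Proof.
move=> mX law mk k0.
have [m mE] := lebRn_measure R n.
have mkX : measurable_fun setT (fun w => k (tup (X w))) by exact: measurableT_comp.
transitivity (\int[P]_w (k (tup (X w)) * 1)%:E)%E.
  by apply: eq_integral => w _; rewrite mulr1.
rewrite (@layer_cake _ _ P _ (cst 1))//.
transitivity (\int[m]_u (k u * q (untup u))%:E)%E; last first.
  rewrite mE.
  - by apply: eq_lebRn => x; rewrite tupK.
  - by apply/measurable_EFinP/measurable_funM.
  - by move=> u; rewrite lee_fin mulr_ge0.
rewrite (@layer_cake _ _ m)//; apply: eq_integral => a _.
have mA := measurable_superlevel a mk.
transitivity (P ((fun w => tup (X w)) @^-1` [set u | 0 <= a < k u])).
  under eq_integral do rewrite mulr1.
  rewrite integral_indic ?setIT//.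
  exact: (measurable_superlevel a mkX).
rewrite law// mE.
- apply: eq_lebRn => x; rewrite tupK /ind_tup indicE; congr (_ * _)%:E.
  have [h|h] := pselect ([set u | 0 <= a < k u] (tup x)).
    by rewrite asboolT// mem_set.
  by rewrite asboolF// memNset.
- apply/measurable_EFinP/measurable_funM => //; exact: measurable_indic.
- by move=> u; rewrite lee_fin mulr_ge0.
Qed.

Variable X : nat -> Om -> 'rV[R]_n.
Hypothesis mX : forall i, measurable_fun setT (fun w => tup (X i w)).
Hypothesis indepX : mutually_independent P (fun i w => tup (X i w)).
Hypothesis lawX : forall i A, measurable A ->
  P ((fun w => tup (X i w)) @^-1` A) = lebRn (fun x => (ind_tup A x * q x)%:E).

(** Two applications of the layer-cake formula leave probabilities of intersections of superlevel
    events, which factor by independence. *)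
Lemma pair_expectation (k : n.-tuple R -> R) i j : i != j ->
  measurable_fun setT k -> (forall u, 0 <= k u) ->
  (\int[P]_w (k (tup (X i w)) * k (tup (X j w)))%:E =
   \int[P]_w (k (tup (X i w)))%:E * \int[P]_w (k (tup (X j w)))%:E)%E.
Proof.
move=> ij mk k0.
have mkX l : measurable_fun setT (fun w => k (tup (X l w))) by exact: measurableT_comp.
have mB l a : measurable [set w | 0 <= a < k (tup (X l w))] by exact: measurable_superlevel.
have E0 l : (\int[P]_w (k (tup (X l w)))%:E = \int[mu]_a P [set w | (0 <= a < k (tup (X l
    w)))%R])%E.
  transitivity (\int[P]_w (k (tup (X l w)) * 1)%:E)%E.
    by apply: eq_integral => w _; rewrite mulr1.
  rewrite (@layer_cake _ _ P _ (cst 1))//; apply: eq_integral => a _.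
  by under eq_integral do rewrite mulr1; rewrite integral_indic ?setIT.
have mPB l : measurable_fun setT (fun a : R => P [set w | (0 <= a < k (tup (X l w)))%R]).
  pose A : set (R * Om) := [set z | 0 <= z.1 < k (tup (X l z.2))].
  have mA : measurable A.
    have m1 : measurable_fun setT (fun z : R * Om => 0 <= z.1) by exact: measurable_fun_ler.
    have m2 : measurable_fun setT (fun z : R * Om => z.1 < k (tup (X l z.2))).
      by apply: measurable_fun_ltr => //; exact: measurableT_comp (mkX l) _.
    have := measurable_and m1 m2 measurableT (Y := [set true]) I.
    by rewrite setTI; congr measurable; apply/seteqP; split.
  have := measurable_fun_xsection P mA.
  apply: eq_measurable_fun => a _; congr (P _).
  by apply/seteqP; split => w; rewrite /xsection /A /= inE.
have kE (l : nat) : (0 <= \int[P]_w (k (tup (X l w)))%:E)%E.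
  by apply: integral_ge0 => w _; rewrite lee_fin.
rewrite (@layer_cake _ _ P)//.
transitivity (\int[mu]_a (P [set w | (0 <= a < k (tup (X i w)))%R] *
    \int[P]_w (k (tup (X j w)))%:E))%E; last first.
  rewrite ge0_integralZr//; last exact: mPB.
  by rewrite (E0 i).
apply: eq_integral => a _.
transitivity (\int[P]_w (k (tup (X j w)) * \1_[set w | (0 <= a < k (tup (X i w)))%R] w)%:E)%E.
  by apply: eq_integral => w _; rewrite mulrC.
rewrite (@layer_cake _ _ P)//.
rewrite [in RHS]E0 -ge0_integralZl//; last exact: mPB.
apply: eq_integral => b _.
transitivity (P ([set w | 0 <= a < k (tup (X i w))] `&` [set w | 0 <= b < k (tup (X j w))])).
  rewrite -[X in _ = P X]setIT -integral_indic//; last exact: measurableI.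
  by apply: eq_integral => w _; rewrite indicI/= mulrC.
(* The family of events takes level [a] at the index [i] and level [b] at the other one. *)
have := indepX (I := [:: i; j])
  (A := fun l => if l == i then [set u | 0 <= a < k u] else [set u | 0 <= b < k u]).
rewrite /= !big_cons !big_nil eqxx [j == i]eq_sym (negbTE ij) setIT mule1; apply.
  by rewrite inE ij.
by move=> l _; case: ifP => _; exact: measurable_superlevel.
Qed.

(** The centred variables are bounded, and orthogonal by [pair_expectation], as [slln_orthogonal]
    requires. *)
Lemma slln_iid (k : n.-tuple R -> R) (K : R) : measurable_fun setT k ->
  (forall u, 0 <= k u <= K) ->
  {ae P, forall w, (\sum_(i < N) k (tup (X i w))) / N%:R @[N --> \oo] -->
    fine (lebRn (fun x => (k (tup x) * q x)%:E))}.
Proof.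
move=> mk kK; have k0 u : 0 <= k u by case/andP: (kK u).
have kK' u : k u <= K by case/andP: (kK u).
set c := fine _.
have mkX l : measurable_fun setT (fun w => k (tup (X l w))) by exact: measurableT_comp.
have ik l : P.-integrable setT (EFin \o (fun w => k (tup (X l w)))).
  by apply: (@bounded_integrable _ _ _ P _ (K)) => // w; rewrite ger0_norm.
have Ek l : Rintegral P setT (fun w => k (tup (X l w))) = c.
  by rewrite /Rintegral expectation_density//; exact: lawX.
have EkE l : (\int[P]_w (k (tup (X l w)))%:E = c%:E)%E.
  by rewrite -(Ek l) /Rintegral fineK//; exact: (integrable_fin_num measurableT (ik l)).
pose Z i w := k (tup (X i w)) - c.
have c0 : 0 <= c.
  by rewrite -lee_fin -(EkE 0%N); apply: integral_ge0 => w _; rewrite lee_fin.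
have mZ i : measurable_fun setT (Z i) by exact: measurable_funB.
have ZK i w : `|Z i w| <= K + c.
  by rewrite (le_trans (ler_normB _ _))// !ger0_norm// lerD2r.
have Zo i j : (i < j)%N -> Rintegral P setT (fun w => Z i w * Z j w) = 0.
  move=> ij; have ij' : i != j by rewrite ltn_eqF.
  have ikk : P.-integrable setT (EFin \o (fun w => k (tup (X i w)) * k (tup (X j w)))).
    apply: (@bounded_integrable _ _ _ P _ (K * K)); first exact: measurable_funM.
    by move=> w; rewrite normrM !ger0_norm// ler_pM.
  have ick l : P.-integrable setT (EFin \o (fun w => c * k (tup (X l w)))).
    apply: (@bounded_integrable _ _ _ P _ (c * K)); first exact: measurable_funM.
    by move=> w; rewrite normrM !ger0_norm// ler_wpM2l.
  have icc : P.-integrable setT (EFin \o (fun=> c * c)).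
    by apply: (@bounded_integrable _ _ _ P _ `|c * c|).
  have i2 : P.-integrable setT (EFin \o (fun w => k (tup (X i w)) * k (tup (X j w)) - c * k (tup
      (X i w)))).
    exact: (integrableB measurableT ikk (ick i)).
  have i3 : P.-integrable setT (EFin \o (fun w => c * k (tup (X j w)) - c * c)).
    exact: (integrableB measurableT (ick j) icc).
  rewrite (_ : (fun w => _) = (fun w => (k (tup (X i w)) * k (tup (X j w)) - c * k (tup (X i w)))
      - (c * k (tup (X j w)) - c * c))); last by apply/funext => w; rewrite /Z; ring.
  rewrite RintegralB// RintegralB// RintegralB//.
  rewrite (RintegralZl c measurableT (ik i)) (RintegralZl c measurableT (ik j)) !Ek.
  have -> : Rintegral P setT (fun w => k (tup (X i w)) * k (tup (X j w))) = c * c.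
    by rewrite /Rintegral pair_expectation// !EkE -EFinM.
  have -> : Rintegral P setT (fun=> c * c) = c * c.
    transitivity (c * c * fine (P setT)); first by rewrite Rintegral_cst.
    by rewrite (_ : P setT = 1%E) ?mulr1//; exact: probability_setT.
  ring.
have := slln_orthogonal mZ ZK Zo; apply: filterS => w.
move=> Zw; have {}Zw : (\sum_(i < N) Z i w) / N%:R + c @[N --> \oo] --> c.
  by rewrite -[X in _ --> X]add0r; apply: cvgD => //; exact: cvg_cst.
apply: cvg_trans Zw; apply: near_eq_cvg; exists 1%N => // N /= N1.
rewrite /Z sumrB sumr_const card_ord mulrBl -[c *+ N]mulr_natr mulfK ?subrK//.
by rewrite pnatr_eq0 -lt0n.
Qed.

End Sampling.

(** * The logarithm of the partition function *)

Section LogPartition.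
Variables (R : realType) (n : nat).
Local Notation mu := (@lebesgue_measure R).

Lemma dominated_continuous d (T : measurableType d) (m : {measure set T -> \bar R})
    (f : R -> T -> R) (g : T -> R) :
  (forall s, measurable_fun setT (f s)) -> (forall y, continuous (f ^~ y)) ->
  m.-integrable setT (EFin \o g) -> (forall s y, `|f s y| <= g y) ->
  continuous (fun s => Rintegral m setT (f s)).
Proof.
move=> mf cf ig fg s.
have i_f r : m.-integrable setT (EFin \o f r).
  apply: le_integrable ig => //; first exact/measurable_EFinP.
  by move=> y _; rewrite /= lee_fin (le_trans (fg _ _))// ler_norm.
apply: (@continuity_under_integral R _ T m f setT measurableT (s - 1) (s + 1)
   (fun x _ => i_f x) _ g ig).
- by apply: aeW => y _ r _; exact: cf.
- by move=> x _; apply: aeW => y _; exact: fg.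
- by rewrite inE/= in_itv/=; apply/andP; split; lra.
Qed.

Variables (rho h : 'rV[R]_n -> R -> R) (t M : R).
Hypothesis t01 : 0 < t <= 1.
Hypothesis rho_cont : continuous (fun z : 'rV[R]_n * R => rho z.1 z.2).
Hypothesis rho_gt0 : forall x s, 0 <= s <= 1 -> 0 < rho x s.
Hypothesis rho_dt : forall x (s : R), 0 < s < 1 -> is_derive s 1 (rho x) (rho x s * h x s).
Hypothesis h_cont : continuous (fun z : 'rV[R]_n * R => h z.1 (clamp 1 z.2)).
Hypothesis h_le : forall x s, 0 <= s <= t -> `|h x s| <= M.
Hypothesis rho0_mass : lebRn (fun x => (rho x 0)%:E) = 1%E.

Definition mass (s : R) : R := fine (lebRn (fun x => (rho x s)%:E)).
(* The shift by [M] makes the integrand nonnegative; the derivative of [mass] is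
   [mass_dt - M * mass]. *)
Definition mass_dt (s : R) : R := fine (lebRn (fun x => (rho x s * (h x s + M))%:E)).

Let t_gt0 : 0 < t. Proof. by case/andP: t01. Qed.

Let M_ge0 : 0 <= M.
Proof. by apply: le_trans (h_le 0 (s := 0) _) => //; rewrite lexx ltW. Qed.

Let t1 s : 0 <= s <= t -> 0 <= s <= 1.
Proof. by case/andP: t01 => _ t1' /andP[-> st]; rewrite (le_trans st). Qed.

Let ct_cont : continuous (clamp t). Proof. exact: clamp_continuous. Qed.

Let ctP s : 0 <= clamp t s <= t. Proof. exact: (clampP _ (ltW t_gt0)). Qed.

Lemma rho_ct_cont x : continuous (fun s => rho x (clamp t s)).
Proof.
apply: (@continuous_compT _ _ _ (fun z : 'rV[R]_n * R => rho z.1 z.2) (fun s =>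
    (x, clamp t s))) => //.
by apply: continuous_pairT => //; exact: continuous_cstT.
Qed.

Lemma h_ct_cont x : continuous (fun s => h x (clamp t s)).
Proof.
rewrite (_ : (fun s => _) = (fun s => h x (clamp 1 (clamp t s)))).
  apply: (@continuous_compT _ _ _ (fun z : 'rV[R]_n * R => h z.1 (clamp 1 z.2)) (fun s =>
      (x, clamp t s))) => //.
  by apply: continuous_pairT => //; exact: continuous_cstT.
by apply/funext => s; rewrite (clampK (t := 1))//; exact: t1.
Qed.

Lemma ln_rho_dt x (s : R) : 0 < s < 1 -> is_derive s 1 (fun r => ln (rho x r)) (h x s).
Proof.
move=> s01; have s01' : 0 <= s <= 1 by case/andP: s01 => /ltW -> /ltW ->.
have r0 := rho_gt0 x s01'.
have := is_derive1_comp (is_derive1_ln r0) (rho_dt x s01).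
by rewrite mulrA mulVf ?mul1r// gt_eqF.
Qed.

(** The time derivative of [ln rho] is bounded by [M] and [s <= 1], so [ln rho] moves by at most
    [M]. The upper bound supplies every dominating function below as a multiple of [rho(., 0)]; the
    lower one keeps the mass positive. *)
Lemma rho_bounds x s : 0 <= s <= t -> expR (- M) * rho x 0 <= rho x s <= expR M * rho x 0.
Proof.
move=> st; have [s0 s_t] := andP st; have s01 := t1 st.
have r0 : 0 < rho x 0 by apply: rho_gt0; rewrite lexx ler01.
have rs := rho_gt0 x s01.
have [r rr|c|c cs E] := @MVT_segment R (fun r => ln (rho x r)) (h x) 0 s s0.
- move: rr; rewrite in_itv/= => /andP[r0' rs']; apply: ln_rho_dt.
  by rewrite r0' (lt_le_trans rs')//; case/andP: s01.
- move: c; apply: (@subspace_eq_continuous _ _ _ (fun r => ln (rho x (clamp t r)))).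
    move=> r; rewrite inE/= in_itv/= => /andP[r0' rs'].
    by rewrite clampK// r0' (le_trans rs').
  apply: continuous_withinT => r.
  apply: (@continuous_comp _ _ _ (fun r => rho x (clamp t r)) (@ln R)); first exact: rho_ct_cont.
  by apply: continuous_ln; apply: rho_gt0; exact: t1.
have : `|ln (rho x s) - ln (rho x 0)| <= M.
  move: cs; rewrite in_itv/= => /andP[c0 cs].
  rewrite E subr0 normrM (ger0_norm s0) -[leRHS]mulr1.
  rewrite ler_pM//; first by rewrite h_le// c0 (le_trans cs).
  by case/andP: s01.
rewrite ler_norml lerBrDr lerBlDr => /andP[l1 l2].
rewrite -(lnK (x := rho x s)) ?posrE// -(lnK (x := rho x 0)) ?posrE// -!expRD !ler_expR.
by rewrite l1 l2.
Qed.

Let m_exists := lebRn_measure R n.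
Let m := projT1 (cid m_exists).
Let mE := projT2 (cid m_exists).

Let toint (k : 'rV[R]_n -> R) : measurable_fun setT (fun u => k (untup u)) ->
    (forall x, 0 <= k x) ->
   lebRn (fun x => (k x)%:E) = (\int[m]_u (k (untup u))%:E)%E.
Proof.
exact: (lebRn_integral mE).
Qed.

Let m_rho s : measurable_fun setT (fun u => rho (untup u) s).
Proof.
apply: (@measurable_continuous_rV _ _ _ _ (fun z : 'rV[R]_n * R =>
    rho z.1 z.2) (@untup R n) (cst s)) => //.
by move=> j; exact: measurable_untup.
Qed.

Let m_h s : measurable_fun setT (fun u => h (untup u) (clamp t s)).
Proof.
rewrite (_ : (fun u => _) = (fun u => h (untup u) (clamp 1 (clamp t s)))).
  apply: (@measurable_continuous_rV _ _ _ _ (fun z : 'rV[R]_n * R =>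
      h z.1 (clamp 1 z.2)) (@untup R n) (cst (clamp t s))) => //.
  by move=> j; exact: measurable_untup.
by apply/funext => u; rewrite (clampK (t := 1))//; exact: t1.
Qed.

Let rct_ge0 x s : 0 <= rho x (clamp t s). Proof. by apply/ltW/rho_gt0/t1. Qed.

Let hM_ge0 x s : 0 <= h x (clamp t s) + M.
Proof. by have := h_le x (ctP s); rewrite ler_norml => /andP[]; rewrite -subr_ge0 opprK. Qed.

Let rho0_int : m.-integrable setT (EFin \o (fun u => rho (untup u) 0)).
Proof.
have r0 x : 0 <= rho x 0 by apply/ltW/rho_gt0; rewrite lexx ler01.
apply/integrableP; split; first exact/measurable_EFinP.
under eq_integral do rewrite /= ger0_norm//.
by rewrite -(toint (k := fun x => rho x 0))// rho0_mass ltry.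
Qed.

Let dom_int K : m.-integrable setT (EFin \o (fun u => K * rho (untup u) 0)).
Proof.
rewrite (_ : _ \o _ = (fun u => K%:E * (EFin \o (fun u => rho (untup u) 0)) u)%E).
  exact: integrableZl.
by apply/funext => u; rewrite /= EFinM.
Qed.

Lemma mass_ctE s : mass (clamp t s) = Rintegral m setT (fun u => rho (untup u) (clamp t s)).
Proof. by rewrite /mass (toint (k := fun x => rho x (clamp t s))). Qed.

Lemma mass_dt_ctE s : mass_dt (clamp t s) =
  Rintegral m setT (fun u => rho (untup u) (clamp t s) * (h (untup u) (clamp t s) + M)).
Proof.
rewrite /mass_dt (toint (k := fun x => rho x (clamp t s) * (h x (clamp t s) + M)))//.
- by apply: measurable_funM => //; exact: measurable_funD.
- by move=> x; rewrite mulr_ge0.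
Qed.

Let rct_le x s : `|rho x (clamp t s)| <= expR M * rho x 0.
Proof. by rewrite ger0_norm//; have /andP[] := rho_bounds x (ctP s). Qed.

Lemma mass_ct_cont : continuous (fun s => mass (clamp t s)).
Proof.
under eq_fun do rewrite mass_ctE.
apply: (@dominated_continuous _ _ m (fun s u => rho (untup u)
    (clamp t s)) _ _ _ (dom_int (expR M))) => //.
by move=> u; exact: rho_ct_cont.
Qed.

Lemma mass_dt_ct_cont : continuous (fun s => mass_dt (clamp t s)).
Proof.
under eq_fun do rewrite mass_dt_ctE.
apply: (@dominated_continuous _ _ m (fun s u => rho (untup u) (clamp t s) * (h (untup u)
    (clamp t s) + M))
  _ _ _ (dom_int (expR M * (M + M)))).
- by move=> s; apply: measurable_funM => //; exact: measurable_funD.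
- move=> u; apply: continuous_mulT; first exact: rho_ct_cont.
  by apply: continuous_addT; [exact: h_ct_cont|exact: continuous_cstT].
- move=> s u; rewrite normrM mulrAC ler_pM//.
  by rewrite ger0_norm// lerD2r (le_trans (ler_norm _))// h_le.
Qed.

Lemma mass_gt0 s : 0 <= s <= t -> 0 < mass s.
Proof.
move=> st; rewrite -(clampK st) mass_ctE.
apply: (@lt_le_trans _ _ (Rintegral m setT (fun u => expR (- M) * rho (untup u) 0))).
  rewrite RintegralZl// mulr_gt0 ?expR_gt0//.
  rewrite /Rintegral -(toint (k := fun x => rho x 0))// ?rho0_mass//.
  by move=> x; apply/ltW/rho_gt0; rewrite lexx ler01.
apply: le_Rintegral => //.
  apply: le_integrable (dom_int (expR M)) => //; first exact/measurable_EFinP.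
  by move=> u _ /=; rewrite lee_fin (le_trans (rct_le _ _))// ler_norm.
by move=> u _; have /andP[] := rho_bounds (untup u) (ctP s).
Qed.

(** Differentiation under the integral, the derivative [rho * h] being dominated by
    [expR M * M * rho(., 0)]. The clamp is the identity near an interior time, and the subtracted
    term undoes the shift in [mass_dt]. *)
Lemma mass_der (s : R) : 0 < s < t ->
  is_derive s 1 (fun r => mass (clamp t r)) (mass_dt s - M * mass s).
Proof.
move=> /andP[s0 st].
have st' : 0 <= s <= t by rewrite !ltW.
have st1 : 0 < s < 1 by rewrite s0 (lt_le_trans st)//; case/andP: t01.
under eq_fun do rewrite mass_ctE.
pose f s u := rho (untup u) (clamp t s).
have i_f r : m.-integrable setT (EFin \o f r).
  have mf : measurable_fun setT (f r) := m_rho (clamp t r).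
  apply: le_integrable (dom_int (expR M)) => //; first by apply/measurable_EFinP; exact: mf.
  by move=> u _ /=; rewrite lee_fin (le_trans (rct_le _ _))// ler_norm.
have dft (r : R) u : r \in `]0, t[ -> is_derive r 1 (f ^~ u) (rho (untup u) r * h (untup u) r).
  rewrite in_itv/= => /andP[r0 rt].
  have r1 : 0 < r < 1 by rewrite r0 (lt_le_trans rt)//; case/andP: t01.
  have := rho_dt (untup u) r1.
  apply: near_eq_is_derive => //; near=> y.
  rewrite /f clampK//; apply/andP; split; apply: ltW; near: y.
    exact: lt_nbhsr.
  exact: lt_nbhsl.
have sI : `]0, t[%classic s by rewrite /= in_itv/= s0.
have df1 (r : R) u : `]0, t[%classic r -> setT u -> derivable (f ^~ u) r 1.
  by move=> rI _; have [] := dft r u rI.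
have dE (r : R) u : `]0, t[%classic r -> (f ^~ u)^`()%classic r = rho (untup u) r * h (untup u) r.
  by move=> rI; rewrite derive1E; have [_ ->] := dft r u rI.
have G_ub (r : R) u : `]0, t[%classic r -> setT u ->
    `|partial1of2 f r u| <= expR M * M * rho (untup u) 0.
  move=> rI _; rewrite /partial1of2 dE//.
  move: rI; rewrite /= in_itv/= => /andP[r0 rt].
  have rt' : 0 <= r <= t by rewrite !ltW.
  rewrite normrM mulrAC ler_pM//; last exact: h_le.
  by have := rct_le (untup u) r; rewrite clampK.
have G0 u : 0 <= expR M * M * rho (untup u) 0.
  by rewrite !mulr_ge0 ?expR_ge0//; apply/ltW/rho_gt0; rewrite lexx ler01.
have D1 := derivable_under_integral measurableT sI (fun r _ => i_f r) df1 G0 (dom_int _) G_ub.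
have D2 := differentiation_under_integral measurableT sI (fun r _ => i_f r) df1 G0 (dom_int _) G_ub.
split; first exact: D1.
rewrite -derive1E D2 -{2 3}(clampK st') mass_ctE mass_dt_ctE.
have iM : m.-integrable setT (EFin \o (fun u => M * rho (untup u) (clamp t s))).
  rewrite (_ : _ \o _ = (fun u => M%:E * (EFin \o f s) u)%E); first exact: integrableZl.
  by apply/funext => u; rewrite /= EFinM.
rewrite -RintegralZl//; last exact: i_f.
rewrite -RintegralB//.
  apply: eq_Rintegral => u _; rewrite /partial1of2 dE// (clampK st'); ring.
apply: le_integrable (dom_int (expR M * (M + M))) => //.
  by apply/measurable_EFinP; apply: measurable_funM => //; exact: measurable_funD.
move=> u _ /=; rewrite lee_fin [leRHS]ger0_norm.
  rewrite normrM mulrAC ler_pM//.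
  by rewrite ger0_norm// lerD2r (le_trans (ler_norm _))// h_le.
by rewrite !mulr_ge0 ?expR_ge0 ?addr_ge0//; apply/ltW/rho_gt0; rewrite lexx ler01.
Unshelve. all: by end_near. Qed.

(** The integrand is the logarithmic derivative of the mass, and the initial mass is 1, so the
    boundary term at 0 vanishes. *)
Lemma ln_mass : Rintegral mu `[0, t] (fun s => mass_dt s / mass s - M) = ln (mass t).
Proof.
pose f s := mass_dt (clamp t s) / mass (clamp t s) - M.
pose F s := ln (mass (clamp t s)).
have mct s : 0 < mass (clamp t s) by exact: mass_gt0.
have cf : continuous f.
  apply: continuous_subT; last exact: continuous_cstT.
  apply: continuous_mulT; first exact: mass_dt_ct_cont.
  by move=> s; apply: cvgV; [rewrite gt_eqF|exact: mass_ct_cont].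
have cF : continuous F.
  move=> s; apply: (@continuous_comp _ _ _ (fun r => mass (clamp t r)) (@ln R));
      first exact: mass_ct_cont.
  exact: continuous_ln.
have dF (s : R) : s \in `]0, t[ -> is_derive s 1 F (f s).
  rewrite in_itv/= => sI; have [s0 st] := andP sI.
  have st' : 0 <= s <= t by rewrite !ltW.
  have := @is_derive1_comp _ (@ln R) (fun r => mass (clamp t r)) s _ _ (is_derive1_ln (mct s))
      (mass_der sI).
  rewrite (_ : _ * _ = f s)// /f clampK//.
  by have := mass_gt0 st' => ms; field; rewrite gt_eqF.
have FTC : (\int[mu]_(x in `[0%R, t]) (f x)%:E = (F t)%:E - (F 0)%:E)%E.
  apply: continuous_FTC2 => //.
  - exact: continuous_withinT.
  - split; first by move=> s sI; have [] := dF s sI.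
    + by apply: cvg_at_right_filter; exact: cF.
    + by apply: cvg_at_left_filter; exact: cF.
  - by move=> s sI; rewrite derive1E; have [_ ->] := dF s sI.
transitivity (Rintegral mu `[0, t] f).
  by apply: eq_Rintegral => s; rewrite inE/= in_itv/= => st; rewrite /f clampK.
rewrite /Rintegral FTC /= /F !clampK ?lexx ?ltW//.
by rewrite /mass rho0_mass /= ln1 subr0.
Qed.

End LogPartition.

(** * Self-normalized averages *)

(* Fubini for the upper limit, since almost sure convergence at each time must be turned into
   almost everywhere convergence in time, almost surely. *)
Lemma ae_ae_cvg0 (R : realType) d d' (T : measurableType d) (T' : measurableType d')
    (m : {sigma_finite_measure set T -> \bar R}) (m' : {sigma_finite_measure set T' -> \bar R})
    (Q : nat -> T * T' -> R) :
  (forall N, measurable_fun setT (Q N)) -> (forall N z, 0 <= Q N z) ->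
  (forall s, {ae m, forall w, Q N (w, s) @[N --> \oo] --> 0}) ->
  {ae m, forall w, {ae m', forall s, Q N (w, s) @[N --> \oo] --> 0}}.
Proof.
move=> mQ Q0 Qcvg.
(* The upper limit is jointly measurable and, [Q] being nonnegative, vanishes exactly where [Q]
   tends to 0; the claim becomes the vanishing of a double integral. *)
pose L z := limn_esup (fun N => (Q N z)%:E).
have mL : measurable_fun setT L.
  by apply: measurable_fun_limn_esup => N; exact/measurable_EFinP.
have L0 z : (0 <= L z)%E.
  rewrite /L limn_esup_lim; apply: lime_ge; first exact: is_cvg_esups.
  apply: nearW => N; rewrite (@le_trans _ _ (Q N z)%:E) ?lee_fin//.
  by apply: ereal_sup_ubound; exists N => /=.
have L0_cvg z : L z = 0%E -> Q N z @[N --> \oo] --> 0.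
  move=> Lz.
  have := @limn_esup_le_cvg R (fun N => (Q N z)%:E) 0%E.
  rewrite -/(L z) Lz => /(_ (lexx _)) H.
  have QE N : (0 <= (Q N z)%:E)%E by rewrite lee_fin.
  exact: fine_cvg (H QE).
have intL : (\int[m]_w \int[m']_s L (w, s) = 0)%E.
  have := @fubini_tonelli _ _ T T' R m m' L mL L0; rewrite /fubini_F /fubini_G => ->.
  rewrite integral0_eq// => s _.
  have mLs : measurable_fun setT (fun w => L (w, s)).
    exact: (measurableT_comp mL (pair2_measurable s)).
  transitivity (\int[m]_w `|L (w, s)|)%E.
    by apply: eq_integral => w _; rewrite gee0_abs.
  apply/(ae_eq_integral_abs m measurableT mLs).
  have := Qcvg s; apply: filterS => w Qw _ /=.
  rewrite /L is_cvg_limn_esupE.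
    by apply/cvg_lim => //; apply: cvg_EFin => //; exact: nearW.
  by apply/cvg_ex; exists 0%E; apply: cvg_EFin => //; exact: nearW.
have mI : measurable_fun setT (fun w => \int[m']_s L (w, s))%E.
  exact: (measurable_fun_fubini_tonelli_F (m2 := m') L).
have : ae_eq m setT (fun w => \int[m']_s L (w, s))%E (cst 0%E).
  apply/(ae_eq_integral_abs m measurableT mI).
  rewrite -[RHS]intL; apply: eq_integral => w _.
  by rewrite gee0_abs//; exact: integral_ge0.
apply: filterS => w /(_ I) /= Iw.
have mLw : measurable_fun setT (fun s => L (w, s)).
  exact: (measurableT_comp mL (pair1_measurable w)).
have : ae_eq m' setT (fun s => L (w, s)) (cst 0%E).
  apply/(ae_eq_integral_abs m' measurableT mLw).
  by rewrite -[RHS]Iw; apply: eq_integral => s _; rewrite gee0_abs.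
by apply: filterS => s /(_ I) /= /L0_cvg.
Qed.

(** * Convergence of the self-normalized estimator *)

Section Sampled.
Variables (R : realType) (n : nat).
Local Notation D := n.+1.
Local Notation mu := (@lebesgue_measure R).
Variables (v : 'rV[R]_D -> R -> 'rV[R]_D) (b : 'I_D -> 'rV[R]_D -> R -> R) (L : R).
Hypothesis v_cont : forall j, continuous (fun z : 'rV[R]_D * R => v z.1 z.2 0 j).
Hypothesis b_cont : forall j, continuous (fun z : 'rV[R]_D * R => b j z.1 z.2).
Hypothesis v_der : forall j s x, is_derive x (basis_vec R j) (fun y => v y s 0 j) (b j x s).
Hypothesis L_ge1 : 1 <= L.
Hypothesis v_lip : forall x y s, 0 <= s <= 1 -> `|v x s - v y s| <= L * `|x - y|.
Variable V0 : R.
Hypothesis v0 : forall s, 0 <= s <= 1 -> `|v 0 s| <= V0.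
Variable phi : 'rV[R]_D -> R -> 'rV[R]_D.
Hypothesis phi0 : forall x, phi x 0 = x.
Hypothesis phi_cont : forall x, continuous (phi x).
Hypothesis phi_der : forall x (s : R), 0 < s < 1 -> is_derive s 1 (phi x) (v (phi x s) s).
Hypothesis phi_clamp : forall x s, phi x (clamp 1 s) = phi x s.
Variables rho al : 'rV[R]_D -> R -> R.
Hypothesis rho_cont : continuous (fun z : 'rV[R]_D * R => rho z.1 z.2).
Hypothesis rho_gt0 : forall x s, 0 <= s <= 1 -> 0 < rho x s.
Hypothesis al_cont : continuous (fun z : 'rV[R]_D * R => al z.1 (clamp 1 z.2)).
Hypothesis rho_der : forall x (s : R), 0 < s < 1 ->
  is_derive s 1 (fun r => ln (rho (phi x r) r)) (al (phi x s) s).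
Variables (h : 'rV[R]_D -> R -> R) (t M K : R).
Hypothesis t01 : 0 < t <= 1.
Hypothesis rho_dt : forall x (s : R), 0 < s < 1 -> is_derive s 1 (rho x) (rho x s * h x s).
Hypothesis h_cont : continuous (fun z : 'rV[R]_D * R => h z.1 (clamp 1 z.2)).
Hypothesis h_le : forall x s, 0 <= s <= t -> `|h x s| <= M.
Hypothesis rho0_mass : lebRn (fun x => (rho x 0)%:E) = 1%E.
Local Notation weight := (weight b phi al).
Hypothesis weight_le : forall x s, 0 <= s <= t -> weight x s <= K.
Context {d : measure_display} {Om : measurableType d} (P : probability Om R).
Variable X : nat -> Om -> 'rV[R]_D.
Hypothesis mX : forall i, measurable_fun setT (fun w => tup (X i w)).
Hypothesis indepX : mutually_independent P (fun i w => tup (X i w)).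
Hypothesis lawX : forall i A, measurable A ->
  P ((fun w => tup (X i w)) @^-1` A) = lebRn (fun x => (ind_tup A x * rho x 0)%:E).

Definition self_normalized (N : nat) (x : nat -> 'rV[R]_D) (s : R) : R :=
  (\sum_(i < N) weight (x i) s * h (phi (x i) s) s) / \sum_(i < N) weight (x i) s.

Let t_ge0 : 0 <= t. Proof. by case/andP: t01 => /ltW. Qed.

Let ctP s : 0 <= clamp t s <= t. Proof. exact: clampP. Qed.

Let ct1 s : 0 <= clamp t s <= 1.
Proof. by case/andP: (ctP s) => -> h1; case/andP: t01 => _; apply: le_trans. Qed.

Let weight_gt0 x s : 0 < weight x s. Proof. exact: expR_gt0. Qed.

Let h_ct_cont1 s : continuous (fun x => h x (clamp t s)).
Proof.
rewrite (_ : (fun x => _) = (fun x => h x (clamp 1 (clamp t s)))).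
  apply: (@continuous_compT _ _ _ (fun z : 'rV[R]_D * R => h z.1 (clamp 1 z.2)) (fun x =>
      (x, clamp t s))) => //.
  by apply: continuous_pairT; [exact: continuous_idT|exact: continuous_cstT].
by apply/funext => x; rewrite (clampK (t := 1)).
Qed.

Let mXc i j : measurable_fun setT (fun w => X i w 0 j).
Proof.
have := measurableT_comp (measurable_tnth j) (mX i).
by apply: eq_measurable_fun => w _ /=; rewrite tnth_mktuple.
Qed.

Let mclamp : measurable_fun setT (clamp t).
Proof. by apply: continuous_measurable_fun; exact: clamp_continuous. Qed.

Let m_weight d' (T : measurableType d') (s : T -> R) (x : T -> 'rV[R]_D) :
  measurable_fun setT s -> (forall j, measurable_fun setT (fun p => x p 0 j)) ->
  measurable_fun setT (fun p => weight (x p) (clamp t (s p))).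
Proof.
move=> ms mx.
have mc : measurable_fun setT (fun p => clamp t (s p)) by exact: measurableT_comp.
exact: (measurable_weight v_cont b_cont L_ge1 v_lip phi0 phi_cont phi_der phi_clamp al_cont mc mx).
Qed.

Let m_h d' (T : measurableType d') (s : T -> R) (x : T -> 'rV[R]_D) :
  measurable_fun setT s -> (forall j, measurable_fun setT (fun p => x p 0 j)) ->
  measurable_fun setT (fun p => h (phi (x p) (clamp t (s p))) (clamp t (s p))).
Proof.
move=> ms mx.
have mc : measurable_fun setT (fun p => clamp t (s p)) by exact: measurableT_comp.
have -> : (fun p => h (phi (x p) (clamp t (s p))) (clamp t (s p))) =
    (fun p => h (phi (x p) (clamp t (s p))) (clamp 1 (clamp t (s p)))).
  by apply/funext => p; rewrite (clampK (t := 1)).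
apply: (@measurable_continuous_rV _ _ _ _ (fun z : 'rV[R]_D * R => h z.1 (clamp 1 z.2))
  (fun p => phi (x p) (clamp t (s p))) (fun p => clamp t (s p))) => // j.
exact: (measurable_phi v_cont L_ge1 v_lip phi0 phi_cont phi_der phi_clamp j mc mx).
Qed.

(** The strong law applies to [weight] times [f] at the transported sample, and [weighted_identity]
    evaluates the expectation. *)
Let average_cvg (f : 'rV[R]_D -> R) (s C : R) : continuous f -> (forall x, 0 <= f x <= C) ->
  {ae P, forall w, (\sum_(i < N) weight (X i w) (clamp t s) * f (phi (X i w) (clamp t s))) / N%:R
     @[N --> \oo] --> fine (lebRn (fun x => (rho x (clamp t s) * f x)%:E))}.
Proof.
move=> cf f0C.
have f0 x : 0 <= f x by case/andP: (f0C x).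
pose k (u : D.-tuple R) := weight (untup u) (clamp t s) * f (phi (untup u) (clamp t s)).
have mc : measurable_fun setT (fun _ : D.-tuple R => clamp t s) by exact: measurable_cst.
have mk : measurable_fun setT k.
  apply: measurable_funM.
    by apply: (@m_weight _ _ (cst s)) => //; exact: measurable_untup.
  apply: measurable_continuous_rV1 => // j.
  apply: (measurable_phi v_cont L_ge1 v_lip phi0 phi_cont phi_der phi_clamp j mc).
  exact: measurable_untup.
have kK u : 0 <= k u <= K * C.
  have [/andP[a1 a2] w0] := (f0C (phi (untup u) (clamp t s)), ltW (weight_gt0 (untup u)
      (clamp t s))).
  by rewrite /k mulr_ge0//= ler_pM// weight_le.
have r0 x : 0 <= rho x 0 by apply/ltW/rho_gt0; rewrite lexx ler01.
have mr : measurable_fun setT (fun u => rho (untup u) 0).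
  apply: (@measurable_continuous_rV _ _ _ _ (fun z : 'rV[R]_D * R =>
      rho z.1 z.2) (@untup R D) (cst 0)) => //.
  by move=> j; exact: measurable_untup.
have := slln_iid r0 mr mX indepX lawX mk kK.
rewrite -(weighted_identity v_cont b_cont v_der L_ge1 v_lip v0 phi0 phi_cont phi_der phi_clamp
  rho_cont rho_gt0 al_cont rho_der (ct1 s) cf f0).
have -> : lebRn (fun x => (k (tup x) * rho x 0)%:E) =
   lebRn (fun x => (rho x 0 * weight x (clamp t s) * f (phi x (clamp t s)))%:E).
  by apply: eq_lebRn => x; rewrite /k tupK; congr EFin; ring.
apply: filterS => w; apply: cvg_trans; apply: near_eq_cvg; apply: nearW => N /=.
by congr (_ / _); apply: eq_bigr => i _; rewrite /k tupK.
Qed.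

Lemma self_normalized_cvg : {ae P, forall w,
  Rintegral mu `[0, t] (self_normalized N (fun i => X i w)) @[N --> \oo] --> ln (mass rho t)}.
Proof.
pose A N w s := (\sum_(i < N) weight (X i w) (clamp t s) * 1) / N%:R.
pose B N w s := (\sum_(i < N) weight (X i w) (clamp t s) *
   (h (phi (X i w) (clamp t s)) (clamp t s) + M)) / N%:R.
pose m1 s := mass rho (clamp t s).
pose m2 s := mass_dt rho h M (clamp t s).
have Acvg s : {ae P, forall w, A N w s @[N --> \oo] --> m1 s}.
  have := @average_cvg (cst 1) s 1 (@continuous_cstT _ _ _); rewrite /m1 /mass.
  have -> : lebRn (fun x => (rho x (clamp t s) * cst 1 x)%:E) = lebRn (fun x =>
      (rho x (clamp t s))%:E).
    by apply: eq_lebRn => x; rewrite mulr1.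
  by apply => x; rewrite ler01 lexx.
have Bcvg s : {ae P, forall w, B N w s @[N --> \oo] --> m2 s}.
  apply: (@average_cvg (fun x => h x (clamp t s) + M) s (M + M)).
    by apply: continuous_addT; [exact: h_ct_cont1|exact: continuous_cstT].
  move=> x; have := h_le x (ctP s); rewrite ler_norml => /andP[h1 h2].
  by rewrite lerD2r h2 andbT -lerBlDr sub0r.
have cm1 : continuous m1 by move=> s; exact: (mass_ct_cont t01 rho_cont rho_gt0 rho_dt h_le
    rho0_mass).
have cm2 : continuous m2 by move=> s; exact: (mass_dt_ct_cont t01 rho_cont rho_gt0 rho_dt h_cont
    h_le rho0_mass).
have m1_gt0 s : 0 < m1 s.
  exact: (mass_gt0 t01 rho_cont rho_gt0 rho_dt h_le rho0_mass).
(* The errors of the denominator and of the numerator are added so that a single use of [ae_ae_cvg0]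
   controls both. *)
pose Q N (z : Om * R) := `|A N z.1 z.2 - m1 z.2| + `|B N z.1 z.2 - m2 z.2|.
have mXz i j : measurable_fun setT (fun z : Om * R => X i z.1 0 j).
  exact: (measurableT_comp (mXc i j) measurable_fst).
have mQ N : measurable_fun setT (Q N).
  apply: measurable_funD; apply: measurableT_comp => //; apply: measurable_funB.
  - apply: measurable_funM => //; apply: measurable_sum => i; apply: measurable_funM => //.
    exact: (m_weight measurable_snd (mXz i)).
  - by apply: (measurableT_comp _ measurable_snd); exact: continuous_measurable_fun.
  - apply: measurable_funM => //; apply: measurable_sum => i; apply: measurable_funM.
      exact: (m_weight measurable_snd (mXz i)).
    by apply: measurable_funD => //; exact: (m_h measurable_snd (mXz i)).
  - by apply: (measurableT_comp _ measurable_snd); exact: continuous_measurable_fun.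
have Q0 N z : 0 <= Q N z by rewrite addr_ge0.
have Qcvg s : {ae P, forall w, Q N (w, s) @[N --> \oo] --> 0}.
  have := Bcvg s; have := Acvg s; apply: filterS2 => w Aw Bw.
  rewrite -[X in _ --> X]addr0; apply: cvgD.
    by have /subr_cvg0/cvg_norm := Aw; rewrite normr0.
  by have /subr_cvg0/cvg_norm := Bw; rewrite normr0.
have := ae_ae_cvg0 mu mQ Q0 Qcvg; apply: filterS => w Qw.
pose f_ N s := self_normalized N (fun i => X i w) (clamp t s).
pose f s := m2 s / m1 s - M.
have f_cvg : {ae mu, forall s, f_ N s @[N --> \oo] --> f s}.
  apply: filterS Qw => s Qs.
  have Aw : A N w s @[N --> \oo] --> m1 s.
    apply/subr_cvg0/cvgr0Pnorm_le => e e0; move/cvgr0Pnorm_le : Qs => /(_ e e0).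
    apply: filterS => N; rewrite ger0_norm//; apply: le_trans; rewrite /Q/= lerDl//.
  have Bw : B N w s @[N --> \oo] --> m2 s.
    apply/subr_cvg0/cvgr0Pnorm_le => e e0; move/cvgr0Pnorm_le : Qs => /(_ e e0).
    apply: filterS => N; rewrite ger0_norm//; apply: le_trans; rewrite /Q/= lerDr//.
  have AV : (A N w s)^-1 @[N --> \oo] --> (m1 s)^-1 by apply: cvgV => //; rewrite gt_eqF.
  have BAM : B N w s * (A N w s)^-1 - M @[N --> \oo] --> f s.
    by apply: cvgB; [exact: cvgM|exact: cvg_cst].
  (* For [N >= 1] the factors [1 / N] cancel, and subtracting [M] undoes the shift of [h] in [B]. *)
  apply: cvg_trans BAM; apply: near_eq_cvg; exists 1%N => // N /= N1.
  have N0 : N%:R != 0 :> R by rewrite pnatr_eq0 -lt0n.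
  pose SW := \sum_(i < N) weight (X i w) (clamp t s).
  pose SH := \sum_(i < N) weight (X i w) (clamp t s) * h (phi (X i w) (clamp t s)) (clamp t s).
  have EA : \sum_(i < N) weight (X i w) (clamp t s) * 1 = SW.
    by apply: eq_bigr => i _; rewrite mulr1.
  have EB : \sum_(i < N) weight (X i w) (clamp t s) *
      (h (phi (X i w) (clamp t s)) (clamp t s) + M) = SH + SW * M.
    by rewrite mulr_suml -big_split; apply: eq_bigr => i _; rewrite mulrDr.
  have SW0 : 0 < SW.
    by rewrite /SW -(prednK N1) big_ord_recl ltr_pwDl// sumr_ge0// => i _; exact: ltW.
  rewrite /f_ /self_normalized /A /B EA EB -/SH -/SW; move: SW SH SW0 {EA EB} => SW SH SW0.
  by field; rewrite N0 gt_eqF.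
have f_le N s : `|f_ N s| <= M.
  have M0 : 0 <= M by exact: le_trans (normr_ge0 _) (h_le 0 (ctP 0)).
  (* An empty sample gives the quotient of 0 by 0, which is 0. *)
  rewrite /f_ /self_normalized; have [->|N0] := posnP N; first by rewrite !big_ord0 mul0r normr0.
  have SW0 : 0 < \sum_(i < N) weight (X i w) (clamp t s).
    rewrite -(prednK N0) big_ord_recl ltr_pwDl// sumr_ge0// => i _; exact: ltW.
  rewrite normrM normfV (gtr0_norm SW0) ler_pdivrMr// mulr_sumr.
  rewrite (le_trans (ler_norm_sum _ _ _))// ler_sum// => i _.
  by rewrite normrM gtr0_norm// mulrC ler_wpM2r ?h_le// ltW.
have mf_ N : measurable_fun setT (f_ N).
  have mXw i j : measurable_fun setT (fun _ : R => X i w 0 j) by exact: measurable_cst.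
  have mid : measurable_fun setT (id : R -> R) by exact: measurable_id.
  have mw i : measurable_fun setT (fun s => weight (X i w) (clamp t s)).
    exact: (@m_weight _ _ id (fun=> X i w) mid (mXw i)).
  have [->|N0] := posnP N.
    rewrite (_ : f_ 0%N = cst 0)//; apply/funext => s.
    by rewrite /f_ /self_normalized !big_ord0 mul0r.
  apply: measurable_funM.
    apply: measurable_sum => i; apply: measurable_funM => //.
    exact: (@m_h _ _ id (fun=> X i w) mid (mXw i)).
  (* The inverse of a positive sum is the exponential of minus its logarithm, a composition of
     measurable functions. *)
  rewrite (_ : (fun s => _) = (fun s => expR (- ln (\sum_(i < N) weight (X i w) (clamp t s))))).
    apply: (measurableT_comp (@measurable_expR R)); apply: measurableT_comp => //.
    apply: (measurableT_comp (@measurable_ln R)); exact: measurable_sum.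
  apply/funext => s; rewrite expRN lnK// posrE.
  by rewrite -(prednK N0) big_ord_recl ltr_pwDl// sumr_ge0// => i _; exact: ltW.
have cf : continuous f.
  apply: continuous_subT; last exact: continuous_cstT.
  apply: continuous_mulT => // s; apply: cvgV; [by rewrite gt_eqF|exact: cm1].
have fE N : Rintegral mu `[0, t] (self_normalized N (fun i => X i w)) = Rintegral mu `[0, t] (f_ N).
  by apply: eq_Rintegral => s; rewrite inE/= in_itv/= => st; rewrite /f_ clampK.
have lnE : Rintegral mu `[0, t] f = ln (mass rho t).
  rewrite -(ln_mass t01 rho_cont rho_gt0 rho_dt h_cont h_le rho0_mass).
  by apply: eq_Rintegral => s; rewrite inE/= in_itv/= => st; rewrite /f /m1 /m2 clampK.
under eq_fun do rewrite fE.
rewrite -lnE.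
have mt : measurable (`[0, t]%classic : set R) by exact: measurable_itv.
have H1 N : measurable_fun `[0, t] (fun s => (f_ N s)%:E).
  by apply/measurable_EFinP; exact: measurable_funTS.
have H2 : measurable_fun `[0, t] (fun s => (f s)%:E).
  by apply/measurable_EFinP; apply: measurable_funTS; exact: continuous_measurable_fun.
have H3 : {ae mu, forall s, `[0, t]%classic s -> (f_ N s)%:E @[N --> \oo] --> (f s)%:E}.
  move: f_cvg; apply: (@filterS _ _ (ae_filter_ringOfSetsType mu)) => s fs _.
  by apply: cvg_EFin => //; exact: nearW.
have H4 : mu.-integrable `[0, t] (EFin \o (cst M : R -> R)).
  by apply: integrable_continuous_segment; exact: continuous_cstT.
have H5 : {ae mu, forall s N, `[0, t]%classic s -> (`|(f_ N s)%:E| <= (EFin \o (cst M : R ->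
    R)) s)%E}.
  by apply: aeW => s N _; rewrite /= lee_fin.
have [ifn _ dc] := @dominated_convergence _ (measurableTypeR R) R mu `[0, t]%classic mt
  (fun N s => (f_ N s)%:E) (fun s => (f s)%:E) (EFin \o cst M) H1 H2 H3 H4 H5.
rewrite /Rintegral; apply: fine_cvg; rewrite fineK; first exact: dc.
exact: (@integrable_fin_num _ (measurableTypeR R) R mu `[0, t]%classic mt (fun s => (f s)%:E) ifn).
Qed.

End Sampled.

Lemma within_clamp_continuous (R : realType) (V : topologicalType) (g : R -> V) t :
  0 <= t -> {within `[0, t], continuous g} -> continuous (fun s => g (clamp t s)).
Proof.
move=> t0 /subspace_continuousP cg s A /= gA.
have sI : `[0, t]%classic (clamp t s) by rewrite /= in_itv/=; exact: clampP.
have H := @clamp_continuous R t s _ (cg _ sI A gA).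
suff : nbhs s (fun r => A (g (clamp t r))) by [].
apply: (@filterS _ (nbhs s) _ _ _ _ H) => r /=; apply.
by rewrite /= in_itv/=; exact: clampP.
Qed.

(** * Estimating the log partition function along the flow *)

Section Main.
Variables (R : realType) (n : nat).
Local Notation D := n.+1.
Local Notation mu := (@lebesgue_measure R).
Variables (rho : 'rV[R]_D -> R -> R) (v : 'rV[R]_D -> R -> 'rV[R]_D)
  (flow : 'rV[R]_D -> R -> 'rV[R]_D) (t M1 M2 L : R).
Let fr := fun z : 'rV[R]_D * R => rho z.1 z.2.
Let vv := fun z : 'rV[R]_D * R => v z.1 z.2.
Hypothesis rho_smooth : smooth fr.
Hypothesis rho_gt0 : forall (x : 'rV[R]_D) (s : R), 0 <= s <= 1 -> 0 < rho x s.
Hypothesis rho0_mass : Zc rho 0 = 1%E.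
Hypothesis v_smooth : smooth vv.
Hypothesis v_lip : forall x y s, 0 <= s <= 1 -> `|v x s - v y s| <= L * `|x - y|.
Hypothesis flow0 : forall x0, flow x0 0 = x0.
Hypothesis flow_cont : forall x0, {within `[0, 1], continuous (flow x0)}.
Hypothesis flow_der : forall x0 (s : R), 0 < s < 1 -> is_derive s 1 (flow x0) (v (flow x0 s) s).
Hypothesis t01 : 0 < t <= 1.
Hypothesis w_le : forall (s : R) x0, 0 <= s <= t -> `|wtilde rho v flow s x0| < M1.
Hypothesis h_lt : forall x (s : R), 0 <= s <= t -> `|dtlog rho x s| < M2.

Let fr_cont : continuous fr. Proof. exact: (rho_smooth 0%N). Qed.
Let fr_der z w : derivable fr z w. Proof. by have [] := rho_smooth 1%N. Qed.
Let fr_C1 w : continuous ('D_w fr). Proof. by have [_] := rho_smooth 1%N; apply. Qed.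
Let vv_cont : continuous vv. Proof. exact: (v_smooth 0%N). Qed.
Let vv_der z w : derivable vv z w. Proof. by have [] := v_smooth 1%N. Qed.
Let vv_C1 w : continuous ('D_w vv). Proof. by have [_] := v_smooth 1%N; apply. Qed.

Let b (j : 'I_D) (x : 'rV[R]_D) (s : R) : R := 'D_(basis_vec R j, 0) vv (x, s) 0 j.
Let phi (x : 'rV[R]_D) (s : R) : 'rV[R]_D := flow x (clamp 1 s).
Let al (x : 'rV[R]_D) (s : R) : R :=
  (\sum_j v x s 0 j * 'D_(basis_vec R j, 0) fr (x, s) + 'D_(0, 1) fr (x, s)) / rho x s.
(** The Lipschitz constant is raised to at least 1, so that it can be divided by and
    [V0 <= L' * V0]. *)
Let L' := Num.max 1 L.

Let v_contj j : continuous (fun z : 'rV[R]_D * R => v z.1 z.2 0 j).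
Proof. by move=> z; apply: (@cvg_coord _ _ (nbhs z)); exact: vv_cont. Qed.

Let b_cont j : continuous (fun z : 'rV[R]_D * R => b j z.1 z.2).
Proof.
rewrite (_ : (fun z => _) = (fun z => 'D_(basis_vec R j, 0) vv z 0 j)).
  by move=> z; apply: (@cvg_coord _ _ (nbhs z)); exact: vv_C1.
by apply/funext => -[x s].
Qed.

Let v_der j s x : is_derive x (basis_vec R j) (fun y => v y s 0 j) (b j x s).
Proof.
apply: (@is_derive_reparam _ _ _ _ (fun z => vv z 0 j) _ (x, s) (basis_vec R j, 0)).
  by move=> h; rewrite /vv/= scaler0 add0r.
by apply: is_derive_coord; exact/derivableP.
Qed.

Let L_ge1 : 1 <= L'. Proof. by rewrite /L' le_max lexx. Qed.

Let v_lip' x y s : 0 <= s <= 1 -> `|v x s - v y s| <= L' * `|x - y|.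
Proof.
move=> s01; rewrite (le_trans (v_lip _ _ s01))// ler_wpM2r//.
by rewrite /L' le_max lexx orbT.
Qed.

Let v0_bound : exists V0, forall s, 0 <= s <= 1 -> `|v 0 s| <= V0.
Proof.
have cv : continuous (fun s => `|v 0 s|).
  have cp : continuous (fun s : R => (0 : 'rV[R]_D, s)).
    by apply: continuous_pairT; [exact: continuous_cstT|exact: continuous_idT].
  have cv := continuous_compT vv_cont cp.
  by move=> s; apply: cvg_norm; exact: cv.
have [c _ cP] := EVT_max (@ler01 R) (continuous_withinT cv).
by exists `|v 0 c| => s s01; apply: cP; rewrite in_itv.
Qed.

Let phiE x s : 0 <= s <= 1 -> phi x s = flow x s.
Proof. by move=> s01; rewrite /phi clampK. Qed.

Let phi0 x : phi x 0 = x. Proof. by rewrite phiE// lexx ler01. Qed.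

Let phi_cont x : continuous (phi x). Proof. exact: within_clamp_continuous. Qed.

Let s01W (s : R) : 0 < s < 1 -> 0 <= s <= 1. Proof. by case/andP => /ltW -> /ltW ->. Qed.

Let phi_der x (s : R) : 0 < s < 1 -> is_derive s 1 (phi x) (v (phi x s) s).
Proof.
move=> s01; have [s0 s1] := andP s01.
rewrite (phiE x (s01W s01)).
have := flow_der x s01; apply: near_eq_is_derive; near=> r.
rewrite phiE//; apply/andP; split; apply: ltW; near: r.
  exact: lt_nbhsr.
exact: lt_nbhsl.
Unshelve. all: by end_near. Qed.

Let phi_clamp x s : phi x (clamp 1 s) = phi x s.
Proof. by rewrite /phi (clampK (t := 1) (r := clamp 1 s))//; exact: clampP. Qed.

Let clamp_pair_cont : continuous (fun z : 'rV[R]_D * R => (z.1, clamp 1 z.2)).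
Proof.
apply: continuous_pairT; first by move=> z; exact: cvg_fst.
apply: (@continuous_compT _ _ _ (clamp 1) snd); first exact: clamp_continuous.
by move=> z; exact: cvg_snd.
Qed.

Let rho_clamp_inv : continuous (fun z : 'rV[R]_D * R => (rho z.1 (clamp 1 z.2))^-1).
Proof.
move=> z; apply: cvgV; first by rewrite gt_eqF// rho_gt0//; exact: clampP.
exact: (@continuous_compT _ _ _ fr _ fr_cont clamp_pair_cont).
Qed.

Let al_cont : continuous (fun z : 'rV[R]_D * R => al z.1 (clamp 1 z.2)).
Proof.
apply: continuous_mulT => //; apply: continuous_addT.
  apply: continuous_sumT => j; apply: continuous_mulT.
    exact: (@continuous_compT _ _ _ _ _ (@v_contj j) clamp_pair_cont).
  exact: (@continuous_compT _ _ _ _ _ (@fr_C1 _) clamp_pair_cont).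
exact: (@continuous_compT _ _ _ _ _ (@fr_C1 _) clamp_pair_cont).
Qed.

Let rho_der x (s : R) : 0 < s < 1 ->
  is_derive s 1 (fun r => ln (rho (phi x r) r)) (al (phi x s) s).
Proof.
move=> s01.
have d1 := is_derive_curve fr_der fr_C1 (phi_der x s01).
have d2 := is_derive1_ln (rho_gt0 (phi x s) (s01W s01)).
have := @is_derive1_comp _ (@ln R) (fun r => fr (phi x r, r)) s _ _ d2 d1.
by rewrite mulrC.
Qed.

Let rho_dt0 x (s : R) : is_derive s 1 (rho x) ('D_(0, 1) fr (x, s)).
Proof.
apply: (@is_derive_reparam _ _ _ _ fr _ (x, s) (0, 1)).
  by move=> h; rewrite /fr/= scaler0 add0r.
exact/derivableP.
Qed.

Let dtlogE x s : 0 <= s <= 1 -> dtlog rho x s = 'D_(0, 1) fr (x, s) / rho x s.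
Proof.
move=> s01; rewrite /dtlog derive1E.
have d2 := is_derive1_ln (rho_gt0 x s01).
have [_ ->] := @is_derive1_comp _ (@ln R) (rho x) s _ _ d2 (rho_dt0 x s).
by rewrite mulrC.
Qed.

Let rho_dt x (s : R) : 0 < s < 1 -> is_derive s 1 (rho x) (rho x s * dtlog rho x s).
Proof.
move=> s01; rewrite dtlogE ?s01W// mulrC divfK; first exact: rho_dt0.
by rewrite gt_eqF// rho_gt0// s01W.
Qed.

Let h_cont : continuous (fun z : 'rV[R]_D * R => dtlog rho z.1 (clamp 1 z.2)).
Proof.
rewrite (_ : (fun z => _) = (fun z => 'D_(0, 1) fr (z.1, clamp 1 z.2) / rho z.1 (clamp 1 z.2))).
  apply: continuous_mulT => //.
  exact: (@continuous_compT _ _ _ _ _ (@fr_C1 _) clamp_pair_cont).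
by apply/funext => z; rewrite dtlogE//; exact: clampP.
Qed.

Let h_le x s : 0 <= s <= t -> `|dtlog rho x s| <= M2.
Proof. by move=> st; rewrite ltW// h_lt. Qed.

Let t1 s : 0 <= s <= t -> 0 <= s <= 1.
Proof. by case/andP: t01 => _ t1' /andP[-> st]; rewrite (le_trans st). Qed.

Let t_ge0 : 0 <= t. Proof. by case/andP: t01 => /ltW. Qed.

Let ctP s : 0 <= clamp t s <= t. Proof. exact: clampP. Qed.

Let M2_ge0 : 0 <= M2. Proof. exact: le_trans (normr_ge0 _) (h_le 0 (ctP 0)). Qed.

(** By the chain rule the score term and the time derivative add up to the derivative of [ln rho]
    along the flow; this is what turns [err] into [rate] minus a function of time. *)
Let scoreE x s : 0 <= s <= 1 ->
  dotv (score rho x s) (v x s) + dtlog rho x s = al x s.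
Proof.
move=> s01; rewrite dtlogE// /al mulrDl; congr (_ + _).
rewrite mulr_suml; apply: eq_bigr => j _; rewrite !mxE /partial.
have d1 : is_derive x (basis_vec R j) (fun y => rho y s) ('D_(basis_vec R j, 0) fr (x, s)).
  apply: (@is_derive_reparam _ _ _ _ fr _ (x, s) (basis_vec R j, 0)).
    by move=> h; rewrite /fr/= scaler0 add0r.
  exact/derivableP.
have d1' : is_derive (0 : R) 1 (fun h => rho (h *: basis_vec R j + x) s)
    ('D_(basis_vec R j, 0) fr (x, s)).
  apply: (@is_derive_reparam _ _ _ _ (fun y => rho y s) _ x (basis_vec R j)) => // h.
  by rewrite addr0 [h *: 1]mulr1.
have r0 : 0 < rho (0 *: basis_vec R j + x) s by exact: rho_gt0.
have d2 := @is_derive1_comp _ (@ln R) (fun h => rho (h *: basis_vec R j + x) s) 0 _ _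
    (is_derive1_ln r0) d1'.
have d3 : is_derive x (basis_vec R j) (fun y => ln (rho y s))
    ((rho (0 *: basis_vec R j + x) s)^-1 * 'D_(basis_vec R j, 0) fr (x, s)).
  apply: (is_derive_reparam _ d2) => h /=.
  by rewrite addr0 [h *: 1]mulr1.
have [_ ->] := d3; rewrite scale0r add0r; ring.
Qed.

Let divE x s : div (fun y => v y s) x = \sum_j b j x s.
Proof. by apply: eq_bigr => j _; rewrite /partial; have [_ ->] := v_der j s x. Qed.

Let es r := Estar rho r (fun y => dtlog rho y r).

Let errE x r : 0 <= r <= 1 -> err rho v (flow x r) r = rate b al (phi x r, r) - es r.
Proof.
move=> r01; rewrite /err /gfun addrA -addrA -/(es r).
rewrite /rate /= clampK// phiE// -scoreE// divE; ring.
Qed.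

Let rho0_mass' : lebRn (fun x => (rho x 0)%:E) = 1%E. Proof. exact: rho0_mass. Qed.

Let mass_pos s : 0 <= s <= t -> 0 < mass rho s.
Proof. exact: (mass_gt0 t01 fr_cont rho_gt0 rho_dt h_le rho0_mass'). Qed.

Let m_rho_joint : measurable_fun setT (fun z : R * D.-tuple R => rho (untup z.2) (clamp t z.1)).
Proof.
apply: (@measurable_continuous_rV _ _ _ _ fr (fun z : R * D.-tuple R => untup z.2) (fun z =>
    clamp t z.1)) => //.
  by move=> j; exact: (measurableT_comp (measurable_untup j) measurable_snd).
apply: (measurableT_comp _ measurable_fst); apply: continuous_measurable_fun;
    exact: clamp_continuous.
Qed.

Let m_h_joint : measurable_fun setT (fun z : R * D.-tuple R => dtlog rho (untup z.2) (clamp t z.1)).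
Proof.
rewrite (_ : (fun z => _) = (fun z : R * D.-tuple R => dtlog rho (untup z.2)
    (clamp 1 (clamp t z.1)))).
  apply: (@measurable_continuous_rV _ _ _ _ (fun z : 'rV[R]_D * R => dtlog rho z.1 (clamp 1 z.2))
    (fun z : R * D.-tuple R => untup z.2) (fun z => clamp t z.1)) => //.
    by move=> j; exact: (measurableT_comp (measurable_untup j) measurable_snd).
  apply: (measurableT_comp _ measurable_fst); apply: continuous_measurable_fun;
      exact: clamp_continuous.
by apply/funext => z; rewrite (clampK (t := 1))//; exact: t1.
Qed.

Let es_measurable : measurable_fun setT (fun r => es (clamp t r)).
Proof.
apply: (measurableT_comp (@fine_measurable R setT measurableT)).
apply: (@lebRn_measurable R D _ R (fun r x => (rho_star rho x (clamp t r) * dtlog rho x (clamp t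
    r))%:E)).
apply/measurable_EFinP; apply: measurable_funM => //; apply: measurable_funM => //.
apply: (@measurableT_comp _ _ _ _ _ _ (fun r => (mass rho (clamp t r))^-1) _ fst);
    last exact: measurable_fst.
apply: continuous_measurable_fun => r; apply: cvgV; first by rewrite gt_eqF// mass_pos.
exact: (mass_ct_cont t01 fr_cont rho_gt0 rho_dt h_le rho0_mass').
Qed.

(** Normalized by the mass, [rho] integrates to 1, so the expectation of a function bounded by [M2]
    is bounded by [M2]. *)
Let es_le r : 0 <= r <= t -> `|es r| <= M2.
Proof.
move=> rt.
have mr : measurable_fun setT (fun u => rho (untup u) r).
  have := measurableT_comp m_rho_joint (pair1_measurable r).
  by apply: eq_measurable_fun => u _ /=; rewrite clampK.
have mh : measurable_fun setT (fun u => dtlog rho (untup u) r).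
  have := measurableT_comp m_h_joint (pair1_measurable r).
  by apply: eq_measurable_fun => u _ /=; rewrite clampK.
have Z0 := mass_pos rt.
have mrs : measurable_fun setT (fun u => rho_star rho (untup u) r) by exact: measurable_funM.
have r0 x : 0 <= rho x r by apply/ltW/rho_gt0/t1.
have rs0 x : 0 <= rho_star rho x r by rewrite mulr_ge0// invr_ge0 ltW.
have mf : measurable_fun setT (fun u => (rho_star rho (untup u) r * dtlog rho (untup u) r)%:E).
  by apply/measurable_EFinP; exact: measurable_funM.
have H1 := le_abse_lebRn (f := fun x => (rho_star rho x r * dtlog rho x r)%:E) mf.
have H2 : (lebRn (fun x : 'rV[R]_D => `|(rho_star rho x r * dtlog rho x r)%:E|) <=
    lebRn (fun x => ((M2 / mass rho r) * rho x r)%:E))%E.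
  apply: ge0_le_lebRn => //.
  - exact: measurableT_comp.
  - by apply/measurable_EFinP; exact: measurable_funM.
  - move=> x; rewrite lee_fin normrM ger0_norm// /rho_star -[fine _]/(mass rho r).
    by rewrite [leLHS]mulrAC [leRHS]mulrAC ler_wpM2r ?invr_ge0 ?(ltW Z0)// mulrC ler_wpM2r// h_le.
have [m mE] := lebRn_measure R D.
have Zfin : lebRn (fun x => (rho x r)%:E) = (mass rho r)%:E.
  rewrite /mass fineK//; move: Z0; rewrite /mass.
  by case: (lebRn _) => //; rewrite ltxx.
have H3 : lebRn (fun x => ((M2 / mass rho r) * rho x r)%:E) = M2%:E.
  transitivity (\int[m]_u ((M2 / mass rho r)%:E * (rho (untup u) r)%:E))%E.
    rewrite mE.
    - by apply: eq_lebRn => x; rewrite tupK.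
    - by apply: emeasurable_funM => //; exact/measurable_EFinP.
    - by move=> u; rewrite -EFinM lee_fin mulr_ge0// divr_ge0// ltW.
  rewrite ge0_integralZl//; last 3 first.
  - exact/measurable_EFinP.
  - by move=> u _; rewrite lee_fin.
  - by rewrite lee_fin divr_ge0// ltW.
  rewrite mE; [|exact/measurable_EFinP|by move=> u; rewrite lee_fin].
  rewrite (eq_lebRn (g := fun x => (rho x r)%:E)); last by move=> x; rewrite tupK.
  by rewrite Zfin -EFinM divfK// gt_eqF.
have := le_trans H1 H2; rewrite H3 /es /Estar.
by case: (lebRn _) => [x||] //=; rewrite ?normr0.
Qed.

Let es_int s : 0 <= s <= t -> mu.-integrable `[0, s] (EFin \o es).
Proof.
move=> /andP[s0 st].
have sub : forall r, `[0, s]%classic r -> 0 <= r <= t.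
  by move=> r /=; rewrite in_itv/= => /andP[-> rs]; rewrite (le_trans rs).
have mI : measurable (`[0, s]%classic : set R) by exact: measurable_itv.
apply: (@measurable_bounded_integrable _ _ _ mu es _ mI).
- by apply: compact_finite_measure; exact: segment_compact.
- apply: eq_measurable_fun (measurable_funTS es_measurable).
  by move=> r; rewrite inE => /sub rt; rewrite clampK.
- exists M2; split; first exact: num_real.
  by move=> y My r /sub rt /=; rewrite (le_trans (es_le rt))// ltW.
Qed.

(* The expectation subtracted in [gfun] contributes a factor common to all samples, which
   cancels in the normalized weights. *)
Let kappa s := expR (- Rintegral mu `[0, s] es).

Let wtildeE x s : 0 <= s <= t -> wtilde rho v flow s x = weight b phi al x s * kappa s.
Proof.
move=> st; rewrite /wtilde /weight /kappa -expRD; congr expR.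
rewrite /primitive -RintegralB//; last exact: es_int.
  apply: eq_Rintegral => r; rewrite inE/= in_itv/= => /andP[r0 rs]; apply: errE.
  by apply: t1; rewrite r0 (le_trans rs)//; case/andP: st.
apply: integrable_continuous_segment.
exact: (continuous_compT (rate_cont b_cont al_cont) (phi_pair_cont phi_cont (x := x))).
Qed.

(** On an interval of length at most 1 the integral of [es] is at most [M2], so [kappa] is at least
    [expR (- M2)] and the bound on [wtilde] passes to [weight] at the cost of the inverse factor. *)
Let weight_le x s : 0 <= s <= t -> weight b phi al x s <= M1 * expR M2.
Proof.
move=> st; have [s0 st'] := andP st.
have k0 : 0 < kappa s by exact: expR_gt0.
have := w_le x st; rewrite wtildeE// normrM (gtr0_norm (expR_gt0 _)) (gtr0_norm k0).
move=> /ltW; rewrite -ler_pdivlMr// => /le_trans; apply.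
have M10 : 0 <= M1 by exact: le_trans (normr_ge0 _) (ltW (w_le x st)).
rewrite ler_wpM2l// /kappa expRN invrK ler_expR (le_trans (ler_norm _))//.
have ies := es_int st.
apply: (le_trans (le_normr_Rintegral _ ies)) => //.
have iM : mu.-integrable `[0, s] (EFin \o cst M2).
  by apply: integrable_continuous_segment; exact: continuous_cstT.
apply: (@le_trans _ _ (Rintegral mu `[0, s] (cst M2))).
  apply: le_Rintegral => //.
    exact: (integrable_norm ies).
  move=> r /=; rewrite in_itv/= => /andP[r0 rs]; apply: es_le.
  by rewrite r0 (le_trans rs).
rewrite Rintegral_cst//= lebesgue_measure_itv/= lte_fin.
case: ifP => _ /=; last by rewrite mulr0.
by rewrite subr0 ler_piMr//; case/andP: (t1 st).
Qed.

Context {d : measure_display} {Omega : measurableType d} (P : probability Omega R).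
Variable X : nat -> Omega -> 'rV[R]_D.
Hypothesis mX : forall i, measurable_fun [set: Omega] (fun w => tup (X i w)).
Hypothesis indepX : mutually_independent P (fun i w => tup (X i w)).
Hypothesis lawX : forall i (A : set (D.-tuple R)), measurable A ->
  P ((fun w => tup (X i w)) @^-1` A) = lebRn (fun x => (ind_tup A x * rho x 0)%:E).

Lemma WN_self_normalized N x s : 0 <= s <= t ->
  WN rho v flow N x s = self_normalized b phi al (dtlog rho) N x s.
Proof.
move=> st; rewrite /WN /self_normalized mulr_suml; apply: eq_bigr => i _.
rewrite /wnorm wtildeE// (eq_bigr (fun j : 'I_N => weight b phi al (x j) s * kappa s)); last first.
  by move=> j _; rewrite wtildeE.
have k0 : kappa s != 0 by rewrite gt_eqF// expR_gt0.
rewrite -mulr_suml phiE ?t1// invfM mulrACA divff// mulr1; ring.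
Qed.

Lemma WN_integral_cvg : {ae P, forall w,
  (fun N : nat => Rintegral mu `[0, t] (fun s => WN rho v flow N (fun i => X i w) s))
    @ \oo --> ln (fine (Zc rho t))}.
Proof.
have [V0 v0] := v0_bound.
have := self_normalized_cvg v_contj b_cont v_der L_ge1 v_lip' v0 phi0 phi_cont phi_der phi_clamp
  fr_cont rho_gt0 al_cont rho_der t01 rho_dt h_cont h_le rho0_mass' weight_le mX indepX lawX.
apply: filterS => w; rewrite /mass -/(Zc rho t).
have -> // : (fun N => Rintegral mu `[0, t] (fun s => WN rho v flow N (fun i => X i w) s)) =
  (fun N => Rintegral mu `[0, t] (self_normalized b phi al (dtlog rho) N (fun i => X i w))).
apply/funext => N; apply: eq_Rintegral => s; rewrite inE/= in_itv/= => st.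
exact: WN_self_normalized.
Qed.

End Main.

Theorem theorem2 (R : realType) (D : nat) (hD : (0 < D)%N)
  (rho : 'rV[R]_D -> R -> R)          (* unnormalized density rho~_*(x,t) *)
  (v : 'rV[R]_D -> R -> 'rV[R]_D)     (* velocity field v_theta(x,t) *)
  (flow : 'rV[R]_D -> R -> 'rV[R]_D)  (* x(t; x0) *)
  (rho_theta : 'rV[R]_D -> R -> R)    (* density of x(t; x0), x0 ~ mu *)
  (t : R) (M1 M2 : R)
  {d : measure_display} (Omega : measurableType d) (P : probability Omega R)
  (X : nat -> Omega -> 'rV[R]_D) :
  (* standing assumptions on rho~_* *)
  smooth (fun z : 'rV[R]_D * R => rho z.1 z.2) ->
  (forall (x : 'rV[R]_D) (s : R), 0 <= s <= 1 -> 0 < rho x s) ->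
  (forall s : R, 0 <= s <= 1 -> (Zc rho s < +oo)%E) ->
  Zc rho 0 = 1%E ->
  (* standing assumptions on v_theta *)
  smooth (fun z : 'rV[R]_D * R => v z.1 z.2) ->
  (exists L : R, forall x y s, 0 <= s <= 1 ->
      `|v x s - v y s| <= L * `|x - y|) ->
  (* flow solves x' = v(x,t), x(0) = x0 on [0,1] *)
  (forall x0 : 'rV[R]_D, flow x0 0 = x0) ->
  (forall x0 : 'rV[R]_D, {within `[0, 1], continuous (flow x0)}) ->
  (forall (x0 : 'rV[R]_D) (s : R), 0 < s < 1 -> is_derive s 1 (flow x0) (v (flow x0 s) s)) ->
  (* rho_theta(.,s) is the density of flow x0 s when x0 ~ mu = rho~(.,0) *)
  (forall s : R, 0 <= s <= 1 -> forall A : set (D.-tuple R), measurable A ->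
     lebRn (fun x0 => (ind_tup A (flow x0 s) * rho x0 0)%:E) =
     lebRn (fun x => (ind_tup A x * rho_theta x s)%:E)) ->
  (* the theorem's hypotheses *)
  0 <= t <= 1 ->
  (forall s : R, 0 <= s <= t ->
     borel_fun (fun x => dtlog rho x s) /\
     (lebRn (fun x => (rho_star rho x s * `|dtlog rho x s|)%:E) < +oo)%E) ->
  (forall (x : 'rV[R]_D) (s : R), 0 <= s <= t -> 0 < rho_star rho x s -> 0 < rho_theta x s) ->
  (forall (s : R) (x0 : 'rV[R]_D), 0 <= s <= t -> `|wtilde rho v flow s x0| < M1) ->
  (forall (x : 'rV[R]_D) (s : R), 0 <= s <= t -> `|dtlog rho x s| < M2) ->
  (* i.i.d. samples x0^(1), x0^(2), ... from mu *)
  (forall i, measurable_fun [set: Omega] (fun w => tup (X i w))) ->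
  mutually_independent P (fun i w => tup (X i w)) ->
  (forall i (A : set (D.-tuple R)), measurable A ->
     P ((fun w => tup (X i w)) @^-1` A) = lebRn (fun x => (ind_tup A x * rho x 0)%:E)) ->
  {ae P, forall w,
     (fun N : nat => Rintegral (@lebesgue_measure R) `[0, t]
                       (fun s => WN rho v flow N (fun i => X i w) s))
       @ \oo --> ln (fine (Zc rho t))}.
Proof.
move=> rho_smooth rho_gt0 _ rho0 v_smooth [L v_lip] flow0 flow_cont flow_der _.
move=> /andP[t0 t1] _ _ w_le h_lt mX indepX lawX.
(* The differentiation of the mass takes place on an open interval, so [t = 0] is treated apart: the
   integral is over a point and [ln 1 = 0]. *)
have [t_eq0|t_neq0] := eqVneq t 0.
  apply: aeW => w; rewrite t_eq0 rho0 /= ln1.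
  rewrite (_ : (fun N : nat => _) = cst 0); first exact: cvg_cst.
  by apply/funext => N; rewrite set_itv1 Rintegral_set1.
case: D hD rho v flow rho_theta X rho_smooth rho_gt0 rho0 v_smooth v_lip flow0
  flow_cont flow_der w_le h_lt mX indepX lawX => // n _ *.
by apply: WN_integral_cvg; eauto; rewrite lt_neqAle eq_sym t_neq0 t0.
Qed.
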